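(* Consider the linear Gaussian model described in the context, with horizon $T\ge 1$ and capacity $B>0$, and the capacity-constrained prediction problem $$\min_{q_1,\dots,q_T}\ \sum_{t=1}^T \mathbb{E}\big[\|\theta_t-\hat\theta_t\|_2^2\big]\quad\text{s.t.}\quad \hat\theta_t\sim q_t(\cdot\mid H_t),\ \ \mathbb{I}(\hat\theta_t;H_t)\le B,\ \ t=1,\dots,T.$$ For each $t$, let $\bar\theta_t=\mathbb{E}[\theta_t\mid H_t]$, let $\lambda_{t1},\dots,\lambda_{td}$ be the eigenvalues of $\mathrm{Cov}[\bar\theta_t]$ and $U_t\in\mathbb{R}^{d\times d}$ an orthogonal matrix whose columns are corresponding eigenvectors. Let $\eta_t$ be the unique solution of $\sum_{i=1}^d[\log(2\lambda_{ti}/\eta)]^+=2B$, and set $B_{ti}=\frac12[\log(2\lambda_{ti}/\eta_t)]^+$. Define $D^F_t=\mathrm{diag}(1-e^{-2B_{t1}},\dots,1-e^{-2B_{td}})$ and $D^\Psi_t=\mathrm{diag}\big((1-e^{-2B_{t1}})e^{-2B_{t1}}\lambda_{t1},\dots,(1-e^{-2B_{td}})e^{-2B_{td}}\lambda_{td}\big)$, and $F_t=U_tD^F_tU_t^\top$, $\Psi_t=U_tD^\Psi_tU_t^\top$. Then an optimal solution of this problem is $$\hat\theta_t=F_t\bar\theta_t+\epsilon_t,\qquad t=1,\dots,T,$$ where $\epsilon_t\sim N(0,\Psi_t)$ is independent of $\theta_0$, $(\omega_s)$ and $(\nu_s)$.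
   Context: Model: $\theta_0\sim N(0,\Sigma_0)$ in $\mathbb{R}^d$; $\theta_{t+1}=A\theta_t+\omega_t$ for $t\ge0$ with $\omega_t$ i.i.d. $N(0,\Sigma_\omega)$; observations $Y_t=C\theta_t+\nu_t\in\mathbb{R}^m$ with $C\in\mathbb{R}^{m\times d}$ and $\nu_t$ i.i.d. $N(0,\Sigma_\nu)$; $\theta_0$, $(\omega_t)$, $(\nu_t)$ are mutually independent, and $A,C,\Sigma_0,\Sigma_\omega,\Sigma_\nu$ are known. $H_t=(Y_1,\dots,Y_t)$. ''$\hat\theta_t\sim q_t(\cdot\mid H_t)$'' means $\hat\theta_t$ is drawn from a conditional distribution given $H_t$ (so it is conditionally independent of the latent variables given $H_t$). $\mathbb{I}$ denotes mutual information; logarithms are natural, $[x]^+=\max\{x,0\}$. *)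

(* Defs.v *)
From HB Require Import structures.
From mathcomp Require Import all_boot all_order all_algebra.
From mathcomp Require Import all_classical all_reals all_analysis.
Set Implicit Arguments. Unset Strict Implicit. Unset Printing Implicit Defensive.
Import Order.TTheory GRing.Theory Num.Theory.
Local Open Scope classical_set_scope.
Local Open Scope ring_scope.

Section defs.
Context {R : realType} {dO : measure_display} {Om : measurableType dO}.
Variable P : probability Om R.

Definition rv_vec n (X : Om -> 'cV[R]_n) :=
  forall i : 'I_n, measurable_fun setT (fun w => X w i ord0).

(** generators of sigma(X): preimages of Borel sets under the coordinates *)
Definition vec_gen n (X : Om -> 'cV[R]_n) : set (set Om) :=
  [set E | exists i : 'I_n, exists2 B : set R, measurable B &
            E = (fun w => X w i ord0) @^-1` B].

Definition hist_gen m (Y : nat -> Om -> 'cV[R]_m) (t : nat) : set (set Om) :=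
  [set E | exists s, (1 <= s <= t)%N /\ vec_gen (Y s) E].

Definition latent_gen d m (th0 : Om -> 'cV[R]_d) (w : nat -> Om -> 'cV[R]_d)
    (nu : nat -> Om -> 'cV[R]_m) : set (set Om) :=
  vec_gen th0 `|` [set E | exists s, vec_gen (w s) E]
              `|` [set E | exists s, (1 <= s)%N /\ vec_gen (nu s) E].

Definition indep2 (G1 G2 : set (set Om)) :=
  forall A C, <<s G1 >> A -> <<s G2 >> C -> P (A `&` C) = (P A * P C)%E.

Definition mutual_indep (I : eqType) (F : I -> set (set Om)) :=
  forall (J : seq I) (A : I -> set Om), uniq J ->
    (forall j, j \in J -> <<s F j >> (A j)) ->
    P (\bigcap_(j in [set j | j \in J]) A j) = (\prod_(j <- J) P (A j))%E.

(** one-dimensional Gaussian law N(mu, v) (v = variance; v = 0 is the Dirac mass) *)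
Definition gauss1_law (mu v : R) (B : set R) : \bar R :=
  if v == 0 then (\1_B mu)%:E else normal_prob mu (Num.sqrt v) B.

(** X ~ N(mu, S) in R^n: every linear functional a^T X is N(a^T mu, a^T S a) *)
Definition is_gaussian n (X : Om -> 'cV[R]_n) (mu : 'cV[R]_n) (S : 'M[R]_n) :=
  forall a : 'cV[R]_n,
    0 <= (a^T *m S *m a) ord0 ord0 /\
    forall B : set R, measurable B ->
      P ((fun w => (a^T *m X w) ord0 ord0) @^-1` B)
      = gauss1_law ((a^T *m mu) ord0 ord0) ((a^T *m S *m a) ord0 ord0) B.

Definition lin_gauss_model d m (A : 'M[R]_d) (C : 'M[R]_(m, d))
    (S0 Sw : 'M[R]_d) (Sv : 'M[R]_m)
    (th w : nat -> Om -> 'cV[R]_d) (nu Y : nat -> Om -> 'cV[R]_m) :=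
  [/\ (rv_vec (th 0%N) /\ (forall s, rv_vec (w s)) /\ (forall s, rv_vec (nu s))),
      (is_gaussian (th 0%N) 0 S0 /\ (forall s, is_gaussian (w s) 0 Sw) /\
        (forall s, (1 <= s)%N -> is_gaussian (nu s) 0 Sv)),
      mutual_indep (fun i : option (nat + nat) =>
        match i with
        | None => vec_gen (th 0%N)
        | Some (inl s) => vec_gen (w s)
        | Some (inr s) => vec_gen (nu s.+1)
        end),
      (forall t x, th t.+1 x = A *m th t x + w t x) &
      (forall t x, (1 <= t)%N -> Y t x = C *m th t x + nu t x)].

Definition is_cond_exp n (X : Om -> 'cV[R]_n) (G : set (set Om))
    (Z : Om -> 'cV[R]_n) :=
  forall i : 'I_n,
    (forall B : set R, measurable B -> <<s G >> ((fun w => Z w i ord0) @^-1` B)) /\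
    P.-integrable setT (fun w => (Z w i ord0)%:E) /\
    forall D, <<s G >> D ->
      (\int[P]_(w in D) (X w i ord0)%:E = \int[P]_(w in D) (Z w i ord0)%:E)%E.

Definition mean_vec n (Z : Om -> 'cV[R]_n) : 'cV[R]_n :=
  \col_i fine (\int[P]_w (Z w i ord0)%:E)%E.
Definition cov_mx n (Z : Om -> 'cV[R]_n) : 'M[R]_n :=
  \matrix_(i, j) fine (\int[P]_w
     ((Z w i ord0 - mean_vec Z i ord0) * (Z w j ord0 - mean_vec Z j ord0))%:E)%E.

(** conditional independence of sigma(GX) and sigma(GZ) given sigma(GY):
    P(A | GY, GZ) has a sigma(GY)-measurable version, for every A in sigma(GX) *)
Definition cond_indep (GX GZ GY : set (set Om)) :=
  forall A, <<s GX >> A -> exists g : Om -> R,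
    (forall B : set R, measurable B -> <<s GY >> (g @^-1` B)) /\
    P.-integrable setT (fun w => (g w)%:E) /\
    forall D, <<s GY `|` GZ >> D -> P (A `&` D) = (\int[P]_(w in D) (g w)%:E)%E.

Definition is_partition (G : set (set Om)) k (A : 'I_k -> set Om) :=
  [/\ forall i, <<s G >> (A i),
      forall i j, i != j -> A i `&` A j = set0 &
      \bigcup_(i in setT) A i = setT].

Definition mi_term (pab pa pb : R) : R :=
  if pab == 0 then 0 else pab * ln (pab / (pa * pb)).

(** mutual information I(X;Y) (Dobrushin / Gelfand-Yaglom-Perez): supremum
    over finite partitions from sigma(X) and sigma(Y), natural logarithm *)
Definition mutual_info (GX GY : set (set Om)) : \bar R :=
  ereal_sup [set x : \bar R | exists k l (A : 'I_k -> set Om) (B : 'I_l -> set Om),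
     [/\ is_partition GX A, is_partition GY B &
      x = (\sum_(i < k) \sum_(j < l)
             mi_term (fine (P (A i `&` B j))) (fine (P (A i))) (fine (P (B j))))%:E]].

Definition sq_obj d (T : nat) (th thh : nat -> Om -> 'cV[R]_d) : \bar R :=
  (\sum_(1 <= t < T.+1)
     \int[P]_w (\sum_(i < d) (th t w i ord0 - thh t w i ord0) ^+ 2)%:E)%E.

(** feasibility: hat theta_t ~ q_t(. | H_t) (a random vector conditionally
    independent of the latent variables given H_t) with I(hat theta_t; H_t) <= B *)
Definition feasible d m (T : nat) (Bc : R) (th w : nat -> Om -> 'cV[R]_d)
    (nu Y : nat -> Om -> 'cV[R]_m) (thh : nat -> Om -> 'cV[R]_d) :=
  forall t, (1 <= t <= T)%N ->
    [/\ rv_vec (thh t),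
        cond_indep (vec_gen (thh t)) (latent_gen (th 0%N) w nu) (hist_gen Y t) &
        (mutual_info (vec_gen (thh t)) (hist_gen Y t) <= Bc%:E)%E].

End defs.

Section mats.
Context {R : realType}.
Definition capB d (lam : 'I_d -> R) (eta : R) (i : 'I_d) : R :=
  2^-1 * Num.max (ln (2 * lam i / eta)) 0.
Definition F_mx d (U : 'M[R]_d) (lam : 'I_d -> R) (eta : R) : 'M[R]_d :=
  U *m diag_mx (\row_i (1 - expR (- (2 * capB lam eta i)))) *m U^T.
Definition Psi_mx d (U : 'M[R]_d) (lam : 'I_d -> R) (eta : R) : 'M[R]_d :=
  U *m diag_mx (\row_i ((1 - expR (- (2 * capB lam eta i)))
                         * expR (- (2 * capB lam eta i)) * lam i)) *m U^T.
End mats.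

(* Main.v *)
Require Import Defs.
From HB Require Import structures.
From mathcomp Require Import all_boot all_order all_algebra.
From mathcomp Require Import all_classical all_reals all_analysis.
From mathcomp Require Import measurable_realfun ring lra.
Import Order.TTheory GRing.Theory Num.Theory.
Import numFieldNormedType.Exports.
Set Implicit Arguments. Unset Strict Implicit. Unset Printing Implicit Defensive.
Local Open Scope classical_set_scope.
Local Open Scope ring_scope.

(* Write H for the history, X for theta_t and Z for E[X | H] in an eigenbasis of
   its covariance. Jointly Gaussian variables are handled through moment
   generating functions only: the mgf of (X, H) is exp(Q/2) with a quadratic form
   Q determined by A, C and the covariances, so the regression matrix, the
   covariance of Z and the residual variance are the same in every realization
   of the model; that X - E[X | H] is uncorrelated with H upgrades to conditional
   mean zero because an everywhere finite mgf determines a (signed) measure. The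
   distortion then splits into the residual variance plus E|Z - hat theta|^2.

   With rho_i = exp(-2 B_i), let f(z, y) be the sum over i of
   - (1 - rho_i) z_i^2 / eta + (2 z_i y_i - y_i^2) / eta + B_i. Water-filling gives
   E exp(f(Z, y)) <= 1 for every y, so quantizing and applying Gibbs' inequality
   yields E f(Z, Y) <= I(Y; H) for every candidate Y, which rearranges to
   E|Z - Y|^2 >= sum_i rho_i lambda_i. For the proposed channel exp(- f(Z, Y)) is
   the density of the product of the marginals with respect to the joint law;
   hence, by Jensen's inequality on every cell of a partition,
   I(Y; H) <= E f(Z, Y) = sum_i B_i, and the distortion bound is attained. *)

(** * Expectations *)

(** Two obstacles shape the proof. The covariances may be singular, so no joint density is
    available: degenerate laws are handled as Dirac masses, and regression rests on solvability of
    the normal equations instead of inversion. And mutual information is a supremum over finite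
    partitions, so there is no log-density to integrate: both bounds are obtained on partitions from
    the tangent inequality 1 + x <= exp x alone, without a chain rule or data processing. The
    function f is a dual certificate. Up to terms in z alone it is -|z - y|^2 / eta, so 1 / eta is
    the multiplier of the capacity constraint; the bound on E exp(f(Z, y)) for each fixed y is dual
    feasibility. On a coordinate above the water level that factor equals 1, and on one below it the
    bound is exactly 2 lambda_i <= eta. Since f is also the log-density of the optimal channel, the
    same expression serves for both bounds. *)

Section hasE.
Context {d : measure_display} {T : measurableType d} {R : realType}.
Variable mu : {measure set T -> \bar R}.
Implicit Types (f g : T -> R) (a b v : R).

(** Integrability is bundled with the value because linearity of the integral needs it; constants
    computed in two ways are then identified by [hasE_unique]. *)
Definition hasE f v :=
  mu.-integrable setT (EFin \o f) /\ (\int[mu]_x (f x)%:E = v%:E)%E.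

Lemma hasE_mfun f v : hasE f v -> measurable_fun setT f.
Proof. by case=> /measurable_int/measurable_EFinP. Qed.

Lemma hasE_unique f a b : hasE f a -> hasE f b -> a = b.
Proof. by move=> [_ fa] [_]; rewrite fa => -[]. Qed.

Lemma integrable_hasE f : mu.-integrable setT (EFin \o f) ->
  exists v, hasE f v.
Proof.
move=> fi; exists (fine (\int[mu]_x (f x)%:E)%E); split=> //.
by rewrite fineK// (integrable_fin_num _ fi).
Qed.

Lemma eq_hasE f g v : f =1 g -> hasE f v -> hasE g v.
Proof. by move=> /funext ->. Qed.

Lemma hasED f g a b : hasE f a -> hasE g b -> hasE (fun x => f x + g x) (a + b).
Proof.
move=> [fi fa] [gi gb]; split.
  by have := integrableD measurableT fi gi; apply: eq_integrable.
under eq_integral do rewrite EFinD.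
by rewrite (integralD_EFin _ fi gi)// fa gb.
Qed.

Lemma hasEZ f a k : hasE f a -> hasE (fun x => k * f x) (k * a).
Proof.
move=> [fi fa]; split.
  by have := integrableZl measurableT k fi; apply: eq_integrable.
under eq_integral do rewrite EFinM.
by rewrite (integralZl _ fi)// fa.
Qed.

Lemma hasEN f a : hasE f a -> hasE (fun x => - f x) (- a).
Proof.
move=> /(hasEZ (-1)); rewrite mulN1r; apply: eq_hasE => x.
by rewrite mulN1r.
Qed.

Lemma hasEB f g a b : hasE f a -> hasE g b -> hasE (fun x => f x - g x) (a - b).
Proof. by move=> fa /hasEN; exact: hasED. Qed.

Lemma hasE0 : hasE (fun=> 0) 0.
Proof. by split; [exact: integrable0|rewrite integral0]. Qed.

Lemma hasE_sum (I : Type) (s : seq I) (Q : pred I) (f : I -> T -> R) (v : I -> R) :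
  (forall i, Q i -> hasE (f i) (v i)) ->
  hasE (fun x => \sum_(i <- s | Q i) f i x) (\sum_(i <- s | Q i) v i).
Proof.
move=> fv; elim: s => [|i s ih].
  by rewrite big_nil; apply: eq_hasE hasE0 => x; rewrite big_nil.
rewrite big_cons; case: ifP => Qi.
  by apply: eq_hasE (hasED (fv i Qi) ih) => x; rewrite big_cons Qi.
by apply: eq_hasE ih => x; rewrite big_cons Qi.
Qed.

Lemma hasE_le f g a b : hasE f a -> hasE g b -> (forall x, f x <= g x) -> a <= b.
Proof.
move=> [fi fa] [gi gb] fg; rewrite -lee_fin -fa -gb.
by apply: le_integral => // x _; rewrite lee_fin.
Qed.

Lemma hasE_ge0 f a : hasE f a -> (forall x, 0 <= f x) -> 0 <= a.
Proof. by move=> fa; apply: hasE_le hasE0 fa. Qed.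

Lemma dom_integrable f g : measurable_fun setT f ->
  (forall x, `|f x| <= g x) -> mu.-integrable setT (EFin \o g) ->
  mu.-integrable setT (EFin \o f).
Proof.
move=> mf fg gi; apply: le_integrable gi => //; first exact/measurable_EFinP.
by move=> x _ /=; rewrite lee_fin (le_trans (fg x))// ler_norm.
Qed.

Lemma ge0_hasE f v : measurable_fun setT f -> (forall x, 0 <= f x) ->
  (\int[mu]_x (f x)%:E = v%:E)%E -> hasE f v.
Proof.
move=> mf f0 fv; split=> //; apply/integrableP; split.
  exact/measurable_EFinP.
by under eq_integral do rewrite /= ger0_norm//; rewrite fv ltry.
Qed.

Lemma hasE_norm f v : hasE f v -> mu.-integrable setT (EFin \o (fun x => `|f x|)).
Proof. by case=> fi _; exact: (integrable_norm fi). Qed.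

Lemma hasE_dct (f_ : nat -> T -> R) f g (a_ : nat -> R) :
  (forall n, hasE (f_ n) (a_ n)) ->
  (forall x, f_ n x @[n --> \oo] --> f x) ->
  (forall n x, `|f_ n x| <= g x) ->
  mu.-integrable setT (EFin \o g) ->
  exists2 a, hasE f a & a_ n @[n --> \oo] --> a.
Proof.
move=> fa ff fg gi.
have mf : measurable_fun setT f.
  apply: (@measurable_fun_cvg _ _ _ setT f_) => //.
  by move=> n; exact: hasE_mfun (fa n).
have [||||fi _ ic] := @dominated_convergence _ _ _ mu setT measurableT
    (fun n => EFin \o f_ n) (EFin \o f) (EFin \o g) _ _ _ gi.
- by move=> n; apply/measurable_EFinP; exact: hasE_mfun (fa n).
- exact/measurable_EFinP.
- by apply/aeW => x _; apply/fine_cvgP; split; [exact: nearW|exact: ff].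
- by apply/aeW => x n _ /=; rewrite lee_fin.
have [a ha] := integrable_hasE fi.
exists a => //; move: ic; rewrite (proj2 ha).
under eq_fun do rewrite (proj2 (fa _)).
by move/fine_cvgP => [].
Qed.

End hasE.
Arguments hasE {d T R} mu f v.

Section hasE_prob.
Context {d : measure_display} {T : measurableType d} {R : realType}.
Variable P : probability T R.

Lemma hasE_cst (k : R) : hasE P (fun=> k) k.
Proof.
split; first exact: (finite_measure_integrable_cst P).
by rewrite integral_cst// [X in (_ * X)%E](probability_setT P) mule1.
Qed.

Lemma hasE_indic (A : set T) : measurable A -> hasE P \1_A (fine (P A)).
Proof.
move=> mA; split; first exact: integrable_indic.
by rewrite integral_indic// setIT fineK// fin_num_measure.
Qed.

End hasE_prob.

Lemma pi_lambda_subset (T : pointedType) (G C : set (set T)) :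
  setI_closed G -> G `<=` C -> C setT ->
  (forall A, <<s G >> A -> C A -> C (~` A)) ->
  (forall F : (set T)^nat, (forall n, <<s G >> (F n)) -> trivIset setT F ->
     (forall n, C (F n)) -> C (\bigcup_k F k)) ->
  <<s G >> `<=` C.
Proof.
move=> GI GC CT CC CU A GA.
by apply: (@dynkin_induction _ (g_sigma_algebraType G) G C).
Qed.

(** * Moment generating functions determine measures *)

Section real_sequences.
Context {R : realType}.
Implicit Types x y a : R.

Lemma expRB1_le y : expR y - 1 <= y * expR y.
Proof.
have := expR_ge1Dx (- y); rewrite expRN => h.
have e0 := expR_gt0 y.
rewrite lerBlDr -lerBlDl -{1}(mul1r (expR y)) -mulrBl.
by rewrite -ler_pdivlMr// div1r.
Qed.

Lemma normr_expRB1 y : `|expR y - 1| <= `|y| * expR `|y|.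
Proof.
rewrite ler_norml; apply/andP; split.
  have h1 : y <= expR y - 1 by rewrite lerBrDl expR_ge1Dx.
  apply: le_trans h1.
  rewrite lerNl; apply: (@le_trans _ _ `|y|); first by rewrite -normrN ler_norm.
  by rewrite ler_peMr// -expR0 ler_expR.
apply: le_trans (expRB1_le y) _.
apply: (@le_trans _ _ (`|y| * expR y)).
  by rewrite ler_wpM2r ?expR_ge0 ?ler_norm.
by rewrite ler_wpM2l// ler_expR ler_norm.
Qed.

Lemma cvg_divn_0 x : x / n.+1%:R @[n --> \oo] --> (0 : R).
Proof.
rewrite -[X in _ --> X](mulr0 x); apply: cvgM; first exact: cvg_cst.
exact: cvg_harmonic.
Qed.

Lemma cvg_expRB1 x : (expR (x / n.+1%:R) - 1) * n.+1%:R @[n --> \oo] --> x.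
Proof.
apply: (@squeeze_cvgr _ _ _ _ (fun=> x) (fun n => x * expR (x / n.+1%:R))).
- apply: nearW => n; have n0 : 0 < n.+1%:R :> R by [].
  rewrite -ler_pdivrMr// lerBrDl expR_ge1Dx/=.
  have := expRB1_le (x / n.+1%:R).
  by rewrite -(ler_pM2r n0) mulrAC divfK// gt_eqF.
- exact: cvg_cst.
- rewrite -[X in _ --> X]mulr1; apply: cvgM; first exact: cvg_cst.
  rewrite -[X in _ --> X]expR0; apply: continuous_cvg; first exact: continuous_expR.
  exact: cvg_divn_0.
Qed.

(** The bound is free of [n], so powers of the difference quotients are dominated by exponentials,
    which a finite mgf makes integrable. *)
Lemma normr_expRB1n x n : `|(expR (x / n.+1%:R) - 1) * n.+1%:R| <= expR (2 * `|x|).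
Proof.
have n0 : 0 < n.+1%:R :> R by [].
have h : `|x / n.+1%:R| = `|x| / n.+1%:R by rewrite normrM normfV (ger0_norm (ltW n0)).
rewrite normrM (ger0_norm (ler0n _ _)).
apply: (@le_trans _ _ (`|x| * expR (`|x| / n.+1%:R))).
  by rewrite -ler_pdivlMr// mulrAC -h normr_expRB1.
rewrite mulrDl mul1r expRD; apply: ler_pM => //.
- by apply: le_trans (expR_ge1Dx _); rewrite lerDr.
- by rewrite ler_expR ler_pdivrMr// ler_peMr// ler1n.
Qed.

Lemma expR_norm_le x : expR `|x| <= expR x + expR (- x).
Proof.
by case: (ger0P x) => _; rewrite ?lerDl ?lerDr expR_ge0.
Qed.

Definition sin_poly n : {poly R} :=
  \poly_(i < n) ((odd i)%:R * (-1) ^+ i.-1./2 / i`!%:R).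

Lemma horner_sin_poly n y : (sin_poly n).[y] = series (sin_coeff y) n.
Proof.
rewrite horner_poly /series/= big_mkord; apply: eq_bigr => i _.
by rewrite /sin_coeff mulrAC.
Qed.

Lemma cvg_sin_poly y : (sin_poly n).[y] @[n --> \oo] --> sin y.
Proof.
under eq_fun do rewrite horner_sin_poly.
by rewrite unlock; exact: is_cvg_series_sin_coeff.
Qed.

Lemma series_exp_le y n : 0 <= y -> \sum_(i < n) (y ^+ i / i`!%:R) <= expR y.
Proof.
move=> y0; rewrite -(big_mkord xpredT (fun i => y ^+ i / i`!%:R)).
apply: (@nondecreasing_cvgn_le _ (series (exp_coeff y))).
  by apply: nondecreasing_series => i _ _; rewrite /exp_coeff/= divr_ge0// exprn_ge0.
exact: is_cvg_series_exp_coeff.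
Qed.

Lemma normr_sin_poly n y : `|(sin_poly n).[y]| <= expR `|y|.
Proof.
rewrite horner_poly; apply: le_trans (ler_norm_sum _ _ _) _.
apply: le_trans (series_exp_le n (normr_ge0 y)); apply: ler_sum => i _.
rewrite !normrM normrX normrV ?unitfE ?pnatr_eq0 -?lt0n ?fact_gt0//.
rewrite normrX normrN normr1 expr1n mulr1 normr_nat (ger0_norm (ler0n _ _)).
rewrite -mulrA [X in _ <= X]mulrC; apply: ler_piMl.
  by rewrite mulr_ge0.
by case: odd.
Qed.

Lemma sin_MVT y : exists2 c, `|c| <= `|y| & sin y = cos c * y.
Proof.
have H (z : R) : 0 <= z -> exists2 c, 0 <= c <= z & sin z = cos c * z.
  move=> z0.
  have [|c cz] := @MVT_segment R sin cos 0 z z0 _ _.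
    by apply: continuous_subspaceT => x; exact: continuous_sin.
  rewrite sin0 !subr0 => ->; exists c => //.
have [y0|y0] := leP 0 y.
  have [c /andP[c0 cy] ->] := H y y0; exists c => //.
  by rewrite !ger0_norm.
have [|c /andP[c0 cy]] := H (- y) _; first lra.
rewrite sinN => /eqP; rewrite eqr_oppLR => /eqP ->; exists c.
  by rewrite ger0_norm// ltr0_norm.
by rewrite mulrN opprK.
Qed.

Lemma normr_sin_le y : `|sin y| <= `|y|.
Proof.
have [c _ ->] := sin_MVT y; rewrite normrM ler_piMl//; exact: cos_max.
Qed.

Lemma cvg_sinn x : sin (x / n.+1%:R) * n.+1%:R @[n --> \oo] --> x.
Proof.
have /choice [c cP] : forall n, exists c,
    `|c| <= `|x / n.+1%:R| /\ sin (x / n.+1%:R) = cos c * (x / n.+1%:R).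
  by move=> n; have [c ? ?] := sin_MVT (x / n.+1%:R); exists c.
rewrite (_ : (fun n => _) = fun n => cos (c n) * x); last first.
  by apply/funext => n; rewrite (proj2 (cP n)) mulrA divfK ?pnatr_eq0.
rewrite -[X in _ --> X]mul1r; apply: cvgM; last exact: cvg_cst.
rewrite -[X in _ --> X]cos0; apply: continuous_cvg; first exact: continuous_cos.
apply/norm_cvg0P; apply: (@squeeze_cvgr _ _ _ _ (fun=> 0)
  (fun n => `|x / n.+1%:R|)).
- by apply: nearW => n; rewrite normr_ge0 (proj1 (cP n)).
- exact: cvg_cst.
- by apply/norm_cvg0P; exact: cvg_divn_0.
Qed.

(* This iteration increases to [`|x|] on [-1, 1]. *)
Fixpoint abs_poly n : {poly R} :=
  if n is n'.+1 then
    abs_poly n' + 2^-1 *: ('X ^+ 2 - abs_poly n' ^+ 2)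
  else 0.

(** With t = |s| and q the current value, one step multiplies the error t - q by 1 - (t + q) / 2.
    This lies in [0, 1 - t / 2] because 0 <= q <= t <= 1. *)
Lemma abs_polyP n s : `|s| <= 1 ->
  0 <= (abs_poly n).[s] <= `|s| /\
  `|s| - (abs_poly n).[s] <= `|s| * (1 - `|s| / 2) ^+ n.
Proof.
move=> s1; elim: n => [|n [/andP[ih0 ih1] ih2]]/=.
  by rewrite horner0 lexx normr_ge0 expr0 mulr1 subr0.
rewrite !(hornerD, hornerZ, hornerN, horner_exp, hornerX).
set q := (abs_poly n).[s] in ih0 ih1 ih2 *; rewrite -(real_normK (num_real s)).
set t := `|s| in s1 ih1 ih2 *.
have t0 : 0 <= t by exact: normr_ge0.
have E : t - (q + 2^-1 * (t ^+ 2 - q ^+ 2)) = (t - q) * (1 - (t + q) / 2).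
  by rewrite !expr2; lra.
split; last first.
  rewrite E exprS mulrCA mulrC; apply: ler_pM => //; lra.
apply/andP; split.
  by rewrite addr_ge0// mulr_ge0// subr_ge0 ler_pXn2r// nnegrE.
rewrite -subr_ge0 E mulr_ge0//; lra.
Qed.

Lemma cvg_abs_poly s : `|s| <= 1 -> (abs_poly n).[s] @[n --> \oo] --> `|s|.
Proof.
move=> s1; have [->|s0] := eqVneq s 0.
  rewrite normr0 (_ : (fun _ => _) = fun=> 0); first exact: cvg_cst.
  apply/funext => n; apply/eqP; have [] := @abs_polyP n 0 _; first by rewrite normr0.
  by rewrite normr0 -eq_le eq_sym.
have t0 : 0 < `|s| by rewrite normr_gt0.
apply: (@squeeze_cvgr _ _ _ _ (fun n => `|s| - `|s| * (1 - `|s| / 2) ^+ n)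
  (fun=> `|s|)).
- by apply: nearW => n; have [/andP[_ ->] h] := abs_polyP n s1; rewrite andbT; lra.
- rewrite -[X in _ --> X]subr0; apply: cvgB; first exact: cvg_cst.
  rewrite -[X in _ --> X](mulr0 `|s|); apply: cvgM; first exact: cvg_cst.
  by apply: cvg_expr; rewrite ger0_norm; lra.
- exact: cvg_cst.
Qed.
End real_sequences.

Lemma cvg_horner {R : realType} (p : {poly R}) (u : nat -> R) (l : R) :
  u n @[n --> \oo] --> l -> p.[u n] @[n --> \oo] --> p.[l].
Proof.
move=> ul; apply: (@continuous_cvg _ _ _ _ _ u (horner p) l) => //.
exact: continuous_horner.
Qed.

Lemma cvg_exprn {R : realType} k (u : nat -> R) (l : R) :
  u n @[n --> \oo] --> l -> u n ^+ k @[n --> \oo] --> l ^+ k.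
Proof.
move=> ul; have := @cvg_horner R 'X^k u l ul; rewrite hornerXn.
rewrite (_ : (fun n => _) = fun n => u n ^+ k)//.
by apply/funext => n; rewrite hornerXn.
Qed.

Section indic_trivIset.
Context {R : realType} {T : Type}.
Variables (F : (set T)^nat) (tF : trivIset setT F).

Let sum_indic_in n k x : F k x ->
  \sum_(i < n) \1_(F i) x = (k < n)%:R :> R.
Proof.
move=> Fkx.
have F0 i : i != k -> \1_(F i) x = 0 :> R.
  move=> ik; rewrite indicE memNset// => Fix; move/eqP: ik; apply.
  by apply: (tF I I); exists x.
have [kn|nk] := ltnP k n; last first.
  by rewrite big1// => i _; rewrite F0// neq_ltn (leq_trans (ltn_ord i) nk).
by rewrite (bigD1 (Ordinal kn))//= indicE mem_set// big1 ?addr0// => i /F0.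
Qed.

Let sum_indic_out n x : ~ (\bigcup_k F k) x -> \sum_(i < n) \1_(F i) x = 0 :> R.
Proof.
move=> nFx; rewrite big1// => i _; rewrite indicE memNset// => Fix.
by apply: nFx; exists (i : nat).
Qed.

Lemma sum_indic_le1 n x : \sum_(i < n) \1_(F i) x <= 1 :> R.
Proof.
have [[k _ /sum_indic_in ->]|/sum_indic_out ->] := pselect ((\bigcup_k F k) x) => //.
by case: leqP.
Qed.

Lemma cvg_sum_indic x :
  \sum_(i < n) \1_(F i) x @[n --> \oo] --> (\1_(\bigcup_k F k) x : R).
Proof.
rewrite indicE; have [[k _ Fkx]|nFx] := pselect ((\bigcup_k F k) x).
  rewrite mem_set; last by exists k.
  apply: cvg_near_cst; exists k.+1 => // n /= kn.
  by rewrite (sum_indic_in _ Fkx) kn.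
rewrite memNset// (_ : (fun n => _) = fun=> 0); first exact: cvg_cst.
by apply/funext => n; rewrite sum_indic_out.
Qed.

End indic_trivIset.

Section mgf_uniqueness.
Context {R : realType} {d1 d2 : measure_display}.
Context {T1 : measurableType d1} {T2 : measurableType d2}.
Variables (mu1 : {measure set T1 -> \bar R}) (mu2 : {measure set T2 -> \bar R}).
Variables (W1 X1 : T1 -> R) (W2 X2 : T2 -> R).

(** The class of such [h] is enlarged from exponentials by dominated limits: powers, polynomials,
    polynomials in a sine, |sin|, |x - a|, indicators of rays, indicators of Borel sets. The detour
    through the sine brings the argument into [-1, 1], where |.| is a bounded limit of polynomials.
    The weights may change sign. *)
Definition agree (h : R -> R) := exists v,
  hasE mu1 (fun x => W1 x * h (X1 x)) v /\ hasE mu2 (fun x => W2 x * h (X2 x)) v.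

Hypothesis agree_exp : forall t, agree (fun x => expR (t * x)).

Let eq_agree h h' : h =1 h' -> agree h -> agree h'.
Proof. by move=> /funext ->. Qed.

Let agreeD h h' : agree h -> agree h' -> agree (fun x => h x + h' x).
Proof.
move=> [v [v1 v2]] [u [u1 u2]]; exists (v + u); split.
  by apply: eq_hasE (hasED v1 u1) => x; rewrite mulrDr.
by apply: eq_hasE (hasED v2 u2) => x; rewrite mulrDr.
Qed.

Let agreeZ k h : agree h -> agree (fun x => k * h x).
Proof.
move=> [v [v1 v2]]; exists (k * v); split.
  by apply: eq_hasE (hasEZ k v1) => x; rewrite mulrCA.
by apply: eq_hasE (hasEZ k v2) => x; rewrite mulrCA.
Qed.

Let agree1 : agree (fun=> 1).
Proof. by apply: eq_agree (agree_exp 0) => x; rewrite mul0r expR0. Qed.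

Let agreeC k : agree (fun=> k).
Proof. by apply: eq_agree (agreeZ k agree1) => x; rewrite mulr1. Qed.

Let agree_sum n (h : 'I_n -> R -> R) :
  (forall i, agree (h i)) -> agree (fun x => \sum_(i < n) h i x).
Proof.
move=> ah; elim: n h ah => [|n ih] h ah.
  by apply: eq_agree (agreeC 0) => x; rewrite big_ord0.
apply: eq_agree (agreeD (ih (fun i => h (widen_ord (leqnSn n) i)) _) (ah ord_max)).
  by move=> x; rewrite big_ord_recr.
by move=> i; exact: ah.
Qed.

(** The hypothesis [agree_exp] at [c] and [- c] makes the bound integrable against both absolute
    weights. The common values of the [h_ n] then have one limit, which is the value on both
    sides. *)
Let agree_lim (h_ : nat -> R -> R) (h : R -> R) (c K : R) : (forall n, agree (h_ n)) ->
  (forall x, h_ n x @[n --> \oo] --> h x) ->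
  (forall n x, `|h_ n x| <= K * (expR (c * x) + expR (- (c * x)))) -> agree h.
Proof.
move=> ah hc hb.
have K0 : 0 <= K.
  have := le_trans (normr_ge0 _) (hb 0%N 0); rewrite mulr0 oppr0 expR0.
  by rewrite pmulr_lge0.
have [a a12] := choice ah.
have [e1 [p1 q1]] := agree_exp c; have [e2 [p2 q2]] := agree_exp (- c).
have dom dd (T : measurableType dd) (mu : {measure set T -> \bar R}) W X v v' :
  (forall n, hasE mu (fun x => W x * h_ n (X x)) (a n)) ->
  hasE mu (fun x => W x * expR (c * X x)) v ->
  hasE mu (fun x => W x * expR (- c * X x)) v' ->
  exists2 l, hasE mu (fun x => W x * h (X x)) l & a n @[n --> \oo] --> l.
  move=> ha hv hv'.
  have [u1 hu1] := integrable_hasE (hasE_norm hv).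
  have [u2 hu2] := integrable_hasE (hasE_norm hv').
  apply: (hasE_dct ha _ _ (proj1 (hasEZ K (hasED hu1 hu2)))) => /= [x|n x].
    by apply: cvgM; [exact: cvg_cst|exact: hc].
  rewrite !normrM !(ger0_norm (expR_ge0 _)) mulNr -mulrDr mulrCA ler_wpM2l//.
have [l1 h1 c1] := dom _ _ _ _ _ _ _ (fun n => proj1 (a12 n)) p1 p2.
have [l2 h2 c2] := dom _ _ _ _ _ _ _ (fun n => proj2 (a12 n)) q1 q2.
exists l1; split=> //; suff -> : l1 = l2 by [].
exact: (@cvg_unique _ (@Rhausdorff R) _ _ _ _ c1 c2).
Qed.

Let bound_sym (c x : R) : expR (`|c| * `|x|) <= expR (c * x) + expR (- (c * x)).
Proof. by rewrite -normrM expR_norm_le. Qed.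

Let agree_horner_exp (p : {poly R}) s : agree (fun x => p.[expR (s * x)]).
Proof.
apply: (@eq_agree (fun x => \sum_(i < size p) p`_i * expR ((i%:R * s) * x))).
  move=> x; rewrite horner_coef; apply: eq_bigr => i _.
  by rewrite -expRM_natl mulrA.
by apply: agree_sum => i; apply: agreeZ; exact: agree_exp.
Qed.

Let agree_exprn k : agree (fun x => x ^+ k).
Proof.
apply: (@agree_lim (fun n x => ((expR (x / n.+1%:R) - 1) * n.+1%:R) ^+ k) _
  (k.*2)%:R 1).
- move=> n; apply: eq_agree (@agree_horner_exp
    ((('X - 1%:P) * n.+1%:R%:P) ^+ k) n.+1%:R^-1) => x.
  by rewrite !(horner_exp, hornerM, hornerC, hornerD, hornerN, hornerX) [X in expR X]mulrC.
- by move=> x; apply: cvg_exprn; exact: cvg_expRB1.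
move=> n x; rewrite mul1r; apply: le_trans (bound_sym _ _).
rewrite normr_nat -muln2 natrM -mulrA expRM_natl normrX.
apply: lerXn2r; rewrite ?nnegrE ?expR_ge0//.
exact: normr_expRB1n.
Qed.

Let agree_horner (p : {poly R}) : agree (horner p).
Proof.
apply: (@eq_agree (fun x => \sum_(i < size p) p`_i * x ^+ i)).
  by move=> x; rewrite horner_coef.
by apply: agree_sum => i; apply: agreeZ; exact: agree_exprn.
Qed.

Let agree_horner_sin (p : {poly R}) a L : agree (fun x => p.[sin ((x - a) * L)]).
Proof.
pose q : {poly R} := ('X - a%:P) * L%:P.
(* A truncated sine at (x - a) L is at most exp |(x - a) L|, whatever the truncation, and it is
   raised to powers below [size p]; this rate therefore serves every [n]. *)
pose c : R := (size p)%:R * `|L|.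
apply: (@agree_lim (fun n x => p.[(sin_poly n).[(x - a) * L]]) _ c
  ((\sum_(i < size p) `|p`_i|) * expR (c * `|a|))).
- move=> n; apply: eq_agree (agree_horner (p \Po (sin_poly n \Po q))) => x.
  by rewrite !horner_comp !(hornerM, hornerC, hornerD, hornerN, hornerX).
- by move=> x; apply: cvg_horner; exact: cvg_sin_poly.
move=> n x; rewrite horner_coef; apply: le_trans (ler_norm_sum _ _ _) _.
rewrite -mulrA mulr_suml; apply: ler_sum => i _; rewrite normrM ler_wpM2l//.
have c0 : 0 <= c by rewrite mulr_ge0.
apply: (@le_trans _ _ (expR (c * `|x - a|))).
  rewrite normrX; apply: (@le_trans _ _ (expR `|(x - a) * L| ^+ i)).
    by apply: lerXn2r; rewrite ?nnegrE ?expR_ge0// normr_sin_poly.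
  rewrite -expRM_natl ler_expR normrM /c -mulrA [`|x - a| * _]mulrC.
  by rewrite ler_wpM2r ?mulr_ge0// ler_nat ltnW.
apply: (@le_trans _ _ (expR (c * `|a|) * expR (c * `|x|))).
  by rewrite -expRD ler_expR -mulrDr ler_wpM2l// [X in _ <= X]addrC ler_normB.
rewrite ler_wpM2l ?expR_ge0//; apply: le_trans (bound_sym _ _).
by rewrite (ger0_norm c0).
Qed.

Let agree_abs_sin a L : agree (fun x => `|sin ((x - a) * L)|).
Proof.
apply: (@agree_lim (fun n x => (abs_poly n).[sin ((x - a) * L)]) _ 0 1).
- by move=> n; exact: agree_horner_sin.
- by move=> x; apply: cvg_abs_poly; exact: sin_max.
move=> n x; have [/andP[h0 h1] _] := abs_polyP n (sin_max ((x - a) * L)).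
rewrite ger0_norm// mul0r oppr0 expR0 mul1r; apply: le_trans h1 _.
by apply: le_trans (sin_max _) _; rewrite lerDl.
Qed.

(** A sine of period growing with [n], rescaled, tends to x - a, and |sin y| <= |y| dominates it by
    |x - a|. *)
Let agree_abs a : agree (fun x => `|x - a|).
Proof.
apply: (@agree_lim (fun n x => n.+1%:R * `|sin ((x - a) / n.+1%:R)|) _ 1
  (expR `|a|)).
- by move=> n; apply: agreeZ; exact: agree_abs_sin.
- move=> x; rewrite (_ : (fun n => _) =
      fun n => `|sin ((x - a) / n.+1%:R) * n.+1%:R|); last first.
    by apply/funext => n; rewrite normrM normr_nat mulrC.
  apply: cvg_norm; exact: cvg_sinn.
move=> n x; have n0 : 0 < n.+1%:R :> R by [].
rewrite normrM normr_id ger0_norm// -ler_pdivlMl// [X in _ <= X]mulrC.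
apply: le_trans (normr_sin_le _) _; rewrite normrM normfV (ger0_norm (ltW n0)).
rewrite ler_pM2r ?invr_gt0//; apply: le_trans (ler_normB _ _) _.
apply: (@le_trans _ _ (expR (`|a| + `|x|))).
  by apply: le_trans (expR_ge1Dx _); rewrite addrC lerDr.
by rewrite expRD ler_wpM2l ?expR_ge0// mul1r expR_norm_le.
Qed.

Lemma agree_ray a : agree \1_(`]-oo, a[%classic).
Proof.
pose h (n : nat) : R := n.+1%:R^-1.
(* A ramp that is 1 up to [a - h n] and 0 from [a] on, written with two absolute values. *)
pose u n x := (h n)^-1 * 2^-1 * (`|x - a| + (-1) * `|x - (a - h n)| + h n).
have h0 n : 0 < h n by rewrite invr_gt0.
have uS n x : a <= x -> u n x = 0.
  move=> ax; rewrite /u !ger0_norm; [|have := h0 n; lra|lra].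
  by apply/eqP; rewrite mulf_eq0; apply/orP; right; apply/eqP; lra.
have uI n x : x <= a - h n -> u n x = 1.
  move=> ax; have := h0 n => hn; rewrite /u !ler0_norm; [|lra|lra].
  rewrite (_ : _ + h n = 2 * h n); last lra.
  by rewrite mulrA mulfVK ?pnatr_eq0// mulVf// gt_eqF.
apply: (@agree_lim u _ 0 1).
- move=> n; apply: agreeZ; apply: agreeD; last exact: agreeC.
  by apply: agreeD; [exact: agree_abs|apply: agreeZ; exact: agree_abs].
- move=> x; rewrite indicE; have [xa|ax] := ltP x a.
    rewrite mem_set ?in_itv//=; apply: cvg_near_cst.
    have : h n @[n --> \oo] --> 0 by exact: cvg_harmonic.
    move=> /cvgrPdist_lt /(_ (a - x)); rewrite subr_gt0 => /(_ xa) [N _ HN].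
    exists N => // n /HN; rewrite sub0r normrN ger0_norm ?ltW// => hn.
    by rewrite uI//; lra.
  rewrite memNset/=; last by rewrite in_itv/= ltNge ax.
  by rewrite (_ : (fun n => _) = fun=> 0); [exact: cvg_cst|apply/funext => n; exact: uS].
move=> n x; rewrite mul1r mul0r oppr0 expR0.
have hn := h0 n.
rewrite normrM gtr0_norm ?mulr_gt0 ?invr_gt0// -mulrA -ler_pdivlMl ?invr_gt0// invrK.
rewrite mulrC -ler_pdivlMr// invrK.
have : `| `|x - a| - `|x - (a - h n)| | <= h n.
  by apply: le_trans (ler_dist_dist _ _) _; rewrite ler_norml; lra.
rewrite !ler_norml; lra.
Qed.

(* Signed weights are harmless, because complements and countable disjoint
   unions of sets of agreement are handled by linearity and domination. *)
Lemma agree_borel (B : set R) : measurable B -> agree \1_B.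
Proof.
move=> mB; have : <<s @RGenInftyO.G R >> B.
  by rewrite -[X in X B]RGenInftyO.measurableE.
move: B {mB}; apply: pi_lambda_subset => [|_ [a ->]||A _ aA|F mF tF aF].
- move=> _ _ [a ->] [b ->]; exists (Num.min a b); apply/seteqP; split => x /=.
    by rewrite !in_itv/= lt_min => -[-> ->].
  by rewrite !in_itv/= lt_min => /andP.
- exact: agree_ray.
- by apply: eq_agree agree1 => x; rewrite indicT.
- apply: eq_agree (agreeD agree1 (agreeZ (-1) aA)) => x.
  by rewrite !indicE in_setC mulN1r; case: (x \in A); rewrite ?subrr ?subr0.
apply: (@agree_lim (fun n x => \sum_(i < n) \1_(F i) x) _ 0 1).
- by move=> n; exact: agree_sum.
- by move=> x; exact: cvg_sum_indic.
move=> n x; rewrite mul1r mul0r oppr0 expR0 ger0_norm ?sumr_ge0//.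
by apply: le_trans (sum_indic_le1 _ _ _) _ => //; rewrite lerDl.
Qed.

End mgf_uniqueness.

(** * Transfer of integrals between weighted laws *)

Section weights_ge0.
Context {R : realType} {d1 d2 : measure_display}.
Context {T1 : measurableType d1} {T2 : measurableType d2}.
Variables (mu1 : {measure set T1 -> \bar R}) (mu2 : {measure set T2 -> \bar R}).
Variables (W1 Z1 : T1 -> R) (W2 Z2 : T2 -> R).
Hypotheses (mW1 : measurable_fun setT W1) (mZ1 : measurable_fun setT Z1).
Hypotheses (mW2 : measurable_fun setT W2) (mZ2 : measurable_fun setT Z2).
Hypotheses (W1_ge0 : forall x, 0 <= W1 x) (W2_ge0 : forall x, 0 <= W2 x).
Hypothesis W12 : forall B : set R, measurable B ->
  (\int[mu1]_x (W1 x * \1_B (Z1 x))%:E = \int[mu2]_x (W2 x * \1_B (Z2 x))%:E)%E.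

Import HBNNSimple.

Let int_sfun d (T : measurableType d) (mu : {measure set T -> \bar R}) (W Z : T -> R)
  (mW : measurable_fun setT W) (mZ : measurable_fun setT Z)
  (W0 : forall x, 0 <= W x) (h : {nnsfun R >-> R}) :
  (\int[mu]_x (W x * h (Z x))%:E = \sum_(y \in range h)
     (y%:E * \int[mu]_x (W x * \1_(h @^-1` [set y]) (Z x))%:E))%E.
Proof.
have m1 y : measurable_fun setT (fun x => W x * \1_(h @^-1` [set y]) (Z x)).
  apply: measurable_funM => //.
  apply: (measurableT_comp (measurable_indic _)) => //.
have rg y : y \in range h -> 0 <= y.
  by rewrite inE => -[x _ <-].
transitivity (\int[mu]_x (\sum_(y \in range h)
    (y%:E * (W x * \1_(h @^-1` [set y]) (Z x))%:E)))%E.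
  apply: eq_integral => x _; rewrite fimfunE fsbig_finite//= fsbig_finite//=.
  rewrite mulr_sumr -sumEFin; apply: eq_bigr => y _.
  by rewrite -EFinM mulrCA.
(* Exchanging sum and integral asks for nonnegative terms at every index, also outside the range of
   [h]; hence the truncation of [y], which changes nothing on the range. *)
transitivity (\sum_(y \in range h)
   \int[mu]_x ((Num.max 0 y)%:E * (W x * \1_(h @^-1` [set y]) (Z x))%:E))%E.
  rewrite -ge0_integral_fsum//.
  - apply: eq_integral => x _; apply: eq_fsbigr => y yh.
    by rewrite max_r// rg.
  - move=> y; apply/measurable_EFinP.
    by apply: measurable_funM => //; exact: measurable_cst.
  - move=> y x _; rewrite -EFinM lee_fin !mulr_ge0// le_max lexx//.
apply: eq_fsbigr => y yh; rewrite max_r ?rg// ge0_integralZl//.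
- exact/measurable_EFinP.
- by move=> x _; rewrite lee_fin mulr_ge0.
- by rewrite lee_fin rg.
Qed.

(** Equality on Borel sets extends to simple functions and then, by monotone convergence, to [h]; no
    integrability is involved. This is how a law computed on one space is read off on another. *)
Lemma weight_ge0_integral (h : R -> R) : measurable_fun setT h ->
  (forall x, 0 <= h x) ->
  (\int[mu1]_x (W1 x * h (Z1 x))%:E = \int[mu2]_x (W2 x * h (Z2 x))%:E)%E.
Proof.
move=> mh h0.
have mEh : measurable_fun setT (EFin \o h) by exact/measurable_EFinP.
pose h_ := nnsfun_approx measurableT mEh.
have cvh d (T : measurableType d) (mu : {measure set T -> \bar R}) (W Z : T -> R)
  (mW : measurable_fun setT W) (mZ : measurable_fun setT Z)
  (W0 : forall x, 0 <= W x) :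
  (\int[mu]_x (W x * h (Z x))%:E =
    limn (fun n => \int[mu]_x (W x * h_ n (Z x))%:E))%E.
  rewrite -monotone_convergence//.
  - apply: eq_integral => x _; apply/esym/cvg_lim => //.
    apply/fine_cvgP; split; first exact: nearW.
    apply: cvgM; first exact: cvg_cst.
    have /fine_cvgP[_] := @cvg_nnsfun_approx _ _ _ _ measurableT _ mEh
      (fun x _ => h0 x) (Z x) I.
    exact.
  - move=> n; apply/measurable_EFinP; apply: measurable_funM => //.
    exact: measurableT_comp.
  - by move=> n x _; rewrite lee_fin mulr_ge0.
  - move=> x _ m n mn; rewrite lee_fin ler_wpM2l//.
    by have /lefP := nd_nnsfun_approx measurableT mEh mn; exact.
rewrite (cvh _ _ _ _ _ mW1 mZ1)// (cvh _ _ _ _ _ mW2 mZ2)//.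
congr (limn _); apply/funext => n; rewrite !int_sfun//.
by apply: eq_fsbigr => y _; rewrite W12.
Qed.

End weights_ge0.

Lemma maxrBmaxr {R : realDomainType} (z : R) : Num.max z 0 - Num.max (- z) 0 = z.
Proof.
have [z0|z0] := leP 0 z; last by rewrite max_l ?sub0r ?opprK// oppr_ge0 ltW.
by rewrite max_r ?subr0// oppr_le0.
Qed.

Lemma maxr0_norm {R : realDomainType} (z : R) : 0 <= Num.max z 0 <= `|z|.
Proof. by rewrite le_max lexx orbT ge_max normr_ge0 ler_norm. Qed.

Section signed_weight.
Context {R : realType} {d : measure_display} {T : measurableType d}.
Variable mu : {measure set T -> \bar R}.

Lemma hasE_bigcup (W : T -> R) (F : (set T)^nat) v : trivIset setT F ->
  hasE mu W v -> (forall n, hasE mu (fun x => W x * \1_(F n) x) 0) ->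
  hasE mu (fun x => W x * \1_(\bigcup_k F k) x) 0.
Proof.
move=> tF Wv WF.
have [|||l hl c0] := @hasE_dct _ _ _ mu (fun n x => W x * \sum_(i < n) \1_(F i) x)
  (fun x => W x * \1_(\bigcup_k F k) x) (fun x => `|W x|) (fun=> 0) _ _ _ (hasE_norm Wv).
- move=> n; have := hasE_sum (index_enum 'I_n) (fun i (_ : xpredT i) => WF i).
  by rewrite big1_eq; apply: eq_hasE => x; rewrite mulr_sumr.
- by move=> x; apply: cvgM; [exact: cvg_cst|exact: cvg_sum_indic].
- move=> n x; rewrite normrM ler_piMr// ger0_norm ?sumr_ge0//.
  exact: sum_indic_le1.
suff <- : l = 0 by [].
by apply: (@cvg_unique _ (@Rhausdorff R) _ _ _ _ c0); exact: cvg_cst.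
Qed.

Lemma hasE_pi_sigma (W : T -> R) (G : set (set T)) : setI_closed G ->
  hasE mu W 0 -> (forall A, G A -> hasE mu (fun x => W x * \1_A x) 0) ->
  forall A, <<s G >> A -> hasE mu (fun x => W x * \1_A x) 0.
Proof.
move=> GI W0 WG.
apply: pi_lambda_subset => //.
- by apply: eq_hasE W0 => x; rewrite indicT mulr1.
- move=> A _ WA; rewrite -[X in hasE _ _ X](subr0 0).
  apply: eq_hasE (hasEB W0 WA) => x.
  by rewrite !indicE in_setC; case: (x \in A); rewrite ?mulr1 ?mulr0 ?subrr ?subr0.
- by move=> F _ tF WF; exact: hasE_bigcup W0 WF.
Qed.

(** It plays the role of the rule that E[W | Z] = 0 implies E[W Z] = 0. The positive and negative
    parts of [W] give the same law to [Z], hence the same integral to the positive and to the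
    negative part of [Z]. *)
Lemma signed_weight0 (W Z : T -> R) : measurable_fun setT Z ->
  (forall B : set R, measurable B -> hasE mu (fun x => W x * \1_B (Z x)) 0) ->
  mu.-integrable setT (EFin \o (fun x => W x * Z x)) ->
  hasE mu (fun x => W x * Z x) 0.
Proof.
move=> mZ WB iWZ.
have W0 : hasE mu W 0.
  by apply: eq_hasE (WB setT measurableT) => x; rewrite indicT mulr1.
have mW := hasE_mfun W0.
pose Wp x := Num.max (W x) 0; pose Wm x := Num.max (- W x) 0.
have Wpm x : W x = Wp x - Wm x by rewrite maxrBmaxr.
have mWp : measurable_fun setT Wp by apply: measurable_maxr.
have mWm : measurable_fun setT Wm.
  by apply: measurable_maxr => //; exact: measurableT_comp.
have Wp0 x : 0 <= Wp x by rewrite le_max lexx orbT.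
have Wm0 x : 0 <= Wm x by rewrite le_max lexx orbT.
have Wple x : Wp x <= `|W x| by have /andP[] := maxr0_norm (W x).
have Wmle x : Wm x <= `|W x| by have /andP[] := maxr0_norm (- W x); rewrite normrN.
have key (h : R -> R) : measurable_fun setT h -> (forall z, 0 <= h z <= `|z|) ->
    hasE mu (fun x => W x * h (Z x)) 0.
  move=> mh hz.
  have h0 z : 0 <= h z by have /andP[] := hz z.
  have mhZ : measurable_fun setT (fun x => h (Z x)) by exact: measurableT_comp.
  have dom (V : T -> R) : measurable_fun setT V -> (forall x, 0 <= V x <= `|W x|) ->
      mu.-integrable setT (EFin \o (fun x => V x * h (Z x))).
    move=> mV VW; apply: (dom_integrable _ _ (integrable_norm iWZ)).
      exact: measurable_funM.
    move=> x /=; have /andP[? ?] := VW x; have /andP[? ?] := hz (Z x).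
    by rewrite !normrM !(ger0_norm (x := V _)) // ?(ger0_norm (x := h _))//; apply: ler_pM.
  have [|a ha] := integrable_hasE (dom Wp mWp _); first by move=> x; rewrite Wp0 Wple.
  have [|b hb] := integrable_hasE (dom Wm mWm _); first by move=> x; rewrite Wm0 Wmle.
  have ab : a = b.
    apply/EFin_inj; rewrite -(proj2 ha) -(proj2 hb).
    apply: weight_ge0_integral => // B mB.
    have mB' : measurable_fun setT (fun x => \1_B (Z x) : R).
      by apply: (measurableT_comp (measurable_indic _)).
    have dom' (V : T -> R) : measurable_fun setT V -> (forall x, 0 <= V x <= `|W x|) ->
        mu.-integrable setT (EFin \o (fun x => V x * \1_B (Z x))).
      move=> mV VW; apply: (dom_integrable _ _ (hasE_norm W0)).
        exact: measurable_funM.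
      move=> x /=; have /andP[V0 VWx] := VW x.
      rewrite normrM (ger0_norm V0) (ger0_norm (x := \1_B _))//; apply: le_trans VWx; apply: ler_piMr => //.
    have [|a' ha'] := integrable_hasE (dom' Wp mWp _); first by move=> x; rewrite Wp0 Wple.
    have [|b' hb'] := integrable_hasE (dom' Wm mWm _); first by move=> x; rewrite Wm0 Wmle.
    rewrite (proj2 ha') (proj2 hb'); congr _%:E; apply/eqP; rewrite -subr_eq0; apply/eqP.
    apply: hasE_unique (WB B mB); apply: eq_hasE (hasEB ha' hb') => x.
    by rewrite -mulrBl -Wpm.
  rewrite -(subrr b) -{1}ab; apply: eq_hasE (hasEB ha hb) => x.
  by rewrite -mulrBl -Wpm.
rewrite -(subrr 0).
apply: eq_hasE (hasEB (key (fun z => Num.max z 0) _ _) (key (fun z => Num.max (- z) 0) _ _)).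
- by move=> x; rewrite -mulrBr; rewrite maxrBmaxr.
- exact: measurable_maxr.
- by move=> z; exact: maxr0_norm.
- by apply: measurable_maxr => //; exact: measurableT_comp.
- by move=> z; rewrite -(normrN z); exact: maxr0_norm.
Qed.

End signed_weight.

(** For the coordinates of a random vector this is convertible to [vec_gen]; the free index type
    also covers histories and rotated coordinates. *)
Definition fam_gen {R : realType} {T I : Type} (X : I -> T -> R) : set (set T) :=
  [set E | exists i, exists2 B : set R, measurable B & E = X i @^-1` B].

Definition lin {R : realType} {T : Type} {I : finType} (X : I -> T -> R)
  (b : I -> R) (x : T) : R := \sum_i b i * X i x.

Section family.
Context {R : realType} {d : measure_display} {T : measurableType d}.
Variable mu : {measure set T -> \bar R}.
Context {I : finType}.
Implicit Types (X : I -> T -> R) (b : I -> R).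

Lemma lin_shift X b k t x :
  lin X (fun i => b i + t * (i == k)%:R) x = lin X b x + t * X k x.
Proof.
rewrite /lin; under eq_bigr do rewrite mulrDl.
rewrite big_split/=; congr (_ + _); rewrite (bigD1 k)//= eqxx mulr1.
by rewrite big1 ?addr0// => i /negPf ->; rewrite mulr0 mul0r.
Qed.

(** A signed measure with vanishing mgf is zero. The multivariate case reduces to the
    one-dimensional one by turning exponentials into indicators one coordinate at a time, and a
    pi-system argument passes from rectangles to the generated sigma-algebra. *)
Lemma mgf_signed_zero (W : T -> R) X :
  (forall b, hasE mu (fun x => W x * expR (lin X b x)) 0) ->
  forall D, <<s fam_gen X >> D -> hasE mu (fun x => W x * \1_D x) 0.
Proof.
move=> WX.
have rect (s : seq I) (B : I -> set R) b : (forall i, measurable (B i)) ->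
    hasE mu (fun x => W x * \prod_(i <- s) \1_(B i) (X i x) * expR (lin X b x)) 0.
  move=> mB; elim: s b => [|k s ih] b.
    by apply: eq_hasE (WX b) => x; rewrite big_nil mulr1.
  (* The indicators already obtained and the remaining exponential are absorbed in a new signed
     weight; it is compared with the zero weight along coordinate [k]. *)
  pose W' x := W x * \prod_(i <- s) \1_(B i) (X i x) * expR (lin X b x).
  have [t|v [h1 h2]] := @agree_borel R d d T T mu mu W' (X k) (fun=> 0) (X k) _ _ (mB k).
    exists 0; split; last by apply: eq_hasE (hasE0 _) => x; rewrite mul0r.
    apply: eq_hasE (ih (fun i => b i + t * (i == k)%:R)) => x.
    by rewrite lin_shift expRD mulrA.
  have v0 : v = 0.
    by apply: hasE_unique h2 _; apply: eq_hasE (hasE0 _) => x; rewrite mul0r.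
  rewrite -v0; apply: eq_hasE h1 => x; rewrite big_cons /W'.
  by ring.
pose G := [set E | exists B : I -> set R, (forall i, measurable (B i)) /\
  E = [set x | forall i, B i (X i x)]].
have GI : setI_closed G.
  move=> _ _ [B [mB ->]] [C [mC ->]]; exists (fun i => B i `&` C i); split.
    by move=> i; exact: measurableI.
  apply/seteqP; split => x /=; first by move=> [h1 h2] i.
  by move=> h; split => i; have [] := h i.
have W0 : hasE mu W 0.
  apply: eq_hasE (WX (fun=> 0)) => x.
  by rewrite /lin big1 ?expR0 ?mulr1// => i _; rewrite mul0r.
move=> D; have FG : <<s fam_gen X >> `<=` <<s G >>.
  apply: smallest_sub; first exact: smallest_sigma_algebra.
  move=> _ [i [B mB ->]]; apply: sub_sigma_algebra.
  exists (fun j => if j == i then B else setT); split.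
    by move=> j; case: ifP.
  apply/seteqP; split => x /= h; first by move=> j; case: eqP => // ->.
  by have := h i; rewrite eqxx.
move=> /FG; apply: hasE_pi_sigma => // _ [B [mB ->]].
apply: eq_hasE (rect (index_enum I) B (fun=> 0) mB) => x.
rewrite [lin _ _ _]big1; last by move=> i _; rewrite mul0r.
rewrite expR0 mulr1; congr (_ * _).
rewrite [RHS]indicE; case: (boolP (x \in _)); rewrite ?inE ?notin_setE/= => h.
  by rewrite big1// => i _; rewrite indicE mem_set.
move/existsNP : h => [i h].
by rewrite (bigD1 i)//= indicE memNset// mul0r.
Qed.

End family.

(** * Gaussian expectations *)

Section gaussian_weight.
Context {R : realType}.
Implicit Types (lam c b : R).

(** The expectation of exp(c X^2 + b X) for X ~ N(0, lam), finite when 2 c lam < 1. *)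
Definition gauss_quad lam c b : R :=
  (Num.sqrt (1 - 2 * c * lam))^-1 * expR (lam * b ^+ 2 / (2 * (1 - 2 * c * lam))).

Lemma gauss_quad0 lam b : gauss_quad lam 0 b = expR (2^-1 * (lam * b ^+ 2)).
Proof.
rewrite /gauss_quad mulr0 mul0r subr0 sqrtr1 invr1 mul1r mulr1.
by rewrite [X in expR X]mulrC.
Qed.

Lemma integral_normal_prob (s : R) (h : R -> R) : measurable_fun setT h ->
  (forall x, 0 <= h x) ->
  (\int[normal_prob 0 s]_x (h x)%:E =
   \int[lebesgue_measure]_x (normal_pdf 0 s x * h x)%:E)%E.
Proof.
move=> mh h0.
have -> : (\int[normal_prob 0 s]_x (h x)%:E = \int[normal_prob 0 s]_x (1 * h x)%:E)%E.
  by apply: eq_integral => x _; rewrite mul1r.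
apply: (@weight_ge0_integral R _ _ _ _ (normal_prob 0 s) lebesgue_measure
   (fun=> 1) id (normal_pdf 0 s) id) => //.
- exact: measurable_normal_pdf.
- by move=> x; exact: normal_pdf_ge0.
move=> B mB; under eq_integral do rewrite mul1r.
rewrite integral_indic// setIT /= /normal_prob [LHS]integral_mkcond.
apply: eq_integral => x _; rewrite patchE indicE.
by case: ifP => _; rewrite ?mulr1 ?mulr0.
Qed.

(** Completing the square: with D = 1 - 2 c lam, the tilted density is a constant times that of N(b
    lam / D, lam / D). *)
Lemma normal_gauss_quad lam c b : 0 < lam -> 2 * c * lam < 1 ->
  hasE (normal_prob 0 (Num.sqrt lam)) (fun x => expR (c * x ^+ 2 + b * x))
    (gauss_quad lam c b).
Proof.
move=> l0 cl; have [D D1] : exists D, D = 1 - 2 * c * lam by eexists.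
have D0 : 0 < D by rewrite D1 subr_gt0.
have mf : measurable_fun setT (fun x : R => expR (c * x ^+ 2 + b * x)).
  apply: measurableT_comp => //; apply: measurable_funD; apply: measurable_funM => //.
apply: ge0_hasE => //.
rewrite integral_normal_prob//.
have s0 : Num.sqrt lam != 0 by rewrite gt_eqF// sqrtr_gt0.
have s0' : Num.sqrt (lam / D) != 0 by rewrite gt_eqF// sqrtr_gt0 divr_gt0.
transitivity (\int[lebesgue_measure]_x ((gauss_quad lam c b)%:E *
   (normal_pdf (b * lam / D) (Num.sqrt (lam / D)) x)%:E))%E; last first.
  rewrite ge0_integralZl ?integral_normal_pdf ?mule1//.
  - by apply/measurable_EFinP; exact: measurable_normal_pdf.
  - by move=> x _; rewrite lee_fin normal_pdf_ge0.
  - by rewrite lee_fin mulr_ge0 ?invr_ge0 ?expR_ge0.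
apply: eq_integral => x _; rewrite -EFinM; congr _%:E.
rewrite !normal_pdfE// /normal_peak /normal_fun /gauss_quad -D1.
rewrite !sqr_sqrtr ?ltW ?divr_gt0//.
move: (@pi R) (@pi_gt0 R) => p pi0.
have -> : lam / D * p *+ 2 = (lam * p *+ 2) / D.
  by field; rewrite gt_eqF.
rewrite sqrtrM ?mulrn_wge0 ?mulr_ge0 ?ltW// sqrtrV ?ltW//.
have sD : Num.sqrt D != 0 by rewrite gt_eqF// sqrtr_gt0.
have p0 : Num.sqrt (lam * p *+ 2) != 0.
  by rewrite gt_eqF// sqrtr_gt0 mulrn_wgt0// mulr_gt0.
rewrite -[LHS]mulrA -[in LHS]expRD; set e4 := expR (- (x - b * lam / D) ^+ 2 / _).
transitivity ((Num.sqrt (lam * p *+ 2))^-1 * (expR (lam * b ^+ 2 / (2 * D)) * e4)).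
  congr (_ * _); rewrite -expRD; congr expR; rewrite subr0.
  have -> : c = (1 - D) / (2 * lam) by rewrite D1; field; rewrite gt_eqF.
  by field; rewrite !gt_eqF.
by field; rewrite p0 sD.
Qed.

End gaussian_weight.

Section gaussian_expectations.
Context {R : realType} {d : measure_display} {T : measurableType d}.
Variable mu : {measure set T -> \bar R}.

(** The mgf identifies the [W]-weighted law of [X] as [w] times N(0, lam), so the integral is
    computed on a reference space: the real line with [normal_prob], or a point when [lam] is 0. The
    weight is there so that the other coordinates of a family can be frozen in it. *)
Lemma gauss_weight (W X : T -> R) (w lam c b : R) :
  measurable_fun setT W -> measurable_fun setT X -> (forall x, 0 <= W x) ->
  0 <= lam -> 2 * c * lam < 1 ->
  (forall t, hasE mu (fun x => W x * expR (t * X x))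
               (w * expR (2^-1 * (lam * t ^+ 2)))) ->
  hasE mu (fun x => W x * expR (c * X x ^+ 2 + b * X x)) (w * gauss_quad lam c b).
Proof.
move=> mW mX W0 l0 cl WX.
have w0 : 0 <= w.
  have := hasE_ge0 (WX 0); rewrite expr0n/= !mulr0 expR0 mulr1; apply => x.
  by rewrite mulr_ge0 ?expR_ge0.
have mexp (Z : R -> R) : measurable_fun setT Z ->
   measurable_fun setT (fun x => expR (c * Z x ^+ 2 + b * Z x)).
  move=> mZ; apply: measurableT_comp => //; apply: measurable_funD; apply: measurable_funM => //.
  exact: measurable_funX.
have main d' (T' : measurableType d') (nu : {measure set T' -> \bar R}) (Z : T' -> R) :
    measurable_fun setT Z ->
    (forall c b, 2 * c * lam < 1 ->
      hasE nu (fun x => expR (c * Z x ^+ 2 + b * Z x)) (gauss_quad lam c b)) ->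
    hasE mu (fun x => W x * expR (c * X x ^+ 2 + b * X x)) (w * gauss_quad lam c b).
  move=> mZ Zg.
  have Zt t : hasE nu (fun x => w * expR (t * Z x)) (w * expR (2^-1 * (lam * t ^+ 2))).
    have := hasEZ w (Zg 0 t _); rewrite gauss_quad0 mulr0 mul0r => /(_ ltr01).
    by apply: eq_hasE => x; rewrite mul0r add0r.
  apply: ge0_hasE.
  - apply: measurable_funM => //.
    exact: (measurableT_comp (mexp id _)).
  - by move=> x; rewrite mulr_ge0 ?expR_ge0.
  rewrite -(proj2 (hasEZ w (Zg c b cl))).
  apply: (@weight_ge0_integral R _ _ _ _ mu nu W X (fun=> w) Z mW mX _ mZ W0 _ _
    (fun x => expR (c * x ^+ 2 + b * x))) => //.
  - move=> B mB.
    have [t|v [h1 h2]] := @agree_borel R _ _ _ _ mu nu W X (fun=> w) Z _ _ mB.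
      by eexists; split; [exact: WX|exact: Zt].
    by rewrite (proj2 h1) (proj2 h2).
  - exact: mexp.
have [l0'|l0'] := ltP 0 lam.
  apply: (main _ _ (normal_prob 0 (Num.sqrt lam)) id) => // c' b' cl'.
  exact: normal_gauss_quad.
have lE : lam = 0 by apply/eqP; rewrite eq_le l0 l0'.
apply: (main _ _ (dirac (tt : unit)) (fun=> 0)) => // c' b' _.
have -> : gauss_quad lam c' b' = 1.
  by rewrite lE /gauss_quad mulr0 subr0 !mul0r expR0 sqrtr1 invr1 mulr1.
apply: eq_hasE (hasE_cst (dirac (tt : unit) : probability _ R) 1) => x.
by rewrite expr0n/= !mulr0 addr0 expR0.
Qed.

Lemma gauss_family (I : finType) (W : T -> R) (X : I -> T -> R) (w : R)
    (lam c b : I -> R) :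
  measurable_fun setT W -> (forall i, measurable_fun setT (X i)) ->
  (forall x, 0 <= W x) -> (forall i, 0 <= lam i) ->
  (forall i, 2 * c i * lam i < 1) ->
  (forall t, hasE mu (fun x => W x * expR (lin X t x))
               (w * \prod_i expR (2^-1 * (lam i * t i ^+ 2)))) ->
  hasE mu (fun x => W x * expR (\sum_i (c i * X i x ^+ 2 + b i * X i x)))
    (w * \prod_i gauss_quad (lam i) (c i) (b i)).
Proof.
move=> mW mX W0 l0 cl WX.
pose cs (s : seq I) i := if i \in s then c i else 0.
suff H (s : seq I) (t : I -> R) : uniq s ->
    hasE mu (fun x => W x * expR (\sum_i (cs s i * X i x ^+ 2 + t i * X i x)))
    (w * \prod_i gauss_quad (lam i) (cs s i) (t i)).
  have := H (enum I) b (enum_uniq _).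
  by congr (hasE _ _ _); [apply/funext => x; congr (_ * expR _)|congr (_ * _)];
    apply: eq_bigr => i _; rewrite /cs mem_enum inE.
elim: s t => [|k s ih] t.
  move=> _; have := WX t; congr (hasE _ _ _).
    apply/funext => x; congr (_ * expR _); apply: eq_bigr => i _.
    by rewrite mul0r add0r.
  by congr (_ * _); apply: eq_bigr => i _; rewrite gauss_quad0.
move=> /= /andP[ks us].
pose t0 i := if i == k then 0 else t i.
pose W' x := W x * expR (\sum_i (cs s i * X i x ^+ 2 + t0 i * X i x)).
have csk i : i != k -> cs (k :: s) i = cs s i.
  by move=> ik; rewrite /cs inE (negPf ik).
have csks : cs s k = 0 by rewrite /cs (negPf ks).
have cskk : cs (k :: s) k = c k by rewrite /cs inE eqxx.
have := @gauss_weight W' (X k) (w * \prod_(i | i != k) gauss_quad (lam i) (cs s i) (t i))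
  (lam k) (c k) (t k) _ (mX k) _ (l0 k) (cl k) _.
have E x u : \sum_i (cs s i * X i x ^+ 2 + t0 i * X i x) + u =
    \sum_(i | i != k) (cs s i * X i x ^+ 2 + t i * X i x) + u.
  congr (_ + _); rewrite (bigD1 k)//= csks /t0 eqxx !mul0r !add0r.
  by apply: eq_bigr => i /negPf ->.
rewrite (_ : (fun x => W' x * _) = (fun x : T =>
    W x * expR (\sum_i (cs (k :: s) i * X i x ^+ 2 + t i * X i x)))); last first.
  apply/funext => x; rewrite -[LHS]mulrA -expRD E [in RHS](bigD1 k)//= cskk.
  congr (_ * expR _); rewrite [LHS]addrC; congr (_ + _).
  by apply: eq_bigr => i /csk ->.
rewrite -mulrA (_ : _ * gauss_quad (lam k) (c k) (t k) =
   \prod_i gauss_quad (lam i) (cs (k :: s) i) (t i)); last first.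
  rewrite [RHS](bigD1 k)//= cskk mulrC; congr (_ * _).
  by apply: eq_bigr => i /csk ->.
apply.
- apply: measurable_funM => //; apply: measurableT_comp => //.
  apply: measurable_sum => i; apply: measurable_funD; apply: measurable_funM => //.
  exact: measurable_funX.
- by move=> x; rewrite mulr_ge0 ?expR_ge0.
move=> u; pose tu i := if i == k then u else t i.
have := ih tu us; congr (hasE _ _ _).
  apply/funext => x; rewrite -[RHS]mulrA -expRD E; congr (_ * expR _).
  rewrite (bigD1 k)//= csks /tu eqxx mul0r add0r [RHS]addrC; congr (_ + _).
  by apply: eq_bigr => i /negPf ->.
rewrite (bigD1 k)//= csks gauss_quad0 /tu eqxx -[RHS]mulrA; congr (_ * _).
by rewrite [RHS]mulrC; congr (_ * _); apply: eq_bigr => i /negPf ->.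
Qed.

End gaussian_expectations.

(** * Products of functions of mutually independent variables *)

Section mutual_independence.
Context {R : realType} {d : measure_display} {T : measurableType d}.
Variable P : probability T R.

Lemma mutual_indep_prod (I : eqType) (F : I -> set (set T)) (X : I -> T -> R)
    (v : I -> R) (J : seq I) :
  mutual_indep P F -> uniq J ->
  (forall j, j \in J -> hasE P (X j) (v j)) ->
  (forall j x, 0 <= X j x) ->
  (forall j, j \in J -> forall B : set R, measurable B -> <<s F j >> (X j @^-1` B)) ->
  hasE P (fun x => \prod_(j <- J) X j x) (\prod_(j <- J) v j).
Proof.
move=> indF uJ XE X0 XF.
have mX j : j \in J -> measurable_fun setT (X j) by move=> /XE /hasE_mfun.
suff H (J2 J1 : seq I) (A : I -> set T) : uniq (J1 ++ J2) -> {subset J2 <= J} ->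
    (forall j, j \in J1 -> <<s F j >> (A j)) -> (forall j, j \in J1 -> measurable (A j)) ->
    hasE P (fun x => \prod_(j <- J1) \1_(A j) x * \prod_(j <- J2) X j x)
      (\prod_(j <- J1) fine (P (A j)) * \prod_(j <- J2) v j).
  have := H J [::] (fun=> setT) uJ (fun _ h => h).
  rewrite big_nil mul1r => h.
  by apply: eq_hasE (h _ _) => // x; rewrite big_nil mul1r.
elim: J2 J1 A => [|k J2 ih] J1 A.
  rewrite cats0 => uJ1 _ AF mA; rewrite big_nil mulr1.
  have mI : measurable (\bigcap_(j in [set j | j \in J1]) A j).
    by apply: fin_bigcap_measurable => //; exact: finite_seq.
  have := hasE_indic P mI; rewrite indF// => h.
  have -> : \prod_(j <- J1) fine (P (A j)) = fine (\prod_(j <- J1) P (A j))%E.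
    elim: (J1) mA => [|j s ihs] mA; first by rewrite !big_nil.
    rewrite !big_cons ihs => [|i si]; last by apply: mA; rewrite inE si orbT.
    rewrite fineM//; first exact: (fin_num_measure P _ (mA _ (mem_head _ _))).
    rewrite big_seq; apply: (big_ind (fun y => y \is a fin_num)) => // [? ? ? ?|i si]; first exact: fin_numM.
    by apply: (fin_num_measure P); apply: mA; rewrite inE si orbT.
  apply: eq_hasE h => x; rewrite big_nil mulr1 indicE.
  case: (boolP (x \in _)); rewrite ?inE ?notin_setE/= => h.
    by rewrite big_seq big1// => j jJ; rewrite indicE mem_set//; exact: h.
  move/existsNP : h => [j /not_implyP[jJ h]].
  rewrite (big_rem j)//= indicE memNset// mul0r//.
move=> uJ' sJ AF mA.
have kJ : k \in J by apply: sJ; rewrite mem_head.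
have kJ1 : k \notin J1.
  by move: uJ'; rewrite cat_uniq /= => /and3P[_ /norP[]].
pose c := \prod_(j <- J1) fine (P (A j)) * \prod_(j <- J2) v j.
pose W x := \prod_(j <- J1) \1_(A j) x * \prod_(j <- J2) X j x.
have uJ2 : uniq (J1 ++ J2).
  move: uJ'; rewrite !cat_uniq /= => /and3P[-> /norP[_ ->] /andP[_ ->]] //.
have sJ2 : {subset J2 <= J} by move=> j jJ; apply: sJ; rewrite inE jJ orbT.
have hW : hasE P W c by exact: ih.
have W0 x : 0 <= W x by rewrite mulr_ge0// prodr_ge0.
have c0 : 0 <= c by exact: hasE_ge0 hW _.
have WB (B : set R) : measurable B ->
    hasE P (fun x => W x * \1_B (X k x)) (c * fine (P (X k @^-1` B))).
  move=> mB; pose A' j := if j == k then X k @^-1` B else A j.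
  have A'j j : j \in J1 -> A' j = A j.
    by move=> jJ; rewrite /A'; case: eqP jJ kJ1 => // -> ->.
  have A'k : A' k = X k @^-1` B by rewrite /A' eqxx.
  have mk : measurable (X k @^-1` B).
    by rewrite -[X in measurable X]setTI; exact: mX.
  have E (f : I -> set T -> R) : \prod_(j <- J1) f j (A' j) = \prod_(j <- J1) f j (A j).
    by rewrite big_seq [RHS]big_seq; apply: eq_bigr => j jJ; rewrite A'j.
  have := ih (k :: J1) A' _ sJ2 _ _.
  rewrite big_cons (E (fun _ S => fine (P S))) A'k => h.
  rewrite mulrC [X in hasE _ _ X]mulrA; apply: eq_hasE (h _ _ _).
  - move=> x; rewrite big_cons (E (fun _ S => \1_S x)) A'k /W.
    by rewrite -[LHS]mulrA [LHS]mulrC.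
  - rewrite cat_cons /= mem_cat (negPf kJ1) uJ2 andbT.
    by move: uJ'; rewrite cat_uniq /= => /and3P[_ _ /andP[]].
  - move=> j; rewrite inE => /orP[/eqP ->|jJ]; last by rewrite A'j//; exact: AF.
    by rewrite A'k; exact: XF.
  - move=> j; rewrite inE => /orP[/eqP ->|jJ]; last by rewrite A'j//; exact: mA.
    by rewrite A'k.
have mk := mX k kJ.
have mW := hasE_mfun hW.
rewrite big_cons mulrCA [X in hasE _ _ X]mulrC -/c.
suff : hasE P (fun x => W x * X k x) (c * v k).
  by apply: eq_hasE => x; rewrite /W big_cons -!mulrA; congr (_ * _); rewrite mulrC.
apply: ge0_hasE; [exact: measurable_funM|by move=> x; rewrite mulr_ge0|].
rewrite -(proj2 (hasEZ c (XE k kJ))).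
(* The transfer lemma wants a function nonnegative on the whole line, whereas only the values of
   [X k] are nonnegative; the identity is therefore replaced by the positive part. *)
have M x : X k x = Num.max (X k x) 0 by rewrite max_l.
under eq_integral do rewrite M.
under [RHS]eq_integral do rewrite M.
apply: (@weight_ge0_integral R _ _ _ _ P P W (X k) (fun=> c) (X k) mW mk _ mk W0 _ _
  (fun z => Num.max z 0)) => //.
- move=> B mB; rewrite (proj2 (WB B mB)).
  have mB' : measurable (X k @^-1` B).
    by rewrite -[X in measurable X]setTI; exact: mk.
  by rewrite -(proj2 (hasEZ c (hasE_indic P mB'))).
- exact: measurable_maxr.
- by move=> z; rewrite le_max lexx orbT.
Qed.
End mutual_independence.

Section gaussian_mgf.
Context {R : realType} {d : measure_display} {T : measurableType d}.
Variable P : probability T R.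

Definition dot n (a x : 'cV[R]_n) : R := (a^T *m x) ord0 ord0.
Definition qform n (S : 'M[R]_n) (a : 'cV[R]_n) : R := (a^T *m S *m a) ord0 ord0.

Lemma dotE n (a x : 'cV[R]_n) : dot a x = \sum_i a i ord0 * x i ord0.
Proof. by rewrite /dot mxE; apply: eq_bigr => i _; rewrite mxE. Qed.

Lemma dot_measurable n (a : 'cV[R]_n) (X : T -> 'cV[R]_n) : rv_vec X ->
  measurable_fun setT (fun x => dot a (X x)).
Proof.
move=> mX; under eq_fun do rewrite dotE.
by apply: measurable_sum => i; apply: measurable_funM.
Qed.

Lemma gaussian_mgf n (X : T -> 'cV[R]_n) (S : 'M[R]_n) (a : 'cV[R]_n) :
  rv_vec X -> is_gaussian P X 0 S ->
  hasE P (fun x => expR (dot a (X x))) (expR (2^-1 * qform S a)).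
Proof.
move=> mX gX; have [v0 law] := gX a; rewrite -/(qform S a) in v0 law.
have mdX := dot_measurable a mX.
have aE : (a^T *m (0 : 'cV[R]_n)) ord0 ord0 = 0 by rewrite mulmx0 mxE.
rewrite aE in law.
apply: ge0_hasE => //; first exact: measurableT_comp.
have main d' (T' : measurableType d') (nu : {measure set T' -> \bar R}) (Z : T' -> R) :
    measurable_fun setT Z ->
    (forall B, measurable B -> gauss1_law 0 (qform S a) B = nu (Z @^-1` B)) ->
    (\int[P]_x (expR (dot a (X x)))%:E = \int[nu]_x (expR (Z x))%:E)%E.
  move=> mZ lawZ.
  transitivity (\int[P]_x (1 * expR (dot a (X x)))%:E)%E.
    by apply: eq_integral => x _; rewrite mul1r.
  transitivity (\int[nu]_x (1 * expR (Z x))%:E)%E; last first.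
    by apply: eq_integral => x _; rewrite mul1r.
  apply: (@weight_ge0_integral R _ _ _ _ P nu (fun=> 1) (fun x => dot a (X x))
    (fun=> 1) Z _ mdX _ mZ _ _ _ expR) => // B mB.
  have E d'' (T'' : measurableType d'') (m : {measure set T'' -> \bar R}) (V : T'' -> R) :
      measurable_fun setT V -> (\int[m]_x (1 * \1_B (V x))%:E = m (V @^-1` B))%E.
    move=> mV; rewrite -[in RHS](setIT (V @^-1` B)) -integral_indic//.
      by apply: eq_integral => x _; rewrite mul1r.
    by rewrite -[X in measurable X]setTI; exact: mV.
  by rewrite !E// -lawZ// -law.
have [l0|l0] := ltP 0 (qform S a).
  rewrite (main _ _ (normal_prob 0 (Num.sqrt (qform S a))) id)//; last first.
    by move=> B mB; rewrite /gauss1_law gt_eqF.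
  have [|_] := @normal_gauss_quad R (qform S a) 0 1 l0 _; first by rewrite mulr0 mul0r.
  rewrite gauss_quad0 expr1n mulr1 => <-.
  by apply: eq_integral => x _; rewrite mul0r add0r mul1r.
have lE : qform S a = 0 by apply/eqP; rewrite eq_le v0 l0.
rewrite (main _ _ (dirac (tt : unit)) (fun=> 0))//; last first.
  move=> B mB; rewrite /gauss1_law lE eqxx/= diracE indicE.
  by congr ((_ : bool)%:R%:E); apply/idP/idP; rewrite !inE.
rewrite lE mulr0; exact: (proj2 (hasE_cst (dirac (tt : unit) : probability _ R) _)).
Qed.
End gaussian_mgf.

(** * Measurability with respect to a generated sigma-algebra *)

Section sub_sigma_measurability.
Context {R : realType} {T : pointedType}.
Implicit Types (G : set (set T)) (f g : T -> R).

Definition smeas G f := forall B : set R, measurable B -> <<s G >> (f @^-1` B).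

Lemma smeasP G f :
  smeas G f <-> measurable_fun (setT : set (g_sigma_algebraType G)) f.
Proof.
split=> [h _ B mB|h B mB]; first by rewrite setTI; exact: h.
by rewrite -[X in <<s _ >> X]setTI; exact: (h measurableT).
Qed.

Lemma smeas_cst G (k : R) : smeas G (fun=> k).
Proof. by apply/smeasP; exact: measurable_cst. Qed.

Lemma smeasD G f g : smeas G f -> smeas G g -> smeas G (fun x => f x + g x).
Proof. by move=> /smeasP mf /smeasP mg; apply/smeasP; exact: measurable_funD. Qed.

Lemma smeasB G f g : smeas G f -> smeas G g -> smeas G (fun x => f x - g x).
Proof. by move=> /smeasP mf /smeasP mg; apply/smeasP; exact: measurable_funB. Qed.

Lemma smeasM G f g : smeas G f -> smeas G g -> smeas G (fun x => f x * g x).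
Proof. by move=> /smeasP mf /smeasP mg; apply/smeasP; exact: measurable_funM. Qed.

Lemma smeas_comp G (h : R -> R) f : measurable_fun setT h -> smeas G f ->
  smeas G (fun x => h (f x)).
Proof. by move=> mh /smeasP mf; apply/smeasP; exact: measurableT_comp. Qed.

Lemma smeas_sum G (I : Type) (s : seq I) (f : I -> T -> R) :
  (forall i, smeas G (f i)) -> smeas G (fun x => \sum_(i <- s) f i x).
Proof.
move=> mf; apply/smeasP; apply: measurable_sum => i; apply/smeasP; exact: mf.
Qed.

Lemma smeas_indic G (A : set T) : <<s G >> A -> smeas G (\1_A).
Proof.
move=> GA; apply/smeasP.
exact: (@measurable_indic _ (g_sigma_algebraType G) R setT A).
Qed.

Lemma smeas_lin G (I : finType) (X : I -> T -> R) b :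
  (forall i, smeas G (X i)) -> smeas G (lin X b).
Proof.
by move=> mX; apply: smeas_sum => i; apply: smeasM => //; exact: smeas_cst.
Qed.

Lemma smeasS G G' f : <<s G >> `<=` <<s G' >> -> smeas G f -> smeas G' f.
Proof. by move=> GG' h B mB; apply: GG'; exact: h. Qed.

Lemma smeas_fam (I : Type) (X : I -> T -> R) i : smeas (fam_gen X) (X i).
Proof. by move=> B mB; apply: sub_sigma_algebra; exists i, B. Qed.

Lemma fam_gen_sub G (I : Type) (X : I -> T -> R) :
  (forall i, smeas G (X i)) -> <<s fam_gen X >> `<=` <<s G >>.
Proof.
move=> mX; apply: smallest_sub; first exact: smallest_sigma_algebra.
by move=> _ [i [B mB ->]]; exact: mX.
Qed.

End sub_sigma_measurability.

Lemma sub_sigma_measurable {d : measure_display} {T : measurableType d}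
    (G : set (set T)) : G `<=` measurable -> <<s G >> `<=` measurable.
Proof.
move=> GT; apply: smallest_sub => //; exact: sigma_algebra_measurable.
Qed.

Lemma smeas_measurable {R : realType} {d : measure_display} {T : measurableType d}
    (G : set (set T)) (f : T -> R) :
  G `<=` measurable -> smeas G f -> measurable_fun setT f.
Proof.
by move=> GT h _ B mB; rewrite setTI; apply: (sub_sigma_measurable GT); exact: h.
Qed.

Section vec_measurability.
Context {R : realType} {d : measure_display} {T : measurableType d}.

Lemma smeas_coord n (X : T -> 'cV[R]_n) i : smeas (vec_gen X) (fun x => X x i ord0).
Proof. by move=> B mB; apply: sub_sigma_algebra; exists i, B. Qed.

Lemma smeas_dot n (a : 'cV[R]_n) (X : T -> 'cV[R]_n) :
  smeas (vec_gen X) (fun x => dot a (X x)).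
Proof.
move=> B; rewrite (_ : (fun x => _) = (fun x => \sum_i a i ord0 * X x i ord0)).
  by apply: smeas_sum => i; apply: smeasM; [exact: smeas_cst|exact: smeas_coord].
by apply/funext => x; rewrite dotE.
Qed.

Lemma vec_gen_measurable n (X : T -> 'cV[R]_n) : rv_vec X ->
  vec_gen X `<=` measurable.
Proof.
by move=> mX _ [i [B mB ->]]; rewrite -[X in measurable X]setTI; exact: mX.
Qed.

End vec_measurability.

(** * The linear Gaussian model and linear regression *)

Section model_mgf.
Context {R : realType} {dO : measure_display} {Om : measurableType dO}.
Variable P : probability Om R.
Variables (d m : nat) (A : 'M[R]_d) (C : 'M[R]_(m, d)) (S0 Sw : 'M[R]_d) (Sv : 'M[R]_m).

(** Twice the logarithm of the joint mgf of the state at time [t] and the observations 1 to [t].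
    Substituting the observation equation turns the coefficient of the state into a + C^T b_t, and
    the state equation pulls it back by A^T. *)
Fixpoint Qf t (a : 'cV[R]_d) (b : nat -> 'cV[R]_m) : R :=
  if t is t'.+1 then
    Qf t' (A^T *m (a + C^T *m b t)) b + qform Sw (a + C^T *m b t) + qform Sv (b t)
  else qform S0 a.

Lemma qformZ n (S : 'M[R]_n) k a : qform S (k *: a) = k ^+ 2 * qform S a.
Proof.
rewrite /qform !linearZ/= -!scalemxAl !mxE.
by rewrite mulrA expr2.
Qed.

Lemma QfZ t k a b : Qf t (k *: a) (fun s => k *: b s) = k ^+ 2 * Qf t a b.
Proof.
elim: t a => [|t ih] a /=; first exact: qformZ.
by rewrite -!scalemxAr -scalerDr -scalemxAr ih !qformZ !mulrDr.
Qed.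

Lemma dotDl n (a a' x : 'cV[R]_n) : dot (a + a') x = dot a x + dot a' x.
Proof. by rewrite /dot linearD/= mulmxDl mxE. Qed.

Lemma dotDr n (a x x' : 'cV[R]_n) : dot a (x + x') = dot a x + dot a x'.
Proof. by rewrite /dot mulmxDr mxE. Qed.

Lemma dot_mulmx n p (M : 'M[R]_(n, p)) a x : dot a (M *m x) = dot (M^T *m a) x.
Proof. by rewrite /dot trmx_mul trmxK mulmxA. Qed.

Variables (th w : nat -> Om -> 'cV[R]_d) (nu Y : nat -> Om -> 'cV[R]_m).
Hypothesis model : lin_gauss_model P A C S0 Sw Sv th w nu Y.

Let latents_mgf N a c e :
  hasE P (fun x => expR (dot a (th 0 x) + \sum_(0 <= s < N) dot (c s) (w s x)
             + \sum_(1 <= s < N.+1) dot (e s) (nu s x)))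
   (expR (2^-1 * (qform S0 a + \sum_(0 <= s < N) qform Sw (c s)
             + \sum_(1 <= s < N.+1) qform Sv (e s)))).
Proof.
have [[m0 [mw mnu]] [g0 [gw gnu]] ind _ _] := model.
pose X (i : option (nat + nat)) (x : Om) : R := match i with
  | None => expR (dot a (th 0 x))
  | Some (inl s) => expR (dot (c s) (w s x))
  | Some (inr s) => expR (dot (e s.+1) (nu s.+1 x)) end.
pose v (i : option (nat + nat)) : R := match i with
  | None => expR (2^-1 * qform S0 a)
  | Some (inl s) => expR (2^-1 * qform Sw (c s))
  | Some (inr s) => expR (2^-1 * qform Sv (e s.+1)) end.
pose J : seq (option (nat + nat)) := None ::
  ([seq Some (inl s) | s <- iota 0 N] ++ [seq Some (inr s) | s <- iota 0 N]).
have uJ : uniq J.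
  rewrite /= mem_cat cat_uniq !map_inj_uniq ?iota_uniq ?andbT/=; try by move=> ? ? [].
  apply/andP; split.
    by apply/norP; split; apply/mapP => -[].
  by apply/hasP => -[_ /mapP[s _ ->]] /mapP[].
have XJ f (g : option (nat + nat) -> R) :
    (forall i, g i = expR (f i)) ->
    \prod_(j <- J) g j = expR (f None + \sum_(0 <= s < N) f (Some (inl s))
      + \sum_(1 <= s < N.+1) f (Some (inr s.-1))).
  move=> gf; under eq_bigr do rewrite gf.
  rewrite -expR_sum /J big_cons big_cat !big_map addrA.
  rewrite /index_iota subn0 subn1/= (iotaDl 1 0 N) big_map.
  by congr (expR (_ + _)).
have := @mutual_indep_prod R _ _ P _ _ X v J ind uJ _ _ _.
rewrite (XJ (fun i => match i with
  | None => 2^-1 * qform S0 a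
  | Some (inl s) => 2^-1 * qform Sw (c s)
  | Some (inr s) => 2^-1 * qform Sv (e s.+1) end)); last by case=> [[]|].
rewrite -!mulr_sumr -!mulrDr => h.
rewrite (_ : \sum_(1 <= s < N.+1) qform Sv (e s) =
   \sum_(1 <= s < N.+1) qform Sv (e s.-1.+1)); last first.
  by apply: eq_big_nat => -[].
apply: eq_hasE (h _ _ _).
- move=> x; rewrite (XJ (fun i => match i with
  | None => dot a (th 0 x)
  | Some (inl s) => dot (c s) (w s x)
  | Some (inr s) => dot (e s.+1) (nu s.+1 x) end)); last by case=> [[]|].
  by congr (expR (_ + _)); apply: eq_big_nat => -[].
- by move=> [[s|s]|] _; apply: gaussian_mgf => //; exact: gnu.
- by move=> [[s|s]|] x; exact: expR_ge0.
- by move=> [[s|s]|] _ /=; apply: (smeas_comp (h := expR)) => //; exact: smeas_dot.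
Qed.

(** At stage [t] the noises [w] from index [t] and [nu] from index [t.+1] are still explicit. The
    next stage absorbs [w t] and [nu t.+1], which fixes their coefficients to [a'] and [b t.+1]. *)
Let model_latents_mgf N t a b c e : (t <= N)%N ->
  hasE P (fun x => expR (dot a (th t x) + \sum_(1 <= s < t.+1) dot (b s) (Y s x)
             + \sum_(t <= s < N) dot (c s) (w s x)
             + \sum_(t.+1 <= s < N.+1) dot (e s) (nu s x)))
   (expR (2^-1 * (Qf t a b + \sum_(t <= s < N) qform Sw (c s)
             + \sum_(t.+1 <= s < N.+1) qform Sv (e s)))).
Proof.
have [_ _ _ thE YE] := model.
elim: t a c e => [|t ih] a c e tN.
  by apply: eq_hasE (latents_mgf N a c e) => x; rewrite [in RHS]big_nil addr0.
pose a' := a + C^T *m b t.+1.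
pose c' s := if s == t then a' else c s.
pose e' s := if s == t.+1 then b t.+1 else e s.
have c'E (f : nat -> 'cV[R]_d -> R) :
    \sum_(t <= s < N) f s (c' s) = f t a' + \sum_(t.+1 <= s < N) f s (c s).
  rewrite big_ltn// {1}/c' eqxx; congr (_ + _); apply: eq_big_nat => s /andP[ts _].
  by rewrite /c' gtn_eqF.
have e'E (f : nat -> 'cV[R]_m -> R) :
    \sum_(t.+1 <= s < N.+1) f s (e' s) = f t.+1 (b t.+1) + \sum_(t.+2 <= s < N.+1) f s (e s).
  rewrite big_ltn// {1}/e' eqxx; congr (_ + _); apply: eq_big_nat => s /andP[ts _].
  by rewrite /e' gtn_eqF.
have := ih (A^T *m a') c' e' (ltnW tN).
rewrite (c'E (fun _ => qform Sw)) (e'E (fun _ => qform Sv)) /=.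
congr (hasE _ _ (expR (_ * _))); last by rewrite -/a'; ring.
apply/funext => x; congr expR.
rewrite (c'E (fun s u => dot u (w s x))) (e'E (fun s u => dot u (nu s x))).
rewrite [in RHS]big_nat_recr//= YE// dotDr !dot_mulmx.
have -> : dot a (th t.+1 x) = dot a' (th t.+1 x) - dot (C^T *m b t.+1) (th t.+1 x).
  by rewrite /a' dotDl addrK.
rewrite {1}thE dotDr dot_mulmx; ring.
Qed.

Lemma model_mgf t a b :
  hasE P (fun x => expR (dot a (th t x) + \sum_(1 <= s < t.+1) dot (b s) (Y s x)))
   (expR (2^-1 * Qf t a b)).
Proof.
have := @model_latents_mgf t t a b (fun=> 0) (fun=> 0) (leqnn t).
rewrite !(big_geq (leqnn _)) !addr0; apply: eq_hasE => x.
by rewrite !(big_geq (leqnn _)) !addr0.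
Qed.

End model_mgf.

(** * First and second moments read off the mgf *)

Section moments.
Context {R : realType} {d : measure_display} {T : measurableType d}.
Variable mu : {measure set T -> \bar R}.

(** The symmetrized difference quotients of exp at 0 have weighted expectation 0 by evenness, and
    they tend to [V] under an integrable bound, so nothing needs to be differentiated. *)
Lemma mgf_even_mean0 (W V : T -> R) (f : R -> R) :
  (forall a, hasE mu (fun x => W x * expR (a * V x)) (f a)) ->
  (forall a, f (- a) = f a) -> hasE mu (fun x => W x * V x) 0.
Proof.
move=> WV feven.
pose u (n : nat) (v : R) := (expR (v / n.+1%:R) - 1) * n.+1%:R.
have W0 : hasE mu W (f 0).
  by apply: eq_hasE (WV 0) => x; rewrite mul0r expR0 mulr1.
have [g1 h1] := integrable_hasE (hasE_norm (WV 2)).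
have [g2 h2] := integrable_hasE (hasE_norm (WV (-2))).
have [|||l hl c0] := @hasE_dct _ _ _ mu
    (fun n x => W x * (2^-1 * (u n (V x) - u n (- V x))))
    (fun x => W x * V x) _ (fun=> 0) _ _ _ (proj1 (hasED h1 h2)).
- move=> n; pose k : R := n.+1%:R.
  have H b : hasE mu (fun x => W x * u n (b * V x)) ((f (b / k) - f 0) * k).
    rewrite [X in hasE _ _ X]mulrC.
    apply: eq_hasE (hasEZ k (hasEB (WV (b / k)) W0)) => x.
    by rewrite /u -/k [b * V x / k]mulrAC; ring.
  have := hasEZ 2^-1 (hasEB (H 1) (H (-1))).
  rewrite mulN1r feven mul1r subrr mulr0.
  by apply: eq_hasE => x; rewrite mul1r mulN1r; ring.
- move=> x; rewrite [X in _ --> X](_ : _ = W x * (2^-1 * (V x - - V x))); last by field.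
  apply: cvgM; first exact: cvg_cst.
  apply: cvgM; first exact: cvg_cst.
  by apply: cvgB; exact: cvg_expRB1.
- move=> n x /=; rewrite !normrM !(ger0_norm (expR_ge0 _)) -mulrDr ler_wpM2l//.
  have B v : `|u n v| <= expR (2 * `|v|) by exact: normr_expRB1n.
  apply: (@le_trans _ _ (expR (2 * `|V x|))).
    have := B (V x); have := B (- V x); rewrite normrN ger0_norm// => b1 b2.
    have := ler_normB (u n (V x)) (u n (- V x)); lra.
  rewrite -[X in X * `|_|](@ger0_norm _ 2)// -normrM mulNr.
  exact: expR_norm_le.
suff <- : l = 0 by [].
by apply: (@cvg_unique _ (@Rhausdorff R) _ _ _ _ c0); exact: cvg_cst.
Qed.

Lemma mgf_second (X : T -> R) (q : R) :
  (forall a, hasE mu (fun x => expR (a * X x)) (expR (2^-1 * (a ^+ 2 * q)))) ->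
  hasE mu (fun x => X x ^+ 2) q.
Proof.
move=> XE.
pose u (n : nat) (v : R) := (expR (v / n.+1%:R) - 1) * n.+1%:R.
pose k (n : nat) : R := n.+1%:R.
have one : hasE mu (fun x => 1) 1.
  have := XE 0; rewrite expr0n/= mul0r mulr0 expR0.
  by apply: eq_hasE => x; rewrite mul0r expR0.
(* The expectation of the squared quotient (k (exp(X / k) - 1))^2, after expanding the square; its
   limit is 2 q - q. *)
pose a_ n := (expR (2 * q / k n ^+ 2) - 1) * k n ^+ 2
   - 2 * ((expR (2^-1 * q / k n ^+ 2) - 1) * k n ^+ 2).
have k0 n : k n != 0 by rewrite pnatr_eq0.
have [|||l hl cl] := @hasE_dct _ _ _ mu (fun n x => u n (X x) ^+ 2)
    (fun x => X x ^+ 2) _ a_ _ _ _ (proj1 (hasED (XE 4) (XE (-4)))).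
- move=> n.
  have := hasEZ (k n ^+ 2) (hasED (hasEB (XE (2 / k n)) (hasEZ 2 (XE ((k n)^-1)))) one).
  congr hasE; last first.
    rewrite /a_ (_ : 2^-1 * ((2 / k n) ^+ 2 * q) = 2 * q / k n ^+ 2); last first.
      by field; rewrite ?k0 ?pnatr_eq0.
    rewrite (_ : 2^-1 * ((k n)^-1 ^+ 2 * q) = 2^-1 * q / k n ^+ 2); last first.
      by field; rewrite ?k0 ?pnatr_eq0.
    by ring.
  apply/funext => x; rewrite /u -/(k n) (_ : 2 / k n * X x = 2%:R * (X x / k n)); last first.
    by field; rewrite ?k0 ?pnatr_eq0.
  by rewrite expRM_natl [_^-1 * _]mulrC; ring.
- by move=> x; apply: cvg_exprn; exact: cvg_expRB1.
- move=> n x; rewrite normrX.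
  apply: (@le_trans _ _ (expR (2 * `|X x|) ^+ 2)).
    by apply: lerXn2r; rewrite ?nnegrE ?expR_ge0//; exact: normr_expRB1n.
  rewrite -expRM_natl mulrA -natrM -[X in X * _](@ger0_norm _ _ (ler0n R 4)).
  by rewrite -normrM mulNr expR_norm_le.
have sub (y : R) : (expR (y / k n ^+ 2) - 1) * k n ^+ 2 @[n --> \oo] --> y.
  (* Since (n + 1)^2 = (n^2 + 2 n) + 1, the sequence is a subsequence of the one in [cvg_expRB1]. *)
  have inj : (fun n : nat => (n * n + n * 2)%N) @ \oo --> \oo.
    apply/cvgnyPge => M; exists M => // n /= Mn; apply: leq_trans Mn _.
    exact: leq_trans (leq_pmulr n (ltn0Sn 1)) (leq_addl _ _).
  have E n : k n ^+ 2 = (n * n + n * 2).+1%:R.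
    by rewrite /k -natrX; congr _%:R; rewrite expnS expn1 mulSn mulnS; ring.
  under eq_fun do rewrite E.
  exact: (cvg_comp _ _ inj (@cvg_expRB1 R y)).
have cl' : a_ n @[n --> \oo] --> 2 * q - 2 * (2^-1 * q).
  apply: cvgB; first exact: sub.
  by apply: cvgM; [exact: cvg_cst|exact: sub].
have : l = 2 * q - 2 * (2^-1 * q) by exact: (@cvg_unique _ (@Rhausdorff R) _ _ _ _ cl cl').
by rewrite (_ : _ - _ = q) => [<-//|]; field.
Qed.

End moments.

Section lin_algebra.
Context {R : realType} {T : Type} {J : finType}.
Implicit Types (p q : J -> R) (G : J -> T -> R).

Definition delta (j i : J) : R := (i == j)%:R.

Lemma lin_delta G j x : lin G (delta j) x = G j x.
Proof.
rewrite /lin (bigD1 j)//= /delta eqxx mul1r big1 ?addr0// => i /negPf ->.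
by rewrite mul0r.
Qed.

Lemma linD G p q x : lin G (fun i => p i + q i) x = lin G p x + lin G q x.
Proof. by rewrite /lin -big_split; apply: eq_bigr => i _; rewrite mulrDl. Qed.

Lemma linZ G k p x : lin G (fun i => k * p i) x = k * lin G p x.
Proof. by rewrite /lin mulr_sumr; apply: eq_bigr => i _; rewrite mulrA. Qed.

Lemma linB G p q x : lin G (fun i => p i - q i) x = lin G p x - lin G q x.
Proof.
by rewrite /lin -sumrB; apply: eq_bigr => i _; rewrite mulrBl.
Qed.

Lemma lin_sum G (I : finType) (p : I -> J -> R) (c : I -> R) x :
  lin G (fun j => \sum_i c i * p i j) x = \sum_i c i * lin G (p i) x.
Proof.
rewrite /lin; under eq_bigr do rewrite mulr_suml.
rewrite exchange_big; apply: eq_bigr => i _; rewrite mulr_sumr.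
by apply: eq_bigr => j _; rewrite mulrA.
Qed.

Definition bil (S : J -> J -> R) p q : R := \sum_i \sum_j p i * q j * S i j.

End lin_algebra.

Section gaussian_family.
Context {R : realType} {d : measure_display} {T : measurableType d}.
Variable P : probability T R.
Context {J : finType} (G : J -> T -> R) (Q : (J -> R) -> R).
Hypothesis mgfG : forall p, hasE P (fun x => expR (lin G p x)) (expR (2^-1 * Q p)).
Hypothesis QZ : forall k p, Q (fun i => k * p i) = k ^+ 2 * Q p.

(** Polarization of [Q], so the covariances depend on [Q] alone and not on the probability space
    that carries [G]. *)
Definition covQ (i j : J) : R :=
  2^-1 * (Q (fun l => delta i l + delta j l) - Q (delta i) - Q (delta j)).

Let mgf1 p a : hasE P (fun x => expR (a * lin G p x)) (expR (2^-1 * (a ^+ 2 * Q p))).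
Proof. by rewrite -QZ; apply: eq_hasE (mgfG _) => x; rewrite linZ. Qed.

Lemma lin_sqr p : hasE P (fun x => lin G p x ^+ 2) (Q p).
Proof. by apply: mgf_second; exact: mgf1. Qed.

Lemma lin_mean p : hasE P (lin G p) 0.
Proof.
have := @mgf_even_mean0 _ _ _ P (fun=> 1) (lin G p)
  (fun a => expR (2^-1 * (a ^+ 2 * Q p))) _ _.
move=> h; apply: eq_hasE (h _ _) => [x|a|a]; first by rewrite mul1r.
  by apply: eq_hasE (mgf1 p a) => x; rewrite mul1r.
by rewrite sqrrN.
Qed.

Let cov_fam i j : hasE P (fun x => G i x * G j x) (covQ i j).
Proof.
have := hasEZ 2^-1 (hasEB (hasEB (lin_sqr (fun l => delta i l + delta j l))
   (lin_sqr (delta i))) (lin_sqr (delta j))).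
by apply: eq_hasE => x; rewrite linD !lin_delta; field.
Qed.

Lemma lin_cov p q : hasE P (fun x => lin G p x * lin G q x) (bil covQ p q).
Proof.
rewrite /bil; apply: (@eq_hasE _ _ _ _
  (fun x => \sum_i \sum_j (p i * q j) * (G i x * G j x))).
  move=> x; rewrite /lin mulr_suml; apply: eq_bigr => i _; rewrite mulr_sumr.
  by apply: eq_bigr => j _; rewrite mulrACA.
by apply: hasE_sum => i _; apply: hasE_sum => j _; apply: hasEZ; exact: cov_fam.
Qed.

(** Without correlation Q(q + a p) has no term linear in a, so the mgf of [lin G p] tilted by exp of
    [lin G q] is even in a. Orthogonality to all these exponentials is what later determines the
    conditional mean. *)
Lemma lin_orth p q : bil covQ p q = 0 ->
  hasE P (fun x => expR (lin G q x) * lin G p x) 0.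
Proof.
move=> pq0.
have QE a : Q (fun i => q i + a * p i) = Q q + a ^+ 2 * Q p.
  apply: hasE_unique (lin_sqr _) _.
  have := hasED (hasED (lin_sqr q) (hasEZ (a ^+ 2) (lin_sqr p)))
     (hasEZ (2 * a) (lin_cov p q)).
  rewrite pq0 mulr0 addr0; apply: eq_hasE => x.
  by rewrite linD linZ; ring.
apply: (@mgf_even_mean0 _ _ _ P _ _
  (fun a => expR (2^-1 * (Q q + a ^+ 2 * Q p)))) => a; last by rewrite sqrrN.
by rewrite -QE; apply: eq_hasE (mgfG _) => x; rewrite linD linZ expRD.
Qed.

End gaussian_family.

Section regression.
Context {R : realType} {d : measure_display} {T : measurableType d}.
Variable P : probability T R.
Context {D I : finType}.
Variables (G : D + I -> T -> R) (Q : ((D + I) -> R) -> R).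
Hypothesis mgfG : forall p, hasE P (fun x => expR (lin G p x)) (expR (2^-1 * Q p)).
Hypothesis QZ : forall k p, Q (fun i => k * p i) = k ^+ 2 * Q p.

Local Notation S := (covQ Q).

Definition on_inr (c : I -> R) (j : D + I) : R := if j is inr i then c i else 0.

Lemma bil_on_inrl c q : bil S (on_inr c) q = \sum_i \sum_j c i * q j * S (inr i) j.
Proof.
rewrite /bil big_sumType/= big1 ?add0r// => i _.
by rewrite big1// => j _; rewrite !mul0r.
Qed.

Lemma covQC i j : S i j = S j i.
Proof.
rewrite /covQ; congr (_ * _); rewrite addrAC; congr (Q _ - _ - _).
by apply/funext => l; rewrite addrC.
Qed.

(* The normal equations are solvable because a null vector of the covariance
   matrix gives a null random variable, hence is orthogonal to everything. *)
Lemma normal_equations (k : D) : exists c : I -> R,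
  forall j, S (inl k) (inr j) = \sum_i c i * S (inr i) (inr j).
Proof.
pose n := #|I|.
pose M : 'M[R]_n := \matrix_(i, j) S (inr (enum_val i)) (inr (enum_val j)).
pose v : 'rV[R]_n := \row_j S (inl k) (inr (enum_val j)).
have key (x : 'cV[R]_n) : M *m x = 0 -> v *m x = 0.
  move=> Mx.
  pose c i := x (enum_rank i) ord0.
  have xE (F : I -> R) : \sum_j F (enum_val j) * x j ord0 = \sum_i F i * c i.
    rewrite [RHS](reindex_onto enum_val enum_rank)/=; last by move=> i _; exact: enum_rankK.
    apply: eq_big => j; first by rewrite enum_valK eqxx.
    by rewrite /c enum_valK.
  have Mc i : \sum_j S (inr i) (inr j) * c j = 0.
    rewrite -(xE (fun j => S (inr i) (inr j))) -[RHS](_ : (M *m x) (enum_rank i) ord0 = 0).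
      by rewrite mxE; apply: eq_bigr => j _; rewrite !mxE enum_rankK.
    by rewrite Mx mxE.
  have b0 : bil S (on_inr c) (on_inr c) = 0.
    rewrite bil_on_inrl big1// => i _; rewrite big_sumType/= big1 ?add0r; last first.
      by move=> j _; rewrite mulr0 mul0r.
    transitivity (c i * \sum_j S (inr i) (inr j) * c j); last by rewrite Mc mulr0.
    by rewrite mulr_sumr; apply: eq_bigr => j _; rewrite -mulrA [c j * _]mulrC.
  have vE : bil S (on_inr c) (delta (inl k)) = (v *m x) ord0 ord0.
    rewrite bil_on_inrl mxE; under [RHS]eq_bigr do rewrite mxE.
    rewrite (xE (fun j => S (inl k) (inr j))); apply: eq_bigr => i _.
    rewrite (bigD1 (inl k))//= big1 ?addr0; last first.
      by move=> j /negPf jk; rewrite /delta jk mulr0 mul0r.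
    by rewrite /delta eqxx mulr1 mulrC covQC.
  apply/matrixP => i j; rewrite !ord1 -vE [RHS]mxE.
  set e := bil _ _ _; pose q := Q (delta (inl k)).
  (* The null vector makes the second moment of a u + z affine in a; being nonnegative for every a,
     it has slope 0. *)
  have ineq a : 0 <= 2 * a * e + q.
    have := hasED (hasED (hasEZ (a ^+ 2) (lin_cov mgfG QZ (on_inr c) (on_inr c)))
      (hasEZ (2 * a) (lin_cov mgfG QZ (on_inr c) (delta (inl k)))))
      (lin_sqr mgfG QZ (delta (inl k))).
    rewrite b0 mulr0 add0r => /hasE_ge0; apply => o.
    set u := lin _ _ _; set z := lin _ _ _.
    rewrite (_ : _ + _ = (a * u + z) ^+ 2); last by ring.
    exact: sqr_ge0.
  apply/eqP/negPn/negP => e0.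
  have := ineq (- (q + 1) / (2 * e)).
  rewrite (_ : 2 * _ * e = - (q + 1)); last by field.
  by rewrite opprD addrAC addNr add0r oppr_ge0 leNgt ltr01.
(* Membership in the row space is tested on the columns of the cokernel, each of which is a null
   vector of [M]. *)
have vM : (v <= M)%MS.
  rewrite submxE; move: (cokermx M) (mulmx_coker M) => N MN.
  apply/eqP/matrixP => i j; have := key (col j N).
  rewrite colE !mulmxA MN mul0mx => /(_ erefl).
  by rewrite -colE => /matrixP/(_ i ord0); rewrite !mxE.
have /submxP[y yE] := vM.
exists (fun i => y ord0 (enum_rank i)) => j.
have := congr1 (fun u : 'rV[R]_n => u ord0 (enum_rank j)) yE.
rewrite !mxE enum_rankK => ->.
rewrite [RHS](reindex_onto enum_val enum_rank)/=; last by move=> i _; exact: enum_rankK.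
apply: eq_big => i; first by rewrite enum_valK eqxx.
by rewrite mxE enum_valK enum_rankK.
Qed.

Variable K : D -> I -> R.
Hypothesis KE : forall k j, S (inl k) (inr j) = \sum_i K k i * S (inr i) (inr j).

Definition resid (k : D) (j : D + I) : R := delta (inl k) j - on_inr (K k) j.

Lemma resid_orth k c : bil S (resid k) (on_inr c) = 0.
Proof.
rewrite /bil big_sumType/= [X in X + _](_ : _ = \sum_j c j * S (inl k) (inr j)); last first.
  rewrite (bigD1 k)//= [X in _ + X]big1 ?addr0; last first.
    move=> i /negPf ik; rewrite big1// => j _.
    by rewrite /resid /delta /= -[inl i == _]/(i == k) ik subr0 !mul0r.
  rewrite big_sumType/= big1 ?add0r => [|j _]; last by rewrite mulr0 mul0r.
  by apply: eq_bigr => j _; rewrite /resid /delta eqxx /= subr0 mul1r.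
rewrite [X in _ + X](_ : _ = - \sum_j c j * S (inl k) (inr j)) ?subrr//.
under [in RHS]eq_bigr do rewrite KE mulr_sumr.
rewrite [in RHS]exchange_big /= -sumrN; apply: eq_bigr => i _.
rewrite big_sumType/= big1 ?add0r => [|j _]; last by rewrite mulr0 mul0r.
rewrite -sumrN; apply: eq_bigr => j _.
by rewrite /resid /delta /= sub0r; ring.
Qed.

Lemma resid_cond k (Dset : set T) : <<s fam_gen (fun i => G (inr i)) >> Dset ->
  hasE P (fun x => lin G (resid k) x * \1_Dset x) 0.
Proof.
apply: mgf_signed_zero => b.
have := lin_orth mgfG QZ (resid_orth k b).
apply: eq_hasE => x; rewrite mulrC; congr (_ * expR _).
by rewrite /lin big_sumType/= big1 ?add0r// => i _; rewrite mul0r.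
Qed.

End regression.

(** * Lower bound on the mutual information *)

Section quantizer.
Context {R : realType}.
Import HBNNSimple.

(** The bound |q n z| <= |z| lets the unquantized variables dominate every quantized expression.
    Both signs are approximated from zero by simple functions, separately. *)
Lemma quantizer : exists q : nat -> R -> R, forall n,
  [/\ measurable_fun setT (q n), exists s : seq R, forall z, q n z \in s,
      forall z, `|q n z| <= `|z| & forall z, q k z @[k --> \oo] --> z].
Proof.
pose hp (z : R) := Num.max z 0; pose hm (z : R) := Num.max (- z) 0.
have mp : measurable_fun setT (EFin \o hp).
  by apply/measurable_EFinP; exact: measurable_maxr.
have mm : measurable_fun setT (EFin \o hm).
  by apply/measurable_EFinP; apply: measurable_maxr => //; exact: measurableT_comp.
have p0 z : 0 <= hp z by rewrite le_max lexx orbT.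
have m0 z : 0 <= hm z by rewrite le_max lexx orbT.
pose qp := nnsfun_approx measurableT mp; pose qm := nnsfun_approx measurableT mm.
have cp z : qp k z @[k --> \oo] --> hp z.
  by have /fine_cvgP[_] := @cvg_nnsfun_approx _ _ _ _ measurableT _ mp (fun x _ => p0 x) z I.
have cm z : qm k z @[k --> \oo] --> hm z.
  by have /fine_cvgP[_] := @cvg_nnsfun_approx _ _ _ _ measurableT _ mm (fun x _ => m0 x) z I.
have lp n z : 0 <= qp n z <= hp z.
  rewrite fun_ge0/= -lee_fin nnsfun_approxE.
  exact: (le_approx n (fun x _ => p0 x : (0 <= (EFin \o hp) x)%E) (I : setT z)).
have lm n z : 0 <= qm n z <= hm z.
  rewrite fun_ge0/= -lee_fin nnsfun_approxE.
  exact: (le_approx n (fun x _ => m0 x : (0 <= (EFin \o hm) x)%E) (I : setT z)).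
exists (fun n z => qp n z - qm n z) => n; split.
- exact: measurable_funB.
- have /finite_seqP[sp spE] : finite_set (range (qp n)) by [].
  have /finite_seqP[sm smE] : finite_set (range (qm n)) by [].
  exists [seq x - y | x <- sp, y <- sm] => z; apply: allpairs_f.
    by have : [set` sp] (qp n z) by rewrite -spE; exists z.
  by have : [set` sm] (qm n z) by rewrite -smE; exists z.
- move=> z; have /andP[a1 a2] := lp n z; have /andP[b1 b2] := lm n z.
  have /andP[_ c1] := maxr0_norm z; have /andP[_ c2] := maxr0_norm (- z).
  rewrite normrN in c2; rewrite ler_norml; apply/andP; split.
    rewrite lerBrDl; apply: le_trans a1; rewrite subr_le0.
    by apply: le_trans b2 c2.
  by rewrite lerBlDr; apply: le_trans a2 _; apply: le_trans c1 _; rewrite lerDl.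
- by move=> z; rewrite -[X in _ --> X]maxrBmaxr; apply: cvgB; [exact: cp|exact: cm].
Qed.

End quantizer.

Section finite_valued.
Context {R : realType} {d : measure_display} {T : measurableType d}.
Variable P : probability T R.

Lemma hasE_finite (F : finType) (a : T -> F) (f : F -> R) :
  (forall i, measurable (a @^-1` [set i])) ->
  hasE P (fun x => f (a x)) (\sum_i f i * fine (P (a @^-1` [set i]))).
Proof.
move=> ma; apply: (@eq_hasE _ _ _ _ (fun x => \sum_i f i * \1_(a @^-1` [set i]) x)).
  move=> x; rewrite (bigD1 (a x))//= indicE mem_set// mulr1 big1 ?addr0// => i ix.
  rewrite indicE memNset ?mulr0//= => ax.
  by move: ix; rewrite -ax eqxx.
by apply: hasE_sum => i _; apply: hasEZ; exact: hasE_indic.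
Qed.

(** With t = ln(pab / (pa pb)), this is 1 + (c - t) <= exp(c - t) multiplied by [pab]. If [pab] is
    0, the left side is nonpositive. *)
Lemma gibbs_term (pab pa pb c : R) : 0 <= pab -> 0 <= pa -> 0 <= pb ->
  pab <= pa -> pab <= pb ->
  pab * c + pab - pa * pb * expR c <= mi_term pab pa pb.
Proof.
move=> h ha hb la lb; rewrite /mi_term; have [->|h0] := eqVneq pab 0.
  by rewrite mul0r !add0r oppr_le0 !mulr_ge0 ?expR_ge0.
have p0 : 0 < pab by rewrite lt_neqAle eq_sym h0.
have pa0 : 0 < pa by exact: lt_le_trans la.
have pb0 : 0 < pb by exact: lt_le_trans lb.
have pp0 : 0 < pa * pb by exact: mulr_gt0.
pose t := ln (pab / (pa * pb)).
have tE : pab = pa * pb * expR t by rewrite /t lnK ?posrE ?divr_gt0// mulrC divfK// gt_eqF.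
have := expR_ge1Dx (c - t); rewrite expRB => e1.
have : pab * (1 + (c - t)) <= pa * pb * expR c.
  apply: (@le_trans _ _ (pab * (expR c / expR t))); first by rewrite ler_wpM2l.
  rewrite {1}tE le_eqVlt; apply/orP; left; apply/eqP.
  by field; rewrite gt_eqF// expR_gt0.
rewrite -/t; lra.
Qed.

(** A linearized form of the Donsker-Varadhan bound: E c + 1 minus the expectation of exp c under
    the product of the marginals. The subtracted sum is that expectation, with [b] integrated
    first. *)
Lemma mi_discrete (GX GY : set (set T)) (FA FB : finType) (a : T -> FA) (b : T -> FB)
    (c : FA -> FB -> R) (Bc v : R) (u : FA -> R) :
  GX `<=` measurable -> GY `<=` measurable ->
  (mutual_info P GX GY <= Bc%:E)%E ->
  (forall i, <<s GX >> (a @^-1` [set i])) -> (forall j, <<s GY >> (b @^-1` [set j])) ->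
  hasE P (fun x => c (a x) (b x)) v ->
  (forall i, hasE P (fun x => expR (c i (b x))) (u i)) ->
  v + 1 - \sum_i fine (P (a @^-1` [set i])) * u i <= Bc.
Proof.
move=> mGX mGY MI aG bG cv cu.
pose pa i := fine (P (a @^-1` [set i])); pose pb j := fine (P (b @^-1` [set j])).
pose pab i j := fine (P (a @^-1` [set i] `&` b @^-1` [set j])).
have ma i : measurable (a @^-1` [set i]) by apply: (sub_sigma_measurable mGX).
have mb j : measurable (b @^-1` [set j]) by apply: (sub_sigma_measurable mGY).
have mab i j : measurable (a @^-1` [set i] `&` b @^-1` [set j]) by exact: measurableI.
have fP S : measurable S -> P S \is a fin_num by move=> mS; exact: fin_num_measure.
have pge0 S : 0 <= fine (P S) by rewrite fine_ge0.
have pable i j : pab i j <= pa i /\ pab i j <= pb j.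
  have le S S' : measurable S -> measurable S' -> S `<=` S' -> fine (P S) <= fine (P S').
    by move=> mS mS' SS'; apply: fine_le; rewrite ?fP//; apply: le_measure; rewrite ?inE.
  by split; apply: le.
have fibE i j : (fun x => (a x, b x)) @^-1` [set (i, j)] = a @^-1` [set i] `&` b @^-1` [set j].
  by apply/seteqP; split => x /=; [case=> <- <-|case=> -> ->].
have hab (f : FA -> FB -> R) : hasE P (fun x => f (a x) (b x)) (\sum_i \sum_j f i j * pab i j).
  rewrite pair_bigA/=.
  have := @hasE_finite _ (fun x => (a x, b x)) (fun ij => f ij.1 ij.2) _.
  move=> h; have := h _; rewrite (eq_bigr (fun ij => f ij.1 ij.2 * pab ij.1 ij.2)).
    by apply; move=> [i j]; rewrite fibE.
  by move=> [i j] _; rewrite fibE.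
have vE : v = \sum_i \sum_j c i j * pab i j by exact: hasE_unique cv (hab _).
have oneE : 1 = \sum_i \sum_j 1 * pab i j.
  exact: hasE_unique (hasE_cst P 1) (hab (fun _ _ => 1)).
have uE i : u i = \sum_j expR (c i j) * pb j.
  exact: hasE_unique (cu i) (hasE_finite (fun j => expR (c i j)) mb).
apply: (@le_trans _ _ (\sum_i \sum_j mi_term (pab i j) (pa i) (pb j))).
  rewrite vE oneE -big_split/= -sumrB; apply: ler_sum => i _.
  rewrite uE mulr_sumr -big_split/= -sumrB; apply: ler_sum => j _.
  have [l1 l2] := pable i j.
  have := gibbs_term (c i j) (pge0 _) (pge0 _) (pge0 _) l1 l2.
  rewrite mul1r [c i j * _]mulrC -/(pa i) [expR _ * _]mulrC mulrA; exact.
rewrite -lee_fin; apply: le_trans MI; apply: ereal_sup_ubound.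
exists #|FA|, #|FB|, (fun i => a @^-1` [set enum_val i]), (fun j => b @^-1` [set enum_val j]).
have partE (F : finType) (g : T -> F) (G : set (set T)) :
    (forall i, <<s G >> (g @^-1` [set i])) ->
    is_partition G (fun i : 'I_#|F| => g @^-1` [set enum_val i]).
  move=> gG; split=> [i|i j ij|]; first exact: gG.
    apply/seteqP; split => x //= [-> /enum_val_inj ijE].
    by rewrite ijE eqxx in ij.
  by apply/seteqP; split => x // _; exists (enum_rank (g x)) => //=; rewrite enum_rankK.
split; [exact: partE|exact: partE|].
have sumE (F : finType) (f : F -> R) : \sum_i f i = \sum_(i < #|F|) f (enum_val i).
  rewrite (reindex_onto enum_val enum_rank)/=; last by move=> i _; exact: enum_rankK.
  by apply: eq_bigl => j; rewrite enum_valK eqxx.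
by congr _%:E; rewrite sumE; apply: eq_bigr => i _; rewrite sumE.
Qed.

Lemma discretize (G : set (set T)) n (Y : 'I_n -> T -> R) (q : R -> R) (s : seq R) :
  (forall i, smeas G (Y i)) -> measurable_fun setT q -> (forall z, q z \in s) ->
  exists a : T -> {ffun 'I_n -> seq_sub s},
    (forall f, <<s G >> (a @^-1` [set f])) /\
    (forall x i, ssval (a x i) = q (Y i x)).
Proof.
move=> mY mq qs.
exists (fun x => [ffun i => SeqSub (qs (Y i x))]); split; last by move=> x i; rewrite ffunE.
move=> f.
rewrite (_ : _ @^-1` _ = \bigcap_(i in [set: 'I_n]) ((fun x => q (Y i x)) @^-1` [set ssval (f i)])).
  apply: (@fin_bigcap_measurable _ (g_sigma_algebraType G)) => // i _.
  exact: (smeas_comp mq (mY i)).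
apply/seteqP; split => x /=.
  by move=> <- i _ /=; rewrite ffunE.
move=> h; apply/ffunP => i; rewrite ffunE; apply/val_inj => /=.
by have := h i I.
Qed.

End finite_valued.

Lemma cvgn_le_cst {R : realType} (u : nat -> R) (l b : R) :
  u n @[n --> \oo] --> l -> (forall n, u n <= b) -> l <= b.
Proof.
move=> ul ub; rewrite -(cvg_lim (@Rhausdorff R) ul); apply: limr_le.
  by apply/cvg_ex; exists l.
exact: nearW.
Qed.

Lemma cvgn_sum {R : realType} (I : Type) (s : seq I) (u : I -> nat -> R) (l : I -> R) :
  (forall i, u i n @[n --> \oo] --> l i) ->
  \sum_(i <- s) u i n @[n --> \oo] --> \sum_(i <- s) l i.
Proof.
move=> ul; elim: s => [|i s ih].
  rewrite big_nil (_ : (fun n => _) = fun=> 0); first exact: cvg_cst.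
  by apply/funext => n; rewrite big_nil.
rewrite big_cons (_ : (fun n => _) = fun n => u i n + \sum_(j <- s) u j n).
  exact: cvgD.
by apply/funext => n; rewrite big_cons.
Qed.

Section converse.
Context {R : realType} {d : measure_display} {T : measurableType d}.
Variable P : probability T R.
Variables (n : nat) (GX GY : set (set T)) (Y Z : 'I_n -> T -> R).
Variables (lam kap bet : 'I_n -> R) (eta Bc : R).
Hypotheses (mGX : GX `<=` measurable) (mGY : GY `<=` measurable).
Hypotheses (mY : forall i, smeas GX (Y i)) (mZ : forall i, smeas GY (Z i)).
Hypothesis MI : (mutual_info P GX GY <= Bc%:E)%E.
Hypothesis mgfZ : forall b, hasE P (fun x => expR (lin Z b x))
  (\prod_i expR (2^-1 * (lam i * b i ^+ 2))).
Hypotheses (lam0 : forall i, 0 <= lam i) (kap0 : forall i, 0 <= kap i) (eta0 : 0 < eta).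
Hypothesis kapE : forall i, 1 + 2 * kap i * lam i = expR (2 * bet i).
Hypothesis lam_le : forall i, 2 * lam i <= eta * expR (2 * bet i).

(* On active coordinates this is the log-density of the backward channel
   N(y, eta/2) with respect to the source law N(0, lam); on inactive ones
   [kap] and [bet] vanish. *)
Definition chan (z y : 'I_n -> R) : R :=
  \sum_i (- kap i * z i ^+ 2 + (2 * z i * y i - y i ^+ 2) / eta + bet i).

Let measZ i : measurable_fun setT (Z i) := smeas_measurable mGY (mZ i).
Let measY i : measurable_fun setT (Y i) := smeas_measurable mGX (mY i).

(** Water-filling enters here: the exponent is a nonnegative multiple of 2 lam - eta exp(2 bet). *)
Let gauss_quad_le i y :
  gauss_quad (lam i) (- kap i) (2 * y / eta) * expR (bet i - y ^+ 2 / eta) <= 1.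
Proof.
have E : 1 - 2 * - kap i * lam i = expR (2 * bet i) by rewrite -kapE; ring.
rewrite /gauss_quad E.
have -> : Num.sqrt (expR (2 * bet i)) = expR (bet i).
  by rewrite mulrDl mul1r expRD -expr2 sqrtr_sqr ger0_norm// expR_ge0.
rewrite -expRN -!expRD -[X in _ <= X]expR0 ler_expR.
have e0 := expR_gt0 (2 * bet i); have le := lam_le i; set e := expR _ in e0 le *.
have -> : - bet i + lam i * (2 * y / eta) ^+ 2 / (2 * e) + (bet i - y ^+ 2 / eta)
   = y ^+ 2 / (eta ^+ 2 * e) * (2 * lam i - eta * e).
  by field; rewrite !gt_eqF.
apply: mulr_ge0_le0; last by rewrite subr_le0.
by rewrite divr_ge0 ?sqr_ge0// mulr_ge0 ?sqr_ge0// ltW.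
Qed.

Let chan_exp (y : 'I_n -> R) : exists2 u, u <= 1 &
  hasE P (fun x => expR (chan (fun i => Z i x) y)) u.
Proof.
have := @gauss_family _ _ _ P _ (fun=> 1) Z 1 lam (fun i => - kap i)
  (fun i => 2 * y i / eta) _ measZ _ lam0 _ _.
have cl i : 2 * - kap i * lam i < 1.
  apply: (@le_lt_trans _ _ 0) => //; rewrite mulrN mulNr oppr_le0 !mulr_ge0//.
move=> /(_ (measurable_cst _) (fun=> ler01) cl) h.
have /h {h} : forall t, hasE P (fun x => 1 * expR (lin Z t x))
    (1 * \prod_i expR (2^-1 * (lam i * t i ^+ 2))).
  by move=> t; rewrite mul1r; apply: eq_hasE (mgfZ t) => x; rewrite mul1r.
move=> /(hasEZ (\prod_i expR (bet i - y i ^+ 2 / eta))) h.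
eexists; last first.
  apply: eq_hasE h => x; rewrite mul1r -expR_sum -expRD; congr expR.
  rewrite -big_split/=; apply: eq_bigr => i _.
  by field; rewrite gt_eqF.
rewrite mul1r -big_split/=.
apply: (@le_trans _ _ (\prod_(i < n) (1 : R))); last by rewrite big1_eq.
apply: ler_prod => i _; rewrite mulrC gauss_quad_le andbT.
by rewrite mulr_ge0 ?expR_ge0// mulr_ge0 ?expR_ge0// invr_ge0.
Qed.

(** The coefficient keeps 2 c lam = lam / (2 (lam + 1)) below 1 even at lam = 0. The function
    dominates exp of [chan] at quantized [Z] and fixed [y]. *)
Let exp_sq_integrable : P.-integrable setT
  (EFin \o (fun x => expR (\sum_i (4 * (lam i + 1))^-1 * Z i x ^+ 2))).
Proof.
have := @gauss_family _ _ _ P _ (fun=> 1) Z 1 lam (fun i => (4 * (lam i + 1))^-1)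
  (fun i => 0) _ measZ _ lam0 _ _.
have cl i : 2 * (4 * (lam i + 1))^-1 * lam i < 1.
  have l1 : 0 < 4 * (lam i + 1) by rewrite mulr_gt0// ltr_wpDl.
  rewrite mulrAC ltr_pdivrMr// mul1r; have := lam0 i; lra.
move=> /(_ (measurable_cst _) (fun=> ler01) cl) h.
have /h [] : forall t, hasE P (fun x => 1 * expR (lin Z t x))
    (1 * \prod_i expR (2^-1 * (lam i * t i ^+ 2))).
  by move=> t; rewrite mul1r; apply: eq_hasE (mgfZ t) => x; rewrite mul1r.
move=> + _; apply: eq_integrable => // x _ /=; rewrite mul1r.
by congr (expR _)%:E; apply: eq_bigr => i _; rewrite mul0r addr0.
Qed.

Variables (zy yy : 'I_n -> R).
Hypothesis EZZ : forall i, hasE P (fun x => Z i x ^+ 2) (lam i).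
Hypothesis EZY : forall i, hasE P (fun x => Z i x * Y i x) (zy i).
Hypothesis EYY : forall i, hasE P (fun x => Y i x ^+ 2) (yy i).

(** Bounds [chan] at all quantized arguments at once, through |2 z y| <= z^2 + y^2. *)
Let chan_dom (x : T) := \sum_i (kap i * Z i x ^+ 2 +
   (Z i x ^+ 2 + 2 * Y i x ^+ 2) / eta + `|bet i|).

Let chan_dom_int : P.-integrable setT (EFin \o chan_dom).
Proof.
suff [v [] //] : exists v, hasE P chan_dom v.
eexists; rewrite /chan_dom; apply: hasE_sum => i _.
apply: hasED; last exact: hasE_cst.
apply: hasED; first by apply: hasEZ; exact: EZZ.
apply: eq_hasE; last first.
  apply: (hasEZ eta^-1); apply: hasED; first exact: EZZ.
  by apply: (hasEZ 2); exact: EYY.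
by move=> x; rewrite mulrC.
Qed.

Let chan_domP (z y : 'I_n -> R) x : (forall i, `|z i| <= `|Z i x|) ->
  (forall i, `|y i| <= `|Y i x|) -> `|chan z y| <= chan_dom x.
Proof.
move=> zZ yY; apply: le_trans (ler_norm_sum _ _ _) _; apply: ler_sum => i _.
apply: le_trans (ler_normD _ _) _; apply: lerD => //.
have sq (u v : R) : `|u| <= `|v| -> u ^+ 2 <= v ^+ 2.
  by move=> uv; rewrite -(real_normK (num_real u)) -(real_normK (num_real v)) lerXn2r ?nnegrE.
have z2 := sq _ _ (zZ i); have y2 := sq _ _ (yY i).
apply: le_trans (ler_normD _ _) _; apply: lerD.
  rewrite normrM normrN (ger0_norm (kap0 i)) (ger0_norm (sqr_ge0 _)).
  by rewrite ler_wpM2l.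
rewrite normrM (@gtr0_norm _ eta^-1) ?invr_gt0// ler_pM2r ?invr_gt0//.
rewrite ler_norml; apply/andP; split.
  have := sqr_ge0 (z i + y i); rewrite sqrrD -mulr_natl; nra.
have := sqr_ge0 (z i - y i); rewrite sqrrB -mulr_natl; nra.
Qed.

(** Gibbs' inequality needs both variables quantized, but the exponential bound by 1 is known only
    for the exact [Z]. Hence [Z] is refined first, at a fixed level of [Y]: only finitely many
    values [y] occur, and each exponential moment converges separately. Refining [Y] afterwards
    involves [chan] but no exponential. *)
Lemma mutual_info_converse :
  \sum_i (- kap i * lam i + (2 * zy i - yy i) / eta + bet i) <= Bc.
Proof.
have [q qP] := @quantizer R.
pose Yq N x i := q N (Y i x); pose Zq k x i := q k (Z i x).
have qc z : q k z @[k --> \oo] --> z by have [] := qP 0%N.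
have chan_cvg (z_ y_ : nat -> 'I_n -> R) z y :
    (forall i, z_ k i @[k --> \oo] --> z i) -> (forall i, y_ k i @[k --> \oo] --> y i) ->
    chan (z_ k) (y_ k) @[k --> \oo] --> chan z y.
  move=> zc yc; rewrite /chan; apply: cvgn_sum => i.
  apply: cvgD; last exact: cvg_cst.
  apply: cvgD.
    by apply: cvgM; [exact: cvg_cst|exact: cvg_exprn].
  apply: cvgM; last exact: cvg_cst.
  apply: cvgB; last exact: cvg_exprn.
  by apply: cvgM => //; apply: cvgM => //; exact: cvg_cst.
have EC : hasE P (fun x => chan (fun i => Z i x) (fun i => Y i x))
    (\sum_i (- kap i * lam i + (2 * zy i - yy i) / eta + bet i)).
  apply: hasE_sum => i _; apply: hasED; last exact: hasE_cst.
  apply: hasED; first by apply: hasEZ; exact: EZZ.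
  rewrite mulrC; apply: eq_hasE (hasEZ eta^-1 (hasEB (hasEZ 2 (EZY i)) (EYY i))) => x.
  by rewrite mulrC mulrA.
have mchan (z y : 'I_n -> T -> R) : (forall i, measurable_fun setT (z i)) ->
    (forall i, measurable_fun setT (y i)) ->
    measurable_fun setT (fun x => chan (fun i => z i x) (fun i => y i x)).
  move=> mz my; apply: measurable_sum => i; apply: measurable_funD => //.
  apply: measurable_funD; first by apply: measurable_funM => //; exact: measurable_funX.
  apply: measurable_funM => //; apply: measurable_funB; last exact: measurable_funX.
  by apply: measurable_funM => //; exact: measurable_funM.
have mq k : measurable_fun setT (q k) by have [] := qP k.
have qle k z : `|q k z| <= `|z| by have [] := qP k.
have step N v : hasE P (fun x => chan (fun i => Z i x) (Yq N x)) v -> v <= Bc.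
  move=> hv.
  have [_ [s sP] _ _] := qP N.
  have [a [aG aE]] := discretize mY (mq N) sP.
  pose yv (f : {ffun 'I_n -> seq_sub s}) i := ssval (f i).
  have /choice [u uP] : forall f, exists u, u <= 1 /\
      hasE P (fun x => expR (chan (fun i => Z i x) (yv f))) u.
    by move=> f; have [u u1 hu] := chan_exp (yv f); exists u.
  have /choice [vk vkP] : forall k, exists v,
      hasE P (fun x => chan (Zq k x) (Yq N x)) v.
    move=> k; apply: integrable_hasE; apply: dom_integrable chan_dom_int.
      by apply: mchan => i; exact: measurableT_comp.
    by move=> x; apply: chan_domP => i; exact: qle.
  have [||v' hv' cv'] := @hasE_dct _ _ _ P _ (fun x => chan (fun i => Z i x) (Yq N x))
    _ _ vkP _ _ chan_dom_int.
  - by move=> x; apply: (chan_cvg (fun k => Zq k x) (fun=> Yq N x)) => i;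
      [exact: qc|exact: cvg_cst].
  - by move=> k x; apply: chan_domP => i; exact: qle.
  have {cv'} vkc : vk k @[k --> \oo] --> v by rewrite (hasE_unique hv hv').
  have uc f : exists2 uk : nat -> R,
      (forall k, hasE P (fun x => expR (chan (Zq k x) (yv f))) (uk k)) &
      uk k @[k --> \oo] --> u f.
    (* From c |Z| <= Z^2 / (4 (lam + 1)) + c^2 (lam + 1) with c = 2 |y| / eta: the part free of [Z]
       goes into this constant. *)
    pose K := expR (\sum_i (`|bet i| + (2 * `|yv f i| / eta) ^+ 2 * (lam i + 1))).
    have dom k x : `|expR (chan (Zq k x) (yv f))| <=
        K * expR (\sum_i (4 * (lam i + 1))^-1 * Z i x ^+ 2).
      rewrite ger0_norm ?expR_ge0// /K -expRD ler_expR -big_split/=.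
      apply: ler_sum => i _; set z := Zq k x i; set y := yv f i.
      have zZ : `|z| <= `|Z i x| by exact: qle.
      have l1 : 0 < lam i + 1 by rewrite ltr_wpDl.
      have h1 : - kap i * z ^+ 2 <= 0 by rewrite mulNr oppr_le0 mulr_ge0// sqr_ge0.
      have h2 : bet i <= `|bet i| by exact: ler_norm.
      pose c := 2 * `|y| / eta.
      have c0 : 0 <= c by rewrite divr_ge0 ?mulr_ge0// ltW.
      have h3 : (2 * z * y - y ^+ 2) / eta <= c * `|Z i x|.
        rewrite /c [X in _ <= X]mulrAC ler_pM2r ?invr_gt0//.
        apply: (@le_trans _ _ (2 * `|y| * `|z|)); last by rewrite ler_wpM2l ?mulr_ge0.
        have := ler_norm (z * y); rewrite normrM; have := sqr_ge0 y; lra.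
      have h4 : c * `|Z i x| <= (4 * (lam i + 1))^-1 * Z i x ^+ 2 + c ^+ 2 * (lam i + 1).
        have E : (4 * (lam i + 1))^-1 * Z i x ^+ 2 + c ^+ 2 * (lam i + 1) - c * `|Z i x| =
          (`|Z i x| - 2 * c * (lam i + 1)) ^+ 2 / (4 * (lam i + 1)).
          by rewrite -(real_normK (num_real (Z i x))); field; rewrite gt_eqF.
        by rewrite -subr_ge0 E divr_ge0 ?sqr_ge0// mulr_ge0// ltW.
      rewrite -/y -/c; lra.
    have [w hw] := integrable_hasE exp_sq_integrable.
    have domint := proj1 (hasEZ K hw).
    have /choice [uk ukP] : forall k, exists u0,
        hasE P (fun x => expR (chan (Zq k x) (yv f))) u0.
      move=> k; apply: integrable_hasE; apply: (dom_integrable _ (dom k) domint).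
      apply: measurableT_comp => //.
      by apply: (mchan (fun i x => Zq k x i) (fun i x => yv f i)) => i //; exact: measurableT_comp.
    exists uk => //.
    have [|u' hu' cu'] := @hasE_dct _ _ _ P _
      (fun x => expR (chan (fun i => Z i x) (yv f))) _ _ ukP _ dom domint.
      by move=> x; apply: continuous_cvg; [exact: continuous_expR|];
        apply: (chan_cvg (fun k => Zq k x) (fun=> yv f)) => i; [exact: qc|exact: cvg_cst].
    by rewrite (hasE_unique (proj2 (uP f)) hu').
  have /choice [uk ukP] : forall f, exists uk : nat -> R,
      (forall k, hasE P (fun x => expR (chan (Zq k x) (yv f))) (uk k)) /\
      uk k @[k --> \oo] --> u f.
    by move=> f; have [uk ? ?] := uc f; exists uk.
  pose pa f := fine (P (a @^-1` [set f])).
  have ineq k : vk k + 1 - \sum_f pa f * uk f k <= Bc.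
    have [_ [s' sP'] _ _] := qP k.
    have [b [bG bE]] := discretize mZ (mq k) sP'.
    have bZ x : (fun i => ssval (b x i)) = Zq k x by apply/funext => i; exact: bE.
    have aY x : yv (a x) = Yq N x by apply/funext => i; exact: aE.
    apply: (@mi_discrete _ _ _ P GX GY _ _ a b
      (fun f g => chan (fun i => ssval (g i)) (yv f)) Bc (vk k) (uk^~ k)) => //.
      by apply: eq_hasE (vkP k) => x; rewrite bZ aY.
    by move=> f; apply: eq_hasE (proj1 (ukP f) k) => x; rewrite bZ.
  have sumpa : \sum_f pa f = 1.
    have ma f : measurable (a @^-1` [set f]) by apply: (sub_sigma_measurable mGX).
    rewrite (hasE_unique (hasE_cst P 1) (hasE_finite P (fun=> 1) ma)).
    by apply: eq_bigr => f _; rewrite mul1r.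
  have lim : (vk k + 1 - \sum_f pa f * uk f k) @[k --> \oo] --> v + 1 - \sum_f pa f * u f.
    apply: cvgB; first by apply: cvgD => //; exact: cvg_cst.
    by apply: cvgn_sum => f; apply: cvgM; [exact: cvg_cst|exact: (proj2 (ukP f))].
  have : v + 1 - \sum_f pa f * u f <= Bc.
    exact: (cvgn_le_cst lim ineq).
  have : \sum_f pa f * u f <= 1.
    rewrite -sumpa; apply: ler_sum => f _; apply: ler_piMr; last by have [] := uP f.
    by rewrite fine_ge0.
  lra.
have /choice [vN vNP] : forall N, exists v,
    hasE P (fun x => chan (fun i => Z i x) (Yq N x)) v.
  move=> N; apply: integrable_hasE; apply: dom_integrable chan_dom_int.
    by apply: mchan => i //; exact: measurableT_comp.
  by move=> x; apply: chan_domP => i //; exact: qle.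
have [||v' hv' cv'] := @hasE_dct _ _ _ P _
  (fun x => chan (fun i => Z i x) (fun i => Y i x)) _ _ vNP _ _ chan_dom_int.
- by move=> x; apply: (chan_cvg (fun=> (fun i => Z i x)) (fun N => Yq N x)) => i;
    [exact: cvg_cst|exact: qc].
- by move=> k x; apply: chan_domP => i //; exact: qle.
rewrite (hasE_unique EC hv'); apply: (cvgn_le_cst cv') => N.
exact: step.
Qed.

End converse.

(** * Mutual information of the Gaussian channel *)

Section independent_fubini.
Context {R : realType} {d : measure_display} {T : measurableType d}.
Variable P : probability T R.
Variables (G1 G2 : set (set T)).
Hypotheses (mG1 : G1 `<=` measurable) (mG2 : G2 `<=` measurable).
Hypothesis ind : indep2 P G1 G2.

Local Notation T1 := (g_sigma_algebraType G1).
Local Notation T2 := (g_sigma_algebraType G2).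

Let mid (G : set (set T)) (mG : G `<=` measurable) :
  measurable_fun setT (id : T -> g_sigma_algebraType G).
Proof. by move=> _ B mB; rewrite setTI; exact: (sub_sigma_measurable mG). Qed.

Let i1 : {mfun T >-> T1} := HB.pack (id : T -> T1) (isMeasurableFun.Build _ _ _ _ _ (mid mG1)).
Let i2 : {mfun T >-> T2} := HB.pack (id : T -> T2) (isMeasurableFun.Build _ _ _ _ _ (mid mG2)).

(* Independence says that the law of the diagonal map into the two
   sub-sigma-algebras is the product measure. *)
Lemma indep_fubini (g : T1 * T2 -> R) : measurable_fun setT g ->
  (forall z, 0 <= g z) ->
  (\int[P]_x (g (x, x))%:E = \int[P]_y \int[P]_x (g (x, y))%:E)%E.
Proof.
move=> mg g0.
have mdiag : measurable_fun setT (fun x : T => (x, x) : T1 * T2).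
  by apply: measurable_fun_pair; exact: mid.
pose dg : {mfun T >-> (T1 * T2)%type} :=
  HB.pack (fun x : T => (x, x) : T1 * T2) (isMeasurableFun.Build _ _ _ _ _ mdiag).
pose m1 : probability T1 R := distribution P i1.
pose m2 : probability T2 R := distribution P i2.
have mEg : measurable_fun setT (EFin \o g) by exact/measurable_EFinP.
transitivity (\int[distribution P dg]_z (g z)%:E)%E.
  by rewrite ge0_integral_distribution// => z; rewrite lee_fin.
transitivity (\int[(m1 \x m2)%E]_z (g z)%:E)%E.
  apply: eq_measure_integral => A mA _; apply/esym.
  exact: (@product_measure_unique _ _ _ _ _ m1 m2 (distribution P dg)
    (fun B C mB mC => ind mB mC) A mA).
rewrite fubini_tonelli2//.
rewrite ge0_integral_distribution//.
- apply: eq_integral => y _; rewrite /= /fubini_G ge0_integral_distribution//.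
    apply/measurable_EFinP. apply: (measurableT_comp mg). exact: measurable_pair2.
  by move=> x; rewrite lee_fin.
- exact: measurable_fun_fubini_tonelli_G.
- by move=> y; apply: integral_ge0 => x _; rewrite lee_fin.
Qed.

End independent_fubini.

Section independent_products.
Context {R : realType} {d : measure_display} {T : measurableType d}.
Variable P : probability T R.
Variables (GE GL : set (set T)).
Hypotheses (mGE : GE `<=` measurable) (mGL : GL `<=` measurable).
Hypothesis ind : indep2 P GE GL.

Lemma indep_hasE_mul (u v : T -> R) a b : smeas GE u -> smeas GL v ->
  (forall x, 0 <= u x) -> (forall x, 0 <= v x) -> hasE P u a -> hasE P v b ->
  hasE P (fun x => u x * v x) (a * b).
Proof.
move=> su sv u0 v0 ua vb.
apply: ge0_hasE; [apply: measurable_funM; [exact: hasE_mfun ua|exact: hasE_mfun vb]| |].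
  by move=> x; rewrite mulr_ge0.
have mg : measurable_fun setT (fun z : g_sigma_algebraType GE * g_sigma_algebraType GL =>
    u z.1 * v z.2).
  apply: measurable_funM.
    by apply: measurableT_comp measurable_fst; apply/smeasP.
  by apply: measurableT_comp measurable_snd; apply/smeasP.
rewrite (indep_fubini mGE mGL ind mg); last by move=> z; rewrite mulr_ge0.
have a0 : 0 <= a by exact: hasE_ge0 ua u0.
transitivity (\int[P]_y (a%:E * (v y)%:E))%E.
  apply: eq_integral => y _ /=.
  under eq_integral do rewrite mulrC.
  by rewrite (proj2 (hasEZ (v y) ua)) mulrC EFinM.
rewrite ge0_integralZl ?lee_fin// ?(proj2 vb)//.
- exact/measurable_EFinP/(hasE_mfun vb).
- by move=> x _; rewrite lee_fin.
Qed.

(** The product rule above concerns nonnegative factors, while [e] is signed. On every event of [Z]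
    the mgf of [e] is multiplied by the probability of the event and stays even, so [e] has mean 0
    there. *)
Lemma indep_mean0 (e Z : T -> R) (psi : R) : smeas GE e -> smeas GL Z ->
  (forall a, hasE P (fun x => expR (a * e x)) (expR (2^-1 * (a ^+ 2 * psi)))) ->
  P.-integrable setT (EFin \o (fun x => e x * Z x)) ->
  hasE P (fun x => e x * Z x) 0.
Proof.
move=> se sZ mgf ieZ; apply: signed_weight0 ieZ.
  exact: smeas_measurable mGL sZ.
move=> B mB; pose A := Z @^-1` B.
have GA : <<s GL >> A by exact: sZ.
have mA : measurable A by exact: (sub_sigma_measurable mGL).
have := @mgf_even_mean0 _ _ _ P (\1_A) e
  (fun a => expR (2^-1 * (a ^+ 2 * psi)) * fine (P A)).
move=> h; apply: eq_hasE (h _ _) => [x|a|a]; first by rewrite mulrC.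
  have := @indep_hasE_mul (fun x => expR (a * e x)) \1_A _ _ _ _ _ _ (mgf a) (hasE_indic P mA).
  move=> h'; apply: eq_hasE (h' _ _ _ _) => // [x||]; first by rewrite mulrC.
    by apply: (smeas_comp (h := expR)) => //; apply: smeasM => //; exact: smeas_cst.
  exact: smeas_indic.
by rewrite sqrrN.
Qed.

End independent_products.

Section achievability.
Context {R : realType} {d : measure_display} {T : measurableType d}.
Variable P : probability T R.
Variables (GE GL GH GX : set (set T)) (n : nat) (e Z : 'I_n -> T -> R).
Variables (lam rho bet : 'I_n -> R) (eta : R).
Hypotheses (mGE : GE `<=` measurable) (mGL : GL `<=` measurable).
Hypothesis ind : indep2 P GE GL.
Hypothesis GHL : <<s GH >> `<=` <<s GL >>.
Hypotheses (se : forall i, smeas GE (e i)) (sZ : forall i, smeas GH (Z i)).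
Hypotheses (lam0 : forall i, 0 <= lam i) (eta0 : 0 < eta).
Hypotheses (rho0 : forall i, 0 < rho i) (rho1 : forall i, rho i <= 1).
Hypothesis rhoE : forall i, (1 - rho i) * (eta - 2 * rho i * lam i) = 0.
Hypothesis betE : forall i, expR (- (2 * bet i)) = rho i.

Definition psi i : R := (1 - rho i) * rho i * lam i.
Definition chanY i x : R := (1 - rho i) * Z i x + e i x.

Hypothesis GXY : <<s GX >> `<=` <<s fam_gen chanY >>.
Hypothesis mgfe : forall b, hasE P (fun x => expR (lin e b x))
  (\prod_i expR (2^-1 * (psi i * b i ^+ 2))).
Hypothesis mgfZ : forall b, hasE P (fun x => expR (lin Z b x))
  (\prod_i expR (2^-1 * (lam i * b i ^+ 2))).

Local Notation kap := (fun i => (1 - rho i) / eta).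

Let sZL i : smeas GL (Z i) := smeasS GHL (sZ i).
Let me i : measurable_fun setT (e i) := smeas_measurable mGE (se i).
Let mZ i : measurable_fun setT (Z i) := smeas_measurable mGL (sZL i).
Let mY i : measurable_fun setT (chanY i).
Proof. by apply: measurable_funD => //; exact: measurable_funM. Qed.

Let psi0 i : 0 <= psi i.
Proof. by rewrite /psi !mulr_ge0 ?subr_ge0// ltW. Qed.

Let rho_cases i : rho i = 1 \/ lam i = eta / (2 * rho i).
Proof.
have /eqP := rhoE i; rewrite mulf_eq0 => /orP[|] /eqP h; [left|right]; first lra.
have r0 := rho0 i; have -> : eta = 2 * rho i * lam i by lra.
by field; rewrite gt_eqF.
Qed.

(** With [Z] frozen the exponent is a quadratic polynomial in the noise, so the noise can be
    integrated out first. *)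
Let chan_lin b x : - chan kap bet eta (Z^~ x) (chanY^~ x) + lin chanY b x =
  \sum_i (eta^-1 * e i x ^+ 2 + (b i - 2 * rho i * Z i x / eta) * e i x) +
  \sum_i (b i * (1 - rho i) * Z i x - (1 - rho i) * rho i * Z i x ^+ 2 / eta - bet i).
Proof.
rewrite /chan /lin -sumrN -!big_split/=; apply: eq_bigr => i _.
by rewrite /chanY; field; rewrite gt_eqF.
Qed.

(** The dependence on [z] cancels: once reweighted, the output does not see the source. Either rho =
    1, and then the noise variance is 0, or lam = eta / (2 rho). *)
Let inner_eq i b z :
  gauss_quad (psi i) eta^-1 (b - 2 * rho i * z / eta) *
  expR (b * (1 - rho i) * z - (1 - rho i) * rho i * z ^+ 2 / eta - bet i) =
  expR (2^-1 * ((1 - rho i) * lam i * b ^+ 2)).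
Proof.
have r0 := rho0 i.
have E : 1 - 2 * eta^-1 * psi i = rho i.
  rewrite /psi; case: (rho_cases i) => ->; last by field; rewrite !gt_eqF.
  by rewrite subrr !mul0r mulr0 subr0.
rewrite /gauss_quad E.
have -> : (Num.sqrt (rho i))^-1 = expR (bet i).
  rewrite -betE (_ : - (2 * bet i) = - bet i + - bet i); last by ring.
  by rewrite expRD -expr2 sqrtr_sqr ger0_norm ?expR_ge0// expRN invrK.
rewrite -!expRD; congr expR; rewrite /psi.
case: (rho_cases i) => [-> |->]; first by field; rewrite gt_eqF.
by field; rewrite !gt_eqF.
Qed.

Let psi_lt i : 2 * eta^-1 * psi i < 1.
Proof.
rewrite -subr_gt0 (_ : _ - _ = rho i)// /psi.
have r0 := rho0 i; case: (rho_cases i) => ->; last by field; rewrite !gt_eqF.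
by rewrite subrr !mul0r mulr0 subr0.
Qed.

Let cb (b : 'I_n -> R) : R := \prod_i expR (2^-1 * ((1 - rho i) * lam i * b i ^+ 2)).

Let W x := expR (- chan kap bet eta (Z^~ x) (chanY^~ x)).

(** Under the measure W dP the output keeps its mgf [cb] and is independent of every history event;
    this is the product-of-marginals property at the level of mgfs. *)
Let W_exp (B : set T) b : <<s GH >> B ->
  hasE P (fun x => W x * \1_B x * expR (lin chanY b x)) (cb b * fine (P B)).
Proof.
move=> GB; have LB := GHL GB.
have mB : measurable B by exact: (sub_sigma_measurable mGL).
pose T1 := g_sigma_algebraType GE; pose T2 := g_sigma_algebraType GL.
pose g (z : T1 * T2) : R := \1_B z.2 *
  (expR (\sum_i (eta^-1 * e i z.1 ^+ 2 + (b i - 2 * rho i * Z i z.2 / eta) * e i z.1)) *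
  expR (\sum_i (b i * (1 - rho i) * Z i z.2 - (1 - rho i) * rho i * Z i z.2 ^+ 2 / eta - bet i))).
have e1 i : measurable_fun setT (fun z : T1 * T2 => e i z.1).
  by apply: measurableT_comp measurable_fst; apply/smeasP; exact: se.
have z2 i : measurable_fun setT (fun z : T1 * T2 => Z i z.2).
  by apply: measurableT_comp measurable_snd; apply/smeasP; exact: sZL.
have mg : measurable_fun setT g.
  apply: measurable_funM.
    by apply: measurableT_comp measurable_snd; apply/smeasP; exact: smeas_indic.
  apply: measurable_funM; apply: measurableT_comp => //; apply: measurable_sum => i.
    apply: measurable_funD; first by apply: measurable_funM => //; exact: measurable_funX.
    apply: measurable_funM => //; apply: measurable_funB => //.
    by apply: measurable_funM => //; exact: measurable_funM.
  apply: measurable_funB => //; apply: measurable_funB; first exact: measurable_funM.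
  by apply: measurable_funM => //; apply: measurable_funM => //; exact: measurable_funX.
have g0 z : 0 <= g z by rewrite mulr_ge0// mulr_ge0// expR_ge0.
have gE x : g (x, x) = W x * \1_B x * expR (lin chanY b x).
  by rewrite /g /= -expRD -chan_lin expRD -/(W x); ring.
suff : hasE P (fun x : T => g (x, x)) (cb b * fine (P B)) by exact: eq_hasE.
apply: ge0_hasE => //.
  rewrite (_ : (fun x : T => g (x, x)) = (fun x => W x * \1_B x * expR (lin chanY b x))).
    apply: measurable_funM.
      apply: measurable_funM => //; apply: measurableT_comp => //.
      apply: measurableT_comp => //; apply: measurable_sum => i.
      apply: measurable_funD => //; apply: measurable_funD.
        by apply: measurable_funM => //; exact: measurable_funX.
      apply: measurable_funM => //; apply: measurable_funB; last exact: measurable_funX.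
      by apply: measurable_funM => //; exact: measurable_funM.
    apply: measurableT_comp => //; apply: measurable_sum => i.
    exact: measurable_funM.
  by apply/funext => x.
rewrite (indep_fubini mGE mGL ind mg g0).
rewrite -(proj2 (hasEZ (cb b) (hasE_indic P mB))).
apply: eq_integral => y _.
have := @gauss_family _ _ _ P _ (fun=> 1) e 1 psi (fun=> eta^-1)
  (fun i => b i - 2 * rho i * Z i y / eta) _ me _ psi0 psi_lt _.
move=> /(_ (measurable_cst _) (fun=> ler01)) h.
have /h {h} : forall t, hasE P (fun x => 1 * expR (lin e t x))
    (1 * \prod_i expR (2^-1 * (psi i * t i ^+ 2))).
  by move=> t; rewrite mul1r; apply: eq_hasE (mgfe t) => x; rewrite mul1r.
set c := expR (\sum_i (b i * (1 - rho i) * Z i y - (1 - rho i) * rho i * Z i y ^+ 2 / eta - bet i)).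
move=> /(hasEZ (\1_B y * c)) [_ h].
transitivity (\1_B y * c * (1 * \prod_i
   gauss_quad (psi i) eta^-1 (b i - 2 * rho i * Z i y / eta)))%:E; last first.
  congr _%:E; rewrite mul1r mulrC [\1_B y * c]mulrC mulrA; congr (_ * _).
  rewrite /c expR_sum -big_split/=; apply: eq_bigr => i _; exact: inner_eq.
rewrite -h; apply: eq_integral => x _; congr _%:E.
by rewrite /g /= -/c; ring.
Qed.

Let Y_exp b : hasE P (fun x => expR (lin chanY b x)) (cb b).
Proof.
have := @indep_hasE_mul _ _ _ P GE GL mGE mGL ind (fun x => expR (lin e b x))
  (fun x => expR (lin Z (fun i => b i * (1 - rho i)) x)) _ _ _ _ _ _ (mgfe b) (mgfZ _).
move=> h; have := h _ _ _ _; rewrite -big_split/= (eq_bigr (fun i =>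
    expR (2^-1 * ((1 - rho i) * lam i * b i ^+ 2)))) => [h'|i _]; last first.
  by rewrite -expRD; congr expR; rewrite /psi; field.
apply: eq_hasE (h' _ _ _ _) => [x|||x|x]; rewrite ?expR_ge0//.
- rewrite -expRD; congr expR; rewrite /lin -big_split/=; apply: eq_bigr => i _.
  by rewrite /chanY; ring.
- by apply: (smeas_comp (h := expR)) => //; exact: smeas_lin.
- by apply: (smeas_comp (h := expR)) => //; exact: smeas_lin.
Qed.

(** The signed weight W 1_B - P(B) has vanishing mgf along the output, hence integrates to 0 over
    every output event. *)
Let W_prod (A B : set T) : <<s GX >> A -> <<s GH >> B -> measurable A ->
  hasE P (fun x => W x * \1_(A `&` B) x) (fine (P A) * fine (P B)).
Proof.
move=> GA GB mA.
have : hasE P (fun x => (W x * \1_B x - fine (P B)) * \1_A x) 0.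
  apply: mgf_signed_zero (GXY GA) => b.
  have := hasEB (W_exp b GB) (hasEZ (fine (P B)) (Y_exp b)).
  rewrite [fine _ * _]mulrC subrr; apply: eq_hasE => x; by rewrite mulrBl.
move=> /hasED /(_ (hasEZ (fine (P B)) (hasE_indic P mA))).
rewrite add0r mulrC; apply: eq_hasE => x; rewrite indicI/=; ring.
Qed.

Hypothesis EZZ : forall i, hasE P (fun x => Z i x ^+ 2) (lam i).
Hypothesis EeZ : forall i, hasE P (fun x => e i x * Z i x) 0.
Hypothesis Eee : forall i, hasE P (fun x => e i x ^+ 2) (psi i).

Let chan_mean : hasE P (fun x => chan kap bet eta (Z^~ x) (chanY^~ x)) (\sum_i bet i).
Proof.
apply: hasE_sum => i _.
have := hasED (hasED (hasEZ ((- (1 - rho i) + 2 * (1 - rho i) - (1 - rho i) ^+ 2) / eta) (EZZ i))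
  (hasEB (hasEZ ((2 - 2 * (1 - rho i)) / eta) (EeZ i)) (hasEZ eta^-1 (Eee i))))
  (hasE_cst P (bet i)).
congr hasE.
  by apply/funext => x; rewrite /chanY; field; rewrite gt_eqF.
by rewrite /psi; field; rewrite gt_eqF.
Qed.

(** Jensen's inequality in tangent form: f >= 1 + t - exp(t) exp(- f), integrated over the cell, for
    every t. The best choice is t = ln(pab / (pa pb)). *)
Let mi_cell (A B : set T) v : <<s GX >> A -> <<s GH >> B -> measurable A ->
  hasE P (fun x => chan kap bet eta (Z^~ x) (chanY^~ x) * \1_(A `&` B) x) v ->
  mi_term (fine (P (A `&` B))) (fine (P A)) (fine (P B)) <= v.
Proof.
move=> GA GB mA hv.
have mB : measurable B by apply: (sub_sigma_measurable mGL); exact: GHL.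
have mAB : measurable (A `&` B) by exact: measurableI.
set pab := fine (P (A `&` B)); set pa := fine (P A); set pb := fine (P B).
have key t : (1 + t) * pab - expR t * (pa * pb) <= v.
  apply: hasE_le (hasEB (hasEZ (1 + t) (hasE_indic P mAB)) (hasEZ (expR t) (W_prod GA GB mA)))
    hv _ => x.
  rewrite mulrA -mulrBl ler_wpM2r// /W -expRD.
  have := expR_ge1Dx (t - chan kap bet eta (Z^~ x) (chanY^~ x)); lra.
have pa0 : 0 <= pa by rewrite fine_ge0.
have pb0 : 0 <= pb by rewrite fine_ge0.
have pab0 : 0 <= pab by rewrite fine_ge0.
rewrite /mi_term; case: eqVneq => [E|pabN].
  rewrite leNgt; apply/negP => v0.
  pose c := pa * pb.
  have c0 : 0 <= c by exact: mulr_ge0.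
  (* A null cell would be settled by t tending to minus infinity. If v < 0, taking exp t equal to
     this number makes c exp t smaller than - v, against the tangent bound. *)
  have r0 : 0 < - v / (2 * (c + 1)) by rewrite divr_gt0 ?oppr_gt0// mulr_gt0// ltr_wpDl.
  have := key (ln (- v / (2 * (c + 1)))); rewrite E mulr0 sub0r lnK ?posrE// -/c.
  apply/negP; rewrite -ltNge ltrNr mulrAC ltr_pdivrMr ?mulr_gt0 ?ltr_wpDl//.
  by rewrite ltr_pM2l ?oppr_gt0//; lra.
have pabp : 0 < pab by rewrite lt_neqAle eq_sym pabN.
have le1 S : measurable S -> A `&` B `<=` S -> pab <= fine (P S).
  by move=> mS SS'; apply: fine_le; rewrite ?fin_num_measure//; apply: le_measure; rewrite ?inE.
have pap : 0 < pa by apply: lt_le_trans pabp _; apply: le1.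
have pbp : 0 < pb by apply: lt_le_trans pabp _; apply: le1.
have := key (ln (pab / (pa * pb))); rewrite lnK ?posrE ?divr_gt0 ?mulr_gt0//.
by rewrite divfK ?gt_eqF ?mulr_gt0// mulrDl mul1r addrAC subrr add0r mulrC.
Qed.

Lemma mutual_info_achieved : GX `<=` measurable ->
  (mutual_info P GX GH <= (\sum_i bet i)%:E)%E.
Proof.
move=> mGX; apply: ge_ereal_sup => _ [k [l [A [B [[GA tA UA] [GB tB UB] ->]]]]].
rewrite lee_fin.
have mA i : measurable (A i) by exact: (sub_sigma_measurable mGX).
have mB j : measurable (B j) by apply: (sub_sigma_measurable mGL); exact: GHL.
pose f x := chan kap bet eta (Z^~ x) (chanY^~ x).
have /choice [v vP] : forall ij : 'I_k * 'I_l, exists v,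
    hasE P (fun x => f x * \1_(A ij.1 `&` B ij.2) x) v.
  move=> [i j]; apply: integrable_hasE => /=.
  apply: (dom_integrable _ _ (hasE_norm chan_mean)).
    apply: measurable_funM; first exact: hasE_mfun chan_mean.
    by apply: measurable_indic; exact: measurableI.
  by move=> x; rewrite normrM ler_piMr// ger0_norm// indicE; case: (_ \in _).
apply: (@le_trans _ _ (\sum_i \sum_j v (i, j))).
  by apply: ler_sum => i _; apply: ler_sum => j _; apply: mi_cell => //; exact: (vP (i, j)).
rewrite le_eqVlt; apply/orP; left; apply/eqP.
have := hasE_sum (index_enum ('I_k : finType)) (fun i (_ : xpredT i) =>
  hasE_sum (index_enum ('I_l : finType)) (fun j (_ : xpredT j) => vP (i, j))).
move=> /hasE_unique; apply; apply: eq_hasE chan_mean => x.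
have [i _ Ai] : (\bigcup_(i in setT) A i) x by rewrite UA.
have [j _ Bj] : (\bigcup_(i in setT) B i) x by rewrite UB.
have out (m : nat) (S : 'I_m -> set T) (i0 i1 : 'I_m) :
    (forall i j, i != j -> S i `&` S j = set0) -> S i0 x -> i1 != i0 -> ~ S i1 x.
  move=> dS S0 i10 S1; have : (S i1 `&` S i0) x by [].
  by rewrite dS.
rewrite (bigD1 i)//= (bigD1 j)//= indicE mem_set// mulr1 big1 ?addr0; last first.
  move=> j' jj; rewrite indicE memNset ?mulr0// => -[_].
  exact: (out _ _ j).
rewrite big1 ?addr0// => i' ii; rewrite big1// => j' _.
rewrite indicE memNset ?mulr0// => -[h _]; move: h.
exact: (out _ _ i).
Qed.

End achievability.

(** * Conditional independence *)

Section trace_measure.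
Context {R : realType} {d : measure_display} {T : measurableType d}.
Variables (P : probability T R) (G : set (set T)) (A : set T).
Variables (mG : G `<=` measurable) (mA : measurable A).

(** Its Radon-Nikodym derivative with respect to [P] on the sigma-algebra of [G] is the conditional
    probability of [A]. The measurability proofs are arguments because the measure structure
    attached below depends on them. *)
Definition trace_measure & G `<=` measurable & measurable A :=
  fun D : set (g_sigma_algebraType G) => P (D `&` A).

Local Notation nu := (trace_measure mG mA).

Let nu0 : nu set0 = 0%E.
Proof. by rewrite /trace_measure set0I measure0. Qed.

Let nu_ge0 D : (0 <= nu D)%E.
Proof. exact: measure_ge0. Qed.

Let nu_sigma_additive : semi_sigma_additive nu.
Proof.
have sG := sub_sigma_measurable mG.
move=> F mF tF mUF.
exact: (@measure_semi_sigma_additive _ _ _ (mrestr P mA) F (fun i => sG _ (mF i)) tF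
  (sG _ mUF)).
Qed.

HB.instance Definition _ := isMeasure.Build _ _ _ nu nu0 nu_ge0 nu_sigma_additive.

Let nu_fin : fin_num_fun nu.
Proof.
move=> D mD; apply: fin_num_measure; apply: measurableI => //.
exact: (sub_sigma_measurable mG).
Qed.

HB.instance Definition _ := Measure_isFinite.Build _ _ _ nu nu_fin.

End trace_measure.

Section conditional_probability.
Context {R : realType} {d : measure_display} {T : measurableType d}.
Variable P : probability T R.

Lemma integral_indicM (f : T -> R) (D : set T) :
  (\int[P]_x (f x * \1_D x)%:E = \int[P]_(x in D) (f x)%:E)%E.
Proof.
rewrite [RHS]integral_mkcond; apply: eq_integral => x _.
by rewrite patchE indicE; case: ifP => _; rewrite ?mulr1 ?mulr0.
Qed.

Lemma cond_prob (G : set (set T)) (A : set T) : G `<=` measurable -> measurable A ->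
  exists g : T -> R, [/\ smeas G g, forall x, 0 <= g x,
    P.-integrable setT (EFin \o g) &
    forall D, <<s G >> D -> (\int[P]_x (g x * \1_D x)%:E = \int[P]_x (\1_A x * \1_D x)%:E)%E].
Proof.
move=> mG mA.
have sG := sub_sigma_measurable mG.
pose TG := g_sigma_algebraType G.
have mid : measurable_fun setT (id : T -> TG).
  by move=> _ B mB; rewrite setTI; exact: sG.
pose iG : {mfun T >-> TG} := HB.pack (id : T -> TG) (isMeasurableFun.Build _ _ _ _ _ mid).
pose mu : probability TG R := distribution P iG.
pose nu : {finite_measure set TG -> \bar R} := trace_measure P mG mA.
have nuE D : nu D = P (D `&` A) by [].
have numu : nu `<< mu.
  apply/null_content_dominatesP => D mD muD; rewrite nuE.
  apply/eqP; rewrite eq_le measure_ge0 andbT -[X in (_ <= X)%E]muD.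
  by apply: le_measure; rewrite ?inE; [apply: measurableI => //; exact: sG|exact: sG|].
have [f [f0 ffin fint fE]] := @radon_nikodym_sigma_finite _ _ _ mu nu numu.
have mf := measurable_int _ fint.
have sg : smeas G (fun x => fine (f x)).
  by apply/smeasP; exact: (measurableT_comp (fine_measurable measurableT) mf).
have g0 x : 0 <= fine (f x) by rewrite fine_ge0.
exists (fun x => fine (f x)); split => //.
- have : P.-integrable setT (f \o iG).
    apply/integrableP; split; first exact: measurableT_comp.
    move/integrableP : fint => [_]; rewrite ge0_integral_distribution//.
    exact: measurableT_comp.
  by apply: eq_integrable => // x _ /=; rewrite fineK.
- move=> D GD; rewrite !integral_indicM.
  have mD := sG _ GD.
  rewrite integral_indic//; transitivity (nu D); last by rewrite nuE setIC.
  rewrite fE//.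
  rewrite ge0_integral_pushforward//=.
  - by rewrite preimage_id; apply: eq_integral => x _; rewrite /= fineK.
  - exact: measurable_funTS.
Qed.

End conditional_probability.

Section noise_cond_indep.
Context {R : realType} {d : measure_display} {T : measurableType d}.
Variable P : probability T R.
Variables (GE GL GH GX : set (set T)).
Hypotheses (mGE : GE `<=` measurable) (mGL : GL `<=` measurable) (mGH : GH `<=` measurable).
Hypothesis ind : indep2 P GE GL.
Hypothesis GHL : GH `<=` <<s GL >>.
Hypothesis GXEH : <<s GX >> `<=` <<s GE `|` GH >>.

(** For a latent event D let h = P(D | H). The signed weight 1_D - h vanishes on intersections of
    noise and history events by independence, hence on A. With g = P(A | H) this gives P(A and D) =
    E[1_A h] = E[g h] = E[1_D g]. *)
Lemma noise_cond_indep : cond_indep P GX GL GH.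
Proof.
move=> A GA.
have sHL : <<s GH >> `<=` <<s GL >>.
  by apply: smallest_sub => //; exact: smallest_sigma_algebra.
have sLT := sub_sigma_measurable mGL; have sET := sub_sigma_measurable mGE.
have sHT := sub_sigma_measurable mGH.
have mA : measurable A.
  by apply: (@sub_sigma_measurable _ _ (GE `|` GH)); [rewrite subUset|exact: GXEH].
have [g [sg g0 ig gE]] := cond_prob P mGH mA.
have mg := smeas_measurable mGH sg.
exists g; split => //; split => //.
move=> D GD.
have LD : <<s GL >> D.
  move: D GD; apply: smallest_sub; first exact: smallest_sigma_algebra.
  by rewrite subUset; split => //; exact: sub_sigma_algebra.
have mD := sLT _ LD.
have [h [sh h0 ih hE]] := cond_prob P mGH mD.
have mh := smeas_measurable mGH sh.
pose G := [set E | exists E1 E2, [/\ <<s GE >> E1, <<s GH >> E2 & E = E1 `&` E2]].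
have GI : setI_closed G.
  move=> _ _ [E1 [E2 [h1 h2 ->]]] [F1 [F2 [k1 k2 ->]]].
  exists (E1 `&` F1), (E2 `&` F2); split; last by rewrite setIACA.
    exact: (@measurableI _ (g_sigma_algebraType GE)).
  exact: (@measurableI _ (g_sigma_algebraType GH)).
have sT (H : set (set T)) : <<s H >> setT by exact: (@measurableT _ (g_sigma_algebraType H)).
have sG : <<s GE `|` GH >> `<=` <<s G >>.
  apply: smallest_sub; first exact: smallest_sigma_algebra.
  rewrite subUset; split => E HE; apply: sub_sigma_algebra.
    by exists E, setT; split; [exact: sub_sigma_algebra|exact: sT|rewrite setIT].
  by exists setT, E; split; [exact: sT|exact: sub_sigma_algebra|rewrite setTI].
have WG E : G E -> hasE P (fun x => (\1_D x - h x) * \1_E x) 0.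
  move=> [E1 [E2 [h1 h2 ->]]].
  have mE1 := sET _ h1; have L2 := sHL _ h2; have mE2 := sLT _ L2.
  have [v hv] : exists v, hasE P (fun x => h x * \1_E2 x) v.
    apply: integrable_hasE; apply: (dom_integrable _ _ (integrable_norm ih)).
      exact: measurable_funM.
    by move=> x /=; rewrite normrM ler_piMr// ger0_norm// indicE; case: (_ \in _).
  have hv' : hasE P (fun x => \1_D x * \1_E2 x) v.
    split; last by rewrite -hE// (proj2 hv).
    apply: (dom_integrable _ _ (proj1 (hasE_cst P 1))); first exact: measurable_funM.
    by move=> x; rewrite ger0_norm ?mulr_ge0// mulr_ile1// indicE; case: (_ \in _).
  have s1 := smeas_indic (R := R) h1.
  have p1 : hasE P (fun x => \1_E1 x * (h x * \1_E2 x)) (fine (P E1) * v).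
    apply: (indep_hasE_mul mGE mGL ind) => //.
    - by apply: smeasS sHL _; apply: smeasM => //; exact: smeas_indic.
    - by move=> x; rewrite mulr_ge0.
    - exact: hasE_indic.
  have p2 : hasE P (fun x => \1_E1 x * (\1_D x * \1_E2 x)) (fine (P E1) * v).
    apply: (indep_hasE_mul mGE mGL ind) => //.
    - by apply: smeasM; exact: smeas_indic.
    - exact: hasE_indic.
  have := hasEB p2 p1; rewrite subrr; apply: eq_hasE => x.
  by rewrite indicI/=; ring.
have W0 : hasE P (fun x => \1_D x - h x) 0.
  have : G setT by exists setT, setT; split; [exact: sT|exact: sT|rewrite setTI].
  by move=> /WG; apply: eq_hasE => x; rewrite indicT mulr1.
have hA := hasE_pi_sigma GI W0 WG (sG _ (GXEH GA)).
have pAD : hasE P (fun x => \1_A x * \1_D x) (fine (P (A `&` D))).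
  by apply: eq_hasE (hasE_indic P (measurableI _ _ mA mD)) => x; rewrite indicI.
have pAh : hasE P (fun x => \1_A x * h x) (fine (P (A `&` D))).
  by have := hasEB pAD hA; rewrite subr0; apply: eq_hasE => x; ring.
have wi (W1 W2 Zf : T -> R) : measurable_fun setT W1 -> measurable_fun setT W2 ->
    measurable_fun setT Zf -> (forall x, 0 <= W1 x) -> (forall x, 0 <= W2 x) ->
    (forall x, 0 <= Zf x) -> (forall B, measurable B ->
    (\int[P]_x (W1 x * \1_(Zf @^-1` B) x)%:E = \int[P]_x (W2 x * \1_(Zf @^-1` B) x)%:E)%E) ->
    (\int[P]_x (W1 x * Zf x)%:E = \int[P]_x (W2 x * Zf x)%:E)%E.
  move=> m1 m2 mZ p1 p2 pZ H.
  have mm : measurable_fun setT (fun z : R => Num.max z 0) by exact: measurable_maxr.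
  have E (W : T -> R) : (\int[P]_x (W x * Zf x)%:E = \int[P]_x (W x * Num.max (Zf x) 0)%:E)%E.
    by apply: eq_integral => x _; rewrite max_l.
  rewrite !E; apply: (@weight_ge0_integral _ _ _ _ _ P P W1 Zf W2 Zf m1 mZ m2 mZ p1 p2 H
    (fun z => Num.max z 0) mm) => x.
  by rewrite le_max lexx orbT.
rewrite -integral_indicM.
transitivity (\int[P]_x (\1_D x * g x)%:E)%E; last first.
  by apply: eq_integral => x _; rewrite mulrC.
rewrite (wi \1_D h g)//; last by move=> B mB; rewrite hE//; exact: sg.
transitivity (\int[P]_x (g x * h x)%:E)%E; last first.
  by apply: eq_integral => x _; rewrite mulrC.
rewrite -(wi \1_A g h)//; last by move=> B mB; rewrite gE//; exact: sh.
by rewrite (proj2 pAh) fineK// fin_num_measure//; exact: measurableI.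
Qed.

End noise_cond_indep.

Section cond_indep_orthogonality.
Context {R : realType} {d : measure_display} {T : measurableType d}.
Variable P : probability T R.
Variables (GL GH GX : set (set T)).
Hypotheses (mGL : GL `<=` measurable) (mGH : GH `<=` measurable) (mGX : GX `<=` measurable).
Hypothesis ci : cond_indep P GX GL GH.

(** For an event A of [Y], conditional independence replaces 1_A by the history-measurable P(A | H),
    against which [V] integrates to 0; [signed_weight0] then passes from events to [Y]. It makes the
    estimation residual orthogonal to any admissible estimate. *)
Lemma cond_indep_orth (V Y : T -> R) : smeas (GH `|` GL) V -> smeas GX Y ->
  (forall D, <<s GH >> D -> hasE P (fun x => V x * \1_D x) 0) ->
  P.-integrable setT (EFin \o (fun x => V x * Y x)) ->
  hasE P (fun x => V x * Y x) 0.
Proof.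
move=> sV sY VH iVY.
have mGHL : GH `|` GL `<=` measurable by rewrite subUset.
have sHT := sub_sigma_measurable mGH; have sHLT := sub_sigma_measurable mGHL.
have sHL : <<s GH >> `<=` <<s GH `|` GL >>.
  apply: smallest_sub; first exact: smallest_sigma_algebra.
  by move=> E HE; apply: sub_sigma_algebra; left.
have sT (H : set (set T)) : <<s H >> setT by exact: (@measurableT _ (g_sigma_algebraType H)).
have mV := smeas_measurable mGHL sV.
have hV : hasE P V 0.
  by apply: eq_hasE (VH _ (sT _)) => x; rewrite indicT mulr1.
apply: signed_weight0 iVY; first exact: smeas_measurable mGX sY.
move=> B mB; pose A := Y @^-1` B; rewrite -[fun x => _]/(fun x => V x * \1_A x).
have GA : <<s GX >> A by exact: sY.
have mA := sub_sigma_measurable mGX GA.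
have [g [sg [ig gE]]] := ci GA.
have mg := smeas_measurable mGH sg.
have gD D : <<s GH `|` GL >> D -> hasE P (fun x => g x * \1_D x) (fine (P (A `&` D))).
  move=> GD; have mD := sHLT _ GD; split.
    apply: (dom_integrable _ _ (integrable_norm ig)); first exact: measurable_funM.
    by move=> x /=; rewrite normrM ler_piMr// ger0_norm// indicE; case: (_ \in _).
  by rewrite integral_indicM -gE// fineK// fin_num_measure//; exact: measurableI.
(* A version of the conditional probability may leave [0, 1] on a null set. These two null
   corrections clip it, so that its product with [V] is integrable. *)
pose gm x : R := Num.max (- g x) 0; pose gp x : R := Num.max (g x - 1) 0.
have gm0 x : 0 <= gm x by rewrite le_max lexx orbT.
have gp0 x : 0 <= gp x by rewrite le_max lexx orbT.
have mmax : measurable_fun setT (fun z : R => Num.max z 0) by exact: measurable_maxr.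
have sgm : smeas GH gm.
  apply: (smeas_comp mmax); move: (smeasB (@smeas_cst R T GH 0) sg).
  by rewrite (_ : (fun x => 0 - g x) = fun x => - g x)//; apply/funext => x; rewrite sub0r.
have sgp : smeas GH gp.
  by apply: (smeas_comp mmax); apply: smeasB => //; exact: smeas_cst.
have Egm : hasE P gm 0.
  pose N := g @^-1` [set z | z < 0].
  have GN : <<s GH >> N by apply: sg; rewrite -set_itvNyo; exact: measurable_itv.
  have hN := hasEN (gD N (sHL _ GN)).
  have hN' : hasE P gm (- fine (P (A `&` N))).
    apply: eq_hasE hN => x; rewrite /gm indicE.
    case: (boolP (x \in N)); rewrite ?inE ?notin_setE /N/= => h.
      by rewrite mulr1 max_l// oppr_ge0 ltW.
    by rewrite mulr0 oppr0 max_r// oppr_le0 leNgt; apply/negP.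
  have p0 : 0 <= fine (P (A `&` N)) by rewrite fine_ge0.
  suff <- : - fine (P (A `&` N)) = 0 by [].
  by apply/eqP; rewrite eq_le oppr_le0 p0/=; exact: hasE_ge0 hN' gm0.
have Egp : hasE P gp 0.
  pose N := g @^-1` [set z | 1 < z].
  have GN : <<s GH >> N by apply: sg; rewrite -set_itvoy; exact: measurable_itv.
  have mN := sHT _ GN.
  have hN := hasEB (gD N (sHL _ GN)) (hasE_indic P mN).
  have hN' : hasE P gp (fine (P (A `&` N)) - fine (P N)).
    apply: eq_hasE hN => x; rewrite /gp indicE.
    case: (boolP (x \in N)); rewrite ?inE ?notin_setE /N/= => h.
      by rewrite mulr1 max_l// subr_ge0 ltW.
    by rewrite mulr0 subr0 max_r// subr_le0 leNgt; apply/negP.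
  have p0 : fine (P (A `&` N)) <= fine (P N).
    have mAN : measurable (A `&` N) by exact: measurableI.
    by apply: fine_le; rewrite ?fin_num_measure//; apply: le_measure; rewrite ?inE.
  suff E : fine (P (A `&` N)) - fine (P N) = 0 by rewrite E in hN'.
  by apply/eqP; rewrite eq_le subr_le0 p0/=; exact: hasE_ge0 hN' gp0.
pose g' x := g x + gm x - gp x.
have g'01 x : 0 <= g' x <= 1.
  by rewrite /g' /gm /gp !maxEle; case: (leP (- g x) 0) => ?; case: (leP (g x - 1) 0) => ?; lra.
have sg' : smeas GH g' by apply: smeasB => //; exact: smeasD.
have mg' := smeas_measurable mGH sg'.
have null (f : T -> R) D : (forall x, 0 <= f x) -> hasE P f 0 -> measurable D ->
    hasE P (fun x => f x * \1_D x) 0.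
  move=> f0 hf mD.
  have fle y : f y * \1_D y <= f y.
    by rewrite ler_piMr// indicE; case: (_ \in _).
  have [v hv] : exists v, hasE P (fun x => f x * \1_D x) v.
    apply: integrable_hasE; apply: dom_integrable (proj1 hf).
      by apply: measurable_funM => //; exact: hasE_mfun hf.
    by move=> x; rewrite ger0_norm ?mulr_ge0.
  suff E : v = 0 by rewrite E in hv.
  apply/eqP; rewrite eq_le (hasE_le hv hf fle)/=; apply: hasE_ge0 hv _ => x.
  by rewrite mulr_ge0.
have WD D : <<s GH `|` GL >> D -> hasE P (fun x => (\1_A x - g' x) * \1_D x) 0.
  move=> GD; have mD := sHLT _ GD; have mAD : measurable (A `&` D) by exact: measurableI.
  have := hasEB (hasE_indic P mAD) (hasEB (hasED (gD D GD) (null _ _ gm0 Egm mD)) (null _ _ gp0 Egp mD)).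
  rewrite addr0 subr0 subrr; apply: eq_hasE => x; rewrite indicI/= /g'; ring.
have bnd x : `|\1_A x - g' x| <= 1.
  by have := g'01 x; rewrite indicE ler_norml; case: (_ \in _) => /=; lra.
have h1 : hasE P (fun x => (\1_A x - g' x) * V x) 0.
  apply: signed_weight0 => //.
    by move=> C mC; exact: (WD _ (sV C mC)).
  apply: (dom_integrable _ _ (hasE_norm hV)).
    by apply: measurable_funM => //; apply: measurable_funB.
  by move=> x /=; rewrite normrM ler_piMl.
have h2 : hasE P (fun x => V x * g' x) 0.
  apply: signed_weight0 => //.
    by move=> C mC; exact: (VH _ (sg' C mC)).
  apply: (dom_integrable _ _ (hasE_norm hV)); first exact: measurable_funM.
  move=> x /=; have /andP[? ?] := g'01 x.
  by rewrite normrM ler_piMr// ger0_norm.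
by have := hasED h1 h2; rewrite addr0; apply: eq_hasE => x; ring.
Qed.

End cond_indep_orthogonality.

(** * Almost sure equality and square integrability *)

Section expectation_ae.
Context {R : realType} {d : measure_display} {T : measurableType d}.
Variable P : probability T R.

Lemma hasE_ae (f g : T -> R) v : {ae P, forall x, f x = g x} ->
  measurable_fun setT g -> hasE P f v -> hasE P g v.
Proof.
move=> fg mg hf.
have mf := hasE_mfun hf.
have fgE : ae_eq P setT (EFin \o f) (EFin \o g).
  by apply: filterS fg => x /= -> _.
split.
  move: (proj1 hf) => /integrableP[_ foo]; apply/integrableP; split.
    exact/measurable_EFinP.
  suff <- : (\int[P]_x `|(f x)%:E| = \int[P]_x `|(g x)%:E|)%E by [].
  apply: ae_eq_integral => //.
  - by apply: measurableT_comp => //; exact/measurable_EFinP.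
  - by apply: measurableT_comp => //; exact/measurable_EFinP.
  - by apply: filterS fg => x /= -> _.
rewrite -(proj2 hf); apply/esym; apply: ae_eq_integral => //; exact/measurable_EFinP.
Qed.

Lemma sq_integrable_mul (X Y : T -> R) a b : measurable_fun setT X -> measurable_fun setT Y ->
  hasE P (fun x => X x ^+ 2) a -> hasE P (fun x => Y x ^+ 2) b ->
  P.-integrable setT (EFin \o (fun x => X x * Y x)).
Proof.
move=> mX mY hX hY; apply: (dom_integrable _ _ (proj1 (hasED hX hY))).
  exact: measurable_funM.
move=> x /=; rewrite normrM -(real_normK (num_real (X x))) -(real_normK (num_real (Y x))).
have := sqr_ge0 (`|X x| - `|Y x|); have := mulr_ge0 (normr_ge0 (X x)) (normr_ge0 (Y x)).
by rewrite !expr2; nra.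
Qed.

Lemma smeas_zero_ae (G : set (set T)) (W : T -> R) : G `<=` measurable -> smeas G W ->
  (forall D, <<s G >> D -> hasE P (fun x => W x * \1_D x) 0) ->
  {ae P, forall x, W x = 0}.
Proof.
move=> mG sW WD.
have mW := smeas_measurable mG sW.
have GN : <<s G >> (W @^-1` `]0, +oo[%classic) by apply: sW; exact: measurable_itv.
have GM : <<s G >> (W @^-1` `]-oo, 0[%classic) by apply: sW; exact: measurable_itv.
have : hasE P (fun x => `|W x|) 0.
  have := hasEB (WD _ GN) (WD _ GM); rewrite subr0; apply: eq_hasE => x.
  rewrite !indicE /=; have [x0|x0|->] := ltrgt0P (W x).
  - rewrite mem_set ?memNset ?mulr1 ?mulr0 ?subr0//= in_itv/= ?andbT//.
    by rewrite ltNge ltW.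
  - rewrite memNset ?mem_set ?mulr1 ?mulr0 ?sub0r//= in_itv/= ?andbT//.
    by rewrite ltNge ltW.
  - by rewrite !mul0r subr0.
move=> [_ /=] h.
have : ae_eq P setT (EFin \o W) (cst 0%E).
  apply/ae_eq_integral_abs => //; exact/measurable_EFinP.
by apply: filterS => x /(_ I) /= [].
Qed.

End expectation_ae.

(** * Optimality at a fixed time *)

Section rotation.
Context {R : realType} {n : nat} (U : 'M[R]_n).
Hypothesis UU : U^T *m U = 1%:M.

(** The entries of U^T x, on plain functions so that families of variables can be rotated. *)
Definition ocoord (x : 'I_n -> R) (i : 'I_n) : R := \sum_k U k i * x k.

Lemma ocoord_inv x k : \sum_i U k i * ocoord x i = x k.
Proof.
have UU' : U *m U^T = 1%:M by exact: mulmx1C.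
have := congr1 (fun M : 'M[R]_n => M *m (\col_j x j)) UU'.
rewrite mul1mx -mulmxA => /matrixP/(_ k ord0); rewrite !mxE => E; rewrite -E.
apply: eq_bigr => i _; rewrite mxE; congr (_ * _).
by apply: eq_bigr => l _; rewrite !mxE.
Qed.

Lemma ocoord_norm x : \sum_k x k ^+ 2 = \sum_i ocoord x i ^+ 2.
Proof.
transitivity (\sum_k \sum_i x k * (U k i * ocoord x i)).
  by apply: eq_bigr => k _; rewrite -mulr_sumr ocoord_inv expr2.
rewrite exchange_big; apply: eq_bigr => i _.
rewrite expr2 {2}/ocoord mulr_suml; apply: eq_bigr => k _.
by rewrite mulrCA mulrA.
Qed.

Lemma ocoordB x y i : ocoord (fun k => x k - y k) i = ocoord x i - ocoord y i.
Proof. by rewrite /ocoord -sumrB; apply: eq_bigr => k _; rewrite mulrBr. Qed.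

End rotation.

Section model_family.
Context {R : realType} {dO : measure_display} {Om : measurableType dO}.
Variable P : probability Om R.
Variables (d m : nat) (A : 'M[R]_d) (C : 'M[R]_(m, d)) (S0 Sw : 'M[R]_d) (Sv : 'M[R]_m).
Variables (th w : nat -> Om -> 'cV[R]_d) (nu Y : nat -> Om -> 'cV[R]_m) (t : nat).

Local Notation J := ('I_d + ('I_t * 'I_m))%type.

Definition obs_fam (j : J) (x : Om) : R := match j with
  | inl k => th t x k ord0
  | inr (s, l) => Y s.+1 x l ord0
  end.

Definition coefA (p : J -> R) : 'cV[R]_d := \col_k p (inl k).
(** The shift matches [Y s.+1] in [obs_fam]. Index 0 receives the value of index 1, which is
    harmless since only indices 1 to [t] are read. *)
Definition coefB (p : J -> R) (s : nat) : 'cV[R]_m :=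
  \col_l (if insub s.-1 is Some i then p (inr (i, l)) else 0).

Definition obsQ (p : J -> R) : R := Qf A C S0 Sw Sv t (coefA p) (coefB p).

Lemma obsQZ k p : obsQ (fun j => k * p j) = k ^+ 2 * obsQ p.
Proof.
rewrite /obsQ -QfZ; congr Qf; first by apply/matrixP => i j; rewrite !mxE.
apply/funext => s; apply/matrixP => i j; rewrite !mxE.
by case: insub => [i0|]; rewrite ?mulr0.
Qed.

Lemma lin_obs p x : lin obs_fam p x =
  dot (coefA p) (th t x) + \sum_(1 <= s < t.+1) dot (coefB p s) (Y s x).
Proof.
rewrite /lin big_sumType/=; congr (_ + _).
  by rewrite dotE; apply: eq_bigr => k _; rewrite mxE.
rewrite big_add1/= big_mkord.
transitivity (\sum_(s < t) \sum_(l < m) p (inr (s, l)) * Y s.+1 x l ord0).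
  by rewrite pair_bigA; apply: eq_bigr => -[s l] _.
apply: eq_bigr => s _; rewrite dotE; apply: eq_bigr => l _.
by rewrite mxE /= valK.
Qed.

Lemma hist_gen_fam : hist_gen Y t = fam_gen (fun i => obs_fam (inr i)).
Proof.
apply/seteqP; split => E.
  move=> [s [/andP[s1 st] [l [B mB ->]]]]; case: s s1 st => // s _ st.
  by exists (Ordinal st, l), B.
move=> [[s l] [B mB ->]]; exists s.+1; split; first by rewrite ltn_ord.
by exists l, B.
Qed.

Hypothesis model : lin_gauss_model P A C S0 Sw Sv th w nu Y.

Lemma obs_mgf p : hasE P (fun x => expR (lin obs_fam p x)) (expR (2^-1 * obsQ p)).
Proof. by apply: eq_hasE (model_mgf model t _ _) => x; rewrite lin_obs. Qed.

Let LG := latent_gen (th 0%N) w nu.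

Lemma latent_gen_measurable : LG `<=` measurable.
Proof.
have [[m0 [mw mnu]] _ _ _ _] := model.
rewrite /LG /latent_gen !subUset; split; first split.
- exact: vec_gen_measurable.
- by move=> E [s] /(vec_gen_measurable (mw s)).
- by move=> E [s [_]] /(vec_gen_measurable (mnu s)).
Qed.

Lemma smeas_th s k : smeas LG (fun x => th s x k ord0).
Proof.
have [_ _ _ thE _] := model.
elim: s k => [|s ih] k.
  by move=> B mB; apply: sub_sigma_algebra; left; left; exists k, B.
move=> B; rewrite (_ : (fun x => _) = (fun x =>
   \sum_l A k l * th s x l ord0 + w s x k ord0)); last first.
  by apply/funext => x; rewrite thE !mxE.
apply: smeasD.
  by apply: smeas_sum => l; apply: smeasM => //; exact: smeas_cst.
by move=> B' mB'; apply: sub_sigma_algebra; left; right; exists s, k, B'.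
Qed.

Lemma smeas_Y s l : (1 <= s)%N -> smeas LG (fun x => Y s x l ord0).
Proof.
have [_ _ _ _ YE] := model.
move=> s1 B; rewrite (_ : (fun x => _) = (fun x =>
   \sum_k C l k * th s x k ord0 + nu s x l ord0)); last first.
  by apply/funext => x; rewrite YE// !mxE.
apply: smeasD.
  by apply: smeas_sum => k; apply: smeasM; [exact: smeas_cst|exact: smeas_th].
by move=> B' mB'; apply: sub_sigma_algebra; right; exists s; split => //; exists l, B'.
Qed.

Lemma smeas_obs j : smeas LG (obs_fam j).
Proof. by case: j => [k|[s l]]; [exact: smeas_th|exact: smeas_Y]. Qed.

Lemma hist_gen_latent : hist_gen Y t `<=` <<s LG >>.
Proof.
rewrite hist_gen_fam => _ [i [B mB ->]]; exact: (@smeas_obs (inr i)).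
Qed.

Lemma hist_gen_measurable : hist_gen Y t `<=` measurable.
Proof.
move=> E /hist_gen_latent; apply: sub_sigma_measurable.
exact: latent_gen_measurable.
Qed.

End model_family.

Section diagonal_mgf.
Context {R : realType} {d : measure_display} {T : measurableType d}.
Variable P : probability T R.

Lemma diagonal_mgf1 n (X : 'I_n -> T -> R) (v : 'I_n -> R) :
  (forall b, hasE P (fun x => expR (lin X b x)) (\prod_i expR (2^-1 * (v i * b i ^+ 2)))) ->
  forall i a, hasE P (fun x => expR (a * X i x)) (expR (2^-1 * (a ^+ 2 * v i))).
Proof.
move=> h i a; have := h (fun j => a * delta i j).
rewrite (bigD1 i)//= /delta eqxx big1 => [|j /negPf ji]; last first.
  by rewrite ji mulr0 expr0n/= !mulr0 expR0.
rewrite !mulr1 [v i * _]mulrC; apply: eq_hasE => x.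
by rewrite linZ lin_delta.
Qed.

End diagonal_mgf.

Section rotated_regression.
Context {R : realType} {dT : measure_display} {T : measurableType dT}.
Variable P : probability T R.
Context {d : nat} {I : finType}.
Local Notation J := ('I_d + I)%type.
Variables (G : J -> T -> R) (Q : (J -> R) -> R).
Hypothesis mgfG : forall p, hasE P (fun x => expR (lin G p x)) (expR (2^-1 * Q p)).
Hypothesis QZ : forall k p, Q (fun i => k * p i) = k ^+ 2 * Q p.
Variable K : 'I_d -> I -> R.
Hypothesis KE : forall k j, covQ Q (inl k) (inr j) = \sum_i K k i * covQ Q (inr i) (inr j).
Variable U : 'M[R]_d.

Definition rot_coef (p : 'I_d -> J -> R) (i : 'I_d) (j : J) : R := \sum_k U k i * p k j.

Lemma lin_rot_coef p i x : lin G (rot_coef p i) x = ocoord U (fun k => lin G (p k) x) i.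
Proof. by rewrite /rot_coef lin_sum. Qed.

Definition predK (k : 'I_d) : J -> R := on_inr (K k).
Definition predZ i x : R := ocoord U (fun k => lin G (predK k) x) i.
Definition residR i x : R := ocoord U (fun k => lin G (resid K k) x) i.
(** Like [pred_cov], a function of [Q], [K] and [U] only, so it carries over to the space of a
    competing estimate. *)
Definition resid_var i : R := bil (covQ Q) (rot_coef (resid K) i) (rot_coef (resid K) i).
Definition pred_cov i j : R := bil (covQ Q) (rot_coef predK i) (rot_coef predK j).

Lemma lin_resid k x : lin G (resid K k) x = G (inl k) x - lin G (predK k) x.
Proof. by rewrite /resid linB lin_delta. Qed.

Lemma residRE i x : residR i x = ocoord U (fun k => G (inl k) x) i - predZ i x.
Proof.
by rewrite /predZ -ocoordB; congr ocoord; apply/funext => k; rewrite lin_resid.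
Qed.

Local Notation GH := (fam_gen (fun i => G (inr i))).

Lemma predZ_smeas i : smeas GH (predZ i).
Proof.
apply: smeas_sum => k; apply: smeasM; first exact: smeas_cst.
suff : smeas GH (lin G (predK k)) by [].
rewrite (_ : lin G _ = lin (fun i => G (inr i)) (K k)).
  by apply: smeas_lin => j; exact: (@smeas_fam _ _ _ (fun i => G (inr i)) j).
apply/funext => x; rewrite /lin big_sumType/= big1 ?add0r// => l _.
by rewrite mul0r.
Qed.

Lemma residR_cond i D : <<s GH >> D -> hasE P (fun x => residR i x * \1_D x) 0.
Proof.
move=> GD; have := hasE_sum (index_enum 'I_d) (fun k (_ : xpredT k) =>
  hasEZ (U k i) (resid_cond mgfG QZ KE k GD)).
rewrite big1 => [|k _]; last by rewrite mulr0.
apply: eq_hasE => x; rewrite /residR /ocoord mulr_suml.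
by apply: eq_bigr => k _; rewrite mulrA.
Qed.

Lemma residR_sqr i : hasE P (fun x => residR i x ^+ 2) (resid_var i).
Proof.
apply: eq_hasE (lin_cov mgfG QZ (rot_coef (resid K) i) (rot_coef (resid K) i)) => x.
by rewrite lin_rot_coef expr2.
Qed.

Lemma predZ_cov i j : hasE P (fun x => predZ i x * predZ j x) (pred_cov i j).
Proof.
by apply: eq_hasE (lin_cov mgfG QZ (rot_coef predK i) (rot_coef predK j)) => x;
  rewrite !lin_rot_coef.
Qed.

Variable lam : 'I_d -> R.
Hypothesis lamE : forall i j, pred_cov i j = lam i * (i == j)%:R.

Lemma predZ_sqr i : hasE P (fun x => predZ i x ^+ 2) (lam i).
Proof.
have := predZ_cov i i; rewrite lamE eqxx mulr1.
by apply: eq_hasE => x; rewrite expr2.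
Qed.

Lemma lam_ge0 i : 0 <= lam i.
Proof. by apply: hasE_ge0 (predZ_sqr i) _ => x; exact: sqr_ge0. Qed.

(** For the Gaussian family the mgf is a function of the second moment, so uncorrelated rotated
    predictions have a product mgf. *)
Lemma predZ_mgf b : hasE P (fun x => expR (lin predZ b x))
  (\prod_i expR (2^-1 * (lam i * b i ^+ 2))).
Proof.
pose p j := \sum_i b i * rot_coef predK i j.
have pE x : lin G p x = lin predZ b x.
  by rewrite lin_sum; apply: eq_bigr => i _; rewrite lin_rot_coef.
have QE : Q p = \sum_i lam i * b i ^+ 2.
  apply: hasE_unique (lin_sqr mgfG QZ p) _.
  have := hasE_sum (index_enum 'I_d) (fun i (_ : xpredT i) =>
    hasE_sum (index_enum 'I_d) (fun j (_ : xpredT j) =>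
      hasEZ (b i * b j) (predZ_cov i j))).
  congr hasE.
    apply/funext => x; rewrite pE expr2 /lin mulr_suml; apply: eq_bigr => i _.
    by rewrite mulr_sumr; apply: eq_bigr => j _; rewrite mulrACA.
  apply: eq_bigr => i _; rewrite (bigD1 i)//= lamE eqxx big1 => [|j ji].
    by rewrite addr0 mulr1 mulrC expr2.
  by rewrite lamE eq_sym (negPf ji) !mulr0.
rewrite -expR_sum -mulr_sumr -QE.
by apply: eq_hasE (mgfG p) => x; rewrite pE.
Qed.

Hypothesis UU : U^T *m U = 1%:M.
Variables (rho bet : 'I_d -> R) (eta : R).
Hypotheses (eta0 : 0 < eta) (rho0 : forall i, 0 < rho i) (rho1 : forall i, rho i <= 1).
Hypothesis rhoE : forall i, (1 - rho i) * (eta - 2 * rho i * lam i) = 0.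
Hypothesis betE : forall i, expR (- (2 * bet i)) = rho i.
Hypothesis lam_rho : forall i, 2 * rho i * lam i <= eta.
Variable GL : set (set T).
Hypotheses (mGL : GL `<=` measurable) (mGH : GH `<=` measurable).
Hypothesis sG : forall j, smeas GL (G j).

Let GHL : <<s GH >> `<=` <<s GL >> := fam_gen_sub (fun i => sG (inr i)).
Let mG j : measurable_fun setT (G j) := smeas_measurable mGL (sG j).

Let residR_smeas i : smeas GL (residR i).
Proof.
apply: smeas_sum => k; apply: smeasM; first exact: smeas_cst.
exact: smeas_lin.
Qed.

Let mR i : measurable_fun setT (residR i) := smeas_measurable mGL (residR_smeas i).
Let mZ i : measurable_fun setT (predZ i) := smeas_measurable mGH (predZ_smeas i).

Let residR_predZ i : hasE P (fun x => residR i x * predZ i x) 0.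
Proof.
apply: signed_weight0 => //.
  by move=> B mB; exact: (residR_cond i (predZ_smeas i mB)).
exact: (sq_integrable_mul (mR i) (mZ i) (residR_sqr i) (predZ_sqr i)).
Qed.

(** The residual is orthogonal both to the prediction and to the estimate, so the distortion is the
    residual variance plus E|Z - Y|^2, which the converse bounds with kap = (1 - rho) / eta. An
    infinite distortion is settled first; a finite one makes the estimate square integrable. *)
Lemma distortion_lower_bound (GX : set (set T)) (y : 'I_d -> T -> R) :
  GX `<=` measurable -> (forall k, smeas GX (y k)) ->
  cond_indep P GX GL GH ->
  (mutual_info P GX GH <= (\sum_i bet i)%:E)%E ->
  ((\sum_i (resid_var i + rho i * lam i))%:E <=
   \int[P]_x (\sum_k (G (inl k) x - y k x) ^+ 2)%:E)%E.
Proof.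
move=> mGX sy ci MI.
have my k : measurable_fun setT (y k) := smeas_measurable mGX (sy k).
pose f x := \sum_k (G (inl k) x - y k x) ^+ 2.
have mf : measurable_fun setT f.
  by apply: measurable_sum => k; apply: measurable_funX; exact: measurable_funB.
have f0 x : 0 <= f x by apply: sumr_ge0 => k _; exact: sqr_ge0.
have [foo|] := ltP (\int[P]_x (f x)%:E)%E +oo%E; last first.
  by rewrite leye_eq => /eqP ->; rewrite leey.
have [v hv] : exists v, hasE P f v.
  apply: integrable_hasE; apply/integrableP; split; first exact/measurable_EFinP.
  by under eq_integral do rewrite /= ger0_norm//.
rewrite -/(f _) (proj2 hv) lee_fin.
have fk k : exists v, hasE P (fun x => (G (inl k) x - y k x) ^+ 2) v.
  apply: integrable_hasE; apply: (dom_integrable _ _ (proj1 hv)).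
    by apply: measurable_funX; exact: measurable_funB.
  move=> x; rewrite ger0_norm ?sqr_ge0// /f (bigD1 k)//= lerDl.
  by apply: sumr_ge0 => j _; exact: sqr_ge0.
have gk k : exists v, hasE P (fun x => G (inl k) x ^+ 2) v.
  eexists; apply: eq_hasE (lin_sqr mgfG QZ (delta (inl k))) => x.
  by rewrite lin_delta.
have yk k : exists v, hasE P (fun x => y k x ^+ 2) v.
  have [u1 h1] := fk k; have [u2 h2] := gk k.
  apply: integrable_hasE.
  apply: (dom_integrable _ _ (proj1 (hasEZ 2 (hasED h1 h2)))); first exact: measurable_funX.
  move=> x; rewrite ger0_norm ?sqr_ge0//.
  have := sqr_ge0 (2 * G (inl k) x - y k x); rewrite !expr2; nra.
have /choice [yv yvP] := yk.
pose Yr i x := ocoord U (fun k => y k x) i.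
have sYr i : smeas GX (Yr i).
  by apply: smeas_sum => k; apply: smeasM => //; exact: smeas_cst.
have mYr i : measurable_fun setT (Yr i) := smeas_measurable mGX (sYr i).
have Yrk i : exists v, hasE P (fun x => Yr i x ^+ 2) v.
  apply: integrable_hasE.
  apply: (dom_integrable _ _ (proj1 (hasE_sum (index_enum 'I_d)
    (fun k (_ : xpredT k) => yvP k)))); first exact: measurable_funX.
  move=> x; rewrite ger0_norm ?sqr_ge0// /= (ocoord_norm UU) (bigD1 i)//= lerDl.
  by apply: sumr_ge0 => j _; exact: sqr_ge0.
have /choice [yy yyP] := Yrk.
have /choice [zy zyP] : forall i, exists v, hasE P (fun x => predZ i x * Yr i x) v.
  move=> i; apply: integrable_hasE.
  exact: (sq_integrable_mul (mZ i) (mYr i) (predZ_sqr i) (yyP i)).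
have ry i : hasE P (fun x => residR i x * Yr i x) 0.
  apply: (cond_indep_orth mGL mGH mGX ci) => //.
  - apply: smeasS (residR_smeas i); apply: smallest_sub; first exact: smallest_sigma_algebra.
    by move=> E HE; apply: sub_sigma_algebra; right.
  - by move=> D; exact: residR_cond.
  - exact: (sq_integrable_mul (mR i) (mYr i) (residR_sqr i) (yyP i)).
have vE : v = \sum_i (resid_var i + lam i + yy i - 2 * zy i).
  apply: hasE_unique hv _.
  have := hasE_sum (index_enum 'I_d) (fun i (_ : xpredT i) =>
    hasEB (hasED (hasED (hasED (residR_sqr i) (predZ_sqr i)) (yyP i))
      (hasEZ 2 (hasEB (residR_predZ i) (ry i)))) (hasEZ 2 (zyP i))).
  congr hasE; last by apply: eq_bigr => i _; rewrite subr0 mulr0 addr0.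
  apply/funext => x; rewrite /f (ocoord_norm UU); apply: eq_bigr => i _.
  rewrite ocoordB -/(Yr i x) -[ocoord U _ i](subrK (predZ i x)) -residRE; ring.
have := @mutual_info_converse _ _ _ P d GX GH Yr predZ lam (fun i => (1 - rho i) / eta)
  bet eta _ mGX mGH sYr predZ_smeas MI predZ_mgf lam_ge0 _ eta0 _ _ zy yy
  predZ_sqr zyP yyP.
have kap0 i : 0 <= (1 - rho i) / eta by rewrite divr_ge0 ?subr_ge0// ltW.
have ebet i : expR (2 * bet i) = (rho i)^-1.
  by rewrite -betE expRN invrK.
move=> /(_ kap0) h.
have {}h : \sum_i (- ((1 - rho i) / eta) * lam i + (2 * zy i - yy i) / eta + bet i)
    <= \sum_i bet i.
  apply: h => i; rewrite ebet.
    have r0 := rho0 i; have := rhoE i => /eqP; rewrite mulf_eq0 => /orP[|] /eqP rE.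
      have -> : rho i = 1 by lra.
      by rewrite subrr !mul0r mulr0 mul0r addr0 invr1.
    have e2 : eta = 2 * rho i * lam i by lra.
    have l0 : lam i != 0 by apply: contraTneq eta0 => l0; rewrite e2 l0 mulr0 ltxx.
    rewrite {1}e2; field; rewrite l0 gt_eqF//.
  by rewrite -ler_pdivrMr ?invr_gt0// invrK mulrAC lam_rho.
(* The capacity is the sum of the [bet i], so these cancel; the rest is multiplied by eta. *)
have {}h : \sum_i (2 * zy i - yy i) <= \sum_i (1 - rho i) * lam i.
  move: h; rewrite big_split/= gerDr -(ler_pM2r eta0) mul0r mulr_suml.
  rewrite -subr_ge0 sub0r -sumrN => h; rewrite -subr_ge0 -sumrB.
  apply: le_trans h _; rewrite le_eqVlt; apply/orP; left; apply/eqP.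
  by apply: eq_bigr => i _; field; rewrite gt_eqF.
rewrite vE -subr_ge0 -sumrB; move: h; rewrite -subr_ge0 -sumrB => /le_trans; apply.
by rewrite le_eqVlt; apply/orP; left; apply/eqP; apply: eq_bigr => i _; ring.
Qed.

Variable GE : set (set T).
Hypothesis mGE : GE `<=` measurable.
Hypothesis ind : indep2 P GE GL.
Variables (thb e : 'I_d -> T -> R).
Hypothesis sthb : forall k, smeas GH (thb k).
Hypothesis thb_ae : forall k, {ae P, forall x, thb k x = lin G (predK k) x}.
Hypothesis se : forall i, smeas GE (e i).
Hypothesis mgfe : forall b, hasE P (fun x => expR (lin e b x))
  (\prod_i expR (2^-1 * (psi lam rho i * b i ^+ 2))).

(** The channel is driven by the given version of the conditional expectation, which equals the
    linear predictor only almost surely; the facts on [predZ] are carried over to it. *)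
Definition predB i x : R := ocoord U (fun k => thb k x) i.

Let predB_smeas i : smeas GH (predB i).
Proof. by apply: smeas_sum => k; apply: smeasM => //; exact: smeas_cst. Qed.

Let mB i : measurable_fun setT (predB i) := smeas_measurable mGH (predB_smeas i).
Let me i : measurable_fun setT (e i) := smeas_measurable mGE (se i).

Let predB_ae : {ae P, forall x, forall i, predZ i x = predB i x}.
Proof.
have : {ae P, forall x, forall k, thb k x = lin G (predK k) x}.
  by apply: filter_forall => k; exact: thb_ae.
apply: filterS => x h i; rewrite /predZ /predB; congr ocoord.
by apply/funext => k; rewrite h.
Qed.

Let B_sqr i : hasE P (fun x => predB i x ^+ 2) (lam i).
Proof.
apply: hasE_ae (predZ_sqr i); last exact: measurable_funX.
by apply: filterS predB_ae => x ->.
Qed.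

Let B_mgf b : hasE P (fun x => expR (lin predB b x))
  (\prod_i expR (2^-1 * (lam i * b i ^+ 2))).
Proof.
apply: hasE_ae (predZ_mgf b).
  by apply: filterS predB_ae => x h; congr expR; apply: eq_bigr => i _; rewrite h.
apply: measurableT_comp => //; apply: measurable_sum => i.
exact: measurable_funM.
Qed.

Let e_mgf1 := diagonal_mgf1 mgfe.

Let e_sqr i : hasE P (fun x => e i x ^+ 2) (psi lam rho i).
Proof. by apply: mgf_second => a; exact: e_mgf1. Qed.

Let e_orth i (V : T -> R) v : smeas GL V -> hasE P (fun x => V x ^+ 2) v ->
  hasE P (fun x => e i x * V x) 0.
Proof.
move=> sV hV; apply: (indep_mean0 mGE mGL ind (se i) sV (e_mgf1 i)).
exact: (sq_integrable_mul (me i) (smeas_measurable mGL sV) (e_sqr i) hV).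
Qed.

Lemma channel_mutual_info (GX : set (set T)) : GX `<=` measurable ->
  <<s GX >> `<=` <<s fam_gen (chanY e predB rho) >> ->
  (mutual_info P GX GH <= (\sum_i bet i)%:E)%E.
Proof.
move=> mGX sGX.
apply: (@mutual_info_achieved _ _ _ P GE GL GH GX d e predB lam rho bet eta) => //.
- exact: lam_ge0.
- by move=> i; apply: e_orth (B_sqr i); exact: smeasS GHL (predB_smeas i).
Qed.

(** In rotated coordinates the error is R + rho Z - e with orthogonal terms, and rho^2 lam + (1 -
    rho) rho lam = rho lam. *)
Lemma channel_distortion (y : 'I_d -> T -> R) :
  (forall x i, ocoord U (fun k => y k x) i = chanY e predB rho i x) ->
  (\int[P]_x (\sum_k (G (inl k) x - y k x) ^+ 2)%:E =
    (\sum_i (resid_var i + rho i * lam i))%:E)%E.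
Proof.
move=> yE.
pose Rb i x := ocoord U (fun k => G (inl k) x) i - predB i x.
have RbE : {ae P, forall x, forall i, residR i x = Rb i x}.
  by apply: filterS predB_ae => x h i; rewrite residRE h.
have sRb i : smeas GL (Rb i).
  apply: smeasB; last exact: smeasS GHL (predB_smeas i).
  by apply: smeas_sum => k; apply: smeasM => //; exact: smeas_cst.
have mRb i : measurable_fun setT (Rb i) := smeas_measurable mGL (sRb i).
have Rb_sqr i : hasE P (fun x => Rb i x ^+ 2) (resid_var i).
  apply: hasE_ae (residR_sqr i); last exact: measurable_funX.
  by apply: filterS RbE => x ->.
have RbB i : hasE P (fun x => Rb i x * predB i x) 0.
  apply: hasE_ae (residR_predZ i); last exact: measurable_funM.
  by apply: filterS2 RbE predB_ae => x -> ->.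
have eR i := e_orth i (sRb i) (Rb_sqr i).
have eB i := e_orth i (smeasS GHL (predB_smeas i)) (B_sqr i).
suff [] : hasE P (fun x => \sum_k (G (inl k) x - y k x) ^+ 2)
    (\sum_i (resid_var i + rho i * lam i)) by [].
have := hasE_sum (index_enum 'I_d) (fun i (_ : xpredT i) =>
  hasED (hasED (hasED (hasED (hasED (Rb_sqr i) (hasEZ (rho i ^+ 2) (B_sqr i))) (e_sqr i))
   (hasEZ (2 * rho i) (RbB i))) (hasEZ (-2) (eR i))) (hasEZ (-2 * rho i) (eB i))).
congr hasE.
  apply/funext => x; rewrite (ocoord_norm UU); apply: eq_bigr => i _.
  by rewrite ocoordB yE /chanY -[ocoord U _ i](subrK (predB i x)) -/(Rb i x); ring.
by apply: eq_bigr => i _; rewrite /psi; ring.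
Qed.

End rotated_regression.

(** * Complementary slackness of the water level *)

Section water_filling.
Context {R : realType} {d : nat}.
Variables (lam : 'I_d -> R) (eta : R).
Hypotheses (lam0 : forall i, 0 <= lam i) (eta0 : 0 < eta).

Definition shrink i : R := expR (- (2 * capB lam eta i)).

Let capB2 i : 2 * capB lam eta i = Num.max (ln (2 * lam i / eta)) 0.
Proof. by rewrite /capB mulrA divff ?mul1r// pnatr_eq0. Qed.

Lemma shrink_gt0 i : 0 < shrink i.
Proof. exact: expR_gt0. Qed.

Lemma shrink_le1 i : shrink i <= 1.
Proof. by rewrite /shrink capB2 expR_le1 oppr_le0 le_max lexx orbT. Qed.

(** A coordinate either lies at or below the water level and gets no rate, or its remaining
    distortion rho lam equals eta / 2. *)
Let shrink_cases i :
  (shrink i = 1 /\ 2 * lam i <= eta) \/ eta = 2 * shrink i * lam i.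
Proof.
rewrite /shrink capB2; have [h|h] := leP (ln (2 * lam i / eta)) 0.
  left; rewrite oppr0 expR0; split=> //.
  have [l0|l0] := ltP 0 (lam i); last first.
    by apply: (@le_trans _ _ 0); [rewrite pmulr_rle0|exact: ltW].
  have p : 0 < 2 * lam i / eta by rewrite divr_gt0// mulr_gt0.
  move: h; rewrite -ln1 ler_ln ?posrE// ler_pdivrMr// mul1r//.
(* Here [ln] is 0 at 0, so a zero eigenvalue counts as inactive and a positive logarithm forces lam
   > 0. *)
right; have l0 : 0 < lam i.
  rewrite lt_neqAle lam0 andbT eq_sym; apply: contraTneq h => ->.
  by rewrite mulr0 mul0r ln0// ltxx.
rewrite expRN lnK ?posrE ?divr_gt0 ?mulr_gt0//.
by field; rewrite !gt_eqF.
Qed.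

Lemma shrinkE i : (1 - shrink i) * (eta - 2 * shrink i * lam i) = 0.
Proof.
case: (shrink_cases i) => [[-> _]|{1}->]; first by rewrite subrr mul0r.
by rewrite subrr mulr0.
Qed.

Lemma shrink_lam i : 2 * shrink i * lam i <= eta.
Proof. by case: (shrink_cases i) => [[-> ?]|<-//]; rewrite mulr1. Qed.

Lemma sum_capB (Bc : R) :
  \sum_(i < d) Num.max (ln (2 * lam i / eta)) 0 = 2 * Bc ->
  \sum_i capB lam eta i = Bc.
Proof.
by move=> h; rewrite /capB -mulr_sumr h mulrA mulVf ?mul1r// pnatr_eq0.
Qed.

End water_filling.

Section matrices.
Context {R : realType} {d : nat} (U : 'M[R]_d) (lam : 'I_d -> R) (eta : R).
Hypothesis UU : U^T *m U = 1%:M.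

Lemma ocoordE (x : 'cV[R]_d) i : ocoord U (fun k => x k ord0) i = (U^T *m x) i ord0.
Proof. by rewrite /ocoord mxE; apply: eq_bigr => k _; rewrite mxE. Qed.

Lemma qform_diag (D : 'rV[R]_d) (b : 'I_d -> R) :
  qform (U *m diag_mx D *m U^T) (U *m (\col_i b i)) = \sum_i D ord0 i * b i ^+ 2.
Proof.
rewrite /qform trmx_mul -!mulmxA (mulmxA U^T U) UU mul1mx.
rewrite (mulmxA U^T U) UU mul1mx mxE; apply: eq_bigr => i _.
rewrite mul_diag_mx !mxE; ring.
Qed.

Lemma ocoord_F_mx (x y : 'cV[R]_d) i :
  ocoord U (fun k => (F_mx U lam eta *m x + y) k ord0) i =
  (1 - shrink lam eta i) * ocoord U (fun k => x k ord0) i + ocoord U (fun k => y k ord0) i.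
Proof.
rewrite !ocoordE mulmxDr mxE; congr (_ + _).
by rewrite /F_mx !mulmxA UU mul1mx -mulmxA mul_diag_mx !mxE.
Qed.

End matrices.

Section conditional_expectation.
Context {R : realType} {dT : measure_display} {T : measurableType dT}.
Variable P : probability T R.
Context {d : nat} {I : finType}.
Local Notation J := ('I_d + I)%type.
Variables (G : J -> T -> R) (Q : (J -> R) -> R).
Hypothesis mgfG : forall p, hasE P (fun x => expR (lin G p x)) (expR (2^-1 * Q p)).
Hypothesis QZ : forall k p, Q (fun i => k * p i) = k ^+ 2 * Q p.
Variable K : 'I_d -> I -> R.
Hypothesis KE : forall k j, covQ Q (inl k) (inr j) = \sum_i K k i * covQ Q (inr i) (inr j).
Local Notation GH := (fam_gen (fun i => G (inr i))).
Hypothesis mGH : GH `<=` measurable.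
Variables (X Z : T -> 'cV[R]_d).
Hypothesis XE : forall k x, X x k ord0 = G (inl k) x.
Hypothesis ZE : is_cond_exp P X GH Z.

(** Both sides are history-measurable and have the same integral over each history event, the
    predictor because its residual has conditional mean 0. *)
Lemma cond_exp_ae k : {ae P, forall x, Z x k ord0 = lin G (predK K k) x}.
Proof.
have [sZ [iZ IZ]] := ZE k.
have mZ : measurable_fun setT (fun x => Z x k ord0) by exact: smeas_measurable mGH sZ.
have sH := sub_sigma_measurable mGH.
have sK : smeas GH (lin G (predK K k)).
  rewrite (_ : lin G _ = lin (fun i => G (inr i)) (K k)).
    by apply: smeas_lin => j; exact: (@smeas_fam _ _ _ (fun i => G (inr i)) j).
  apply/funext => x; rewrite /lin big_sumType/= big1 ?add0r// => l _.
  by rewrite mul0r.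
suff : {ae P, forall x, Z x k ord0 - lin G (predK K k) x = 0}.
  by apply: filterS => x /eqP; rewrite subr_eq0 => /eqP.
apply: (smeas_zero_ae mGH); first exact: smeasB.
move=> D GD; have mD := sH _ GD.
have hX : hasE P (fun x => G (inl k) x) 0.
  by apply: eq_hasE (lin_mean mgfG QZ (delta (inl k))) => x; rewrite lin_delta.
have ID (f : T -> R) : P.-integrable setT (EFin \o f) ->
    exists v, hasE P (fun x => f x * \1_D x) v.
  move=> fi; apply: integrable_hasE; apply: (dom_integrable _ _ (integrable_norm fi)).
    apply: measurable_funM; last exact: measurable_indic.
    exact/measurable_EFinP/(measurable_int _ fi).
  by move=> x /=; rewrite normrM ler_piMr// ger0_norm// indicE; case: (_ \in _).
have [v hv] := ID _ (proj1 hX); have [u hu] := ID _ iZ.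
have uv : u = v.
  apply: EFin_inj; rewrite -(proj2 hu) -(proj2 hv) !integral_indicM -IZ//.
  by apply: eq_integral => x _; rewrite XE.
have := hasED (hasEB hu hv) (resid_cond mgfG QZ KE k GD).
rewrite uv subrr addr0; apply: eq_hasE => x; rewrite lin_resid; ring.
Qed.

Let mZ k : measurable_fun setT (fun x => Z x k ord0).
Proof. by have [sZ _] := ZE k; exact: smeas_measurable mGH sZ. Qed.

Lemma cond_exp_cov k l :
  cov_mx P Z k l = bil (covQ Q) (predK K k) (predK K l).
Proof.
have mean0 i : mean_vec P Z i ord0 = 0.
  rewrite mxE; suff [_ ->] : hasE P (fun x => Z x i ord0) 0 by [].
  apply: hasE_ae (lin_mean mgfG QZ (predK K i)) => //.
  by apply: filterS (cond_exp_ae i) => x ->.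
rewrite mxE; suff [_ ->] : hasE P (fun x => (Z x k ord0 - mean_vec P Z k ord0) *
   (Z x l ord0 - mean_vec P Z l ord0)) (bil (covQ Q) (predK K k) (predK K l)) by [].
apply: hasE_ae (lin_cov mgfG QZ (predK K k) (predK K l)).
  by apply: filterS2 (cond_exp_ae k) (cond_exp_ae l) => x -> ->; rewrite !mean0 !subr0.
by apply: measurable_funM; apply: measurable_funB.
Qed.

Variables (U : 'M[R]_d) (lam : 'I_d -> R).
Hypothesis UU : U^T *m U = 1%:M.
Hypothesis eigU : cov_mx P Z *m U = U *m diag_mx (\row_i lam i).

(** Turns the eigenvector hypothesis on the covariance under [P] into a statement on [Q], which is
    usable on any other probability space. *)
Lemma pred_cov_eigen i j : pred_cov Q K U i j = lam i * (i == j)%:R.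
Proof.
have -> : pred_cov Q K U i j = \sum_k \sum_l U k i * U l j *
    bil (covQ Q) (predK K k) (predK K l).
  apply: hasE_unique (predZ_cov mgfG QZ K U i j) _.
  have := hasE_sum (index_enum 'I_d) (fun k (_ : xpredT k) =>
    hasE_sum (index_enum 'I_d) (fun l (_ : xpredT l) =>
      hasEZ (U k i * U l j) (lin_cov mgfG QZ (predK K k) (predK K l)))).
  apply: eq_hasE => x; rewrite /predZ /ocoord mulr_suml; apply: eq_bigr => k _.
  by rewrite mulr_sumr; apply: eq_bigr => l _; rewrite mulrACA.
have : (U^T *m (cov_mx P Z *m U)) i j = lam i * (i == j)%:R.
  by rewrite eigU mulmxA UU mul1mx !mxE mulr_natr.
move=> <-; rewrite mxE; apply: eq_bigr => k _; rewrite !mxE mulr_sumr.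
by apply: eq_bigr => l _; rewrite cond_exp_cov; ring.
Qed.

End conditional_expectation.

Section stage.
Context {R : realType} {dO : measure_display} {Om : measurableType dO}.
Variables (P : probability Om R) (d m t : nat).
Variables (A : 'M[R]_d) (C : 'M[R]_(m, d)) (S0 Sw : 'M[R]_d) (Sv : 'M[R]_m).
Variables (th w : nat -> Om -> 'cV[R]_d) (nu Y : nat -> Om -> 'cV[R]_m).
Hypothesis model : lin_gauss_model P A C S0 Sw Sv th w nu Y.
Variable thbar : Om -> 'cV[R]_d.
Hypothesis thbarE : is_cond_exp P (th t) (hist_gen Y t) thbar.
Variables (lam : 'I_d -> R) (U : 'M[R]_d) (eta Bc : R) (eps : Om -> 'cV[R]_d).
Hypothesis UU : U^T *m U = 1%:M.
Hypothesis eigU : cov_mx P thbar *m U = U *m diag_mx (\row_i lam i).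
Hypothesis eta0 : 0 < eta.
Hypothesis etaE : \sum_(i < d) Num.max (ln (2 * lam i / eta)) 0 = 2 * Bc.
Hypothesis meps : rv_vec eps.
Hypothesis geps : is_gaussian P eps 0 (Psi_mx U lam eta).
Hypothesis ieps : indep2 P (vec_gen eps) (latent_gen (th 0%N) w nu).

Local Notation G := (@obs_fam R _ Om d m th Y t).
Local Notation Q := (@obsQ R d m A C S0 Sw Sv t).
Local Notation GH := (fam_gen (fun i => G (inr i))).
Local Notation GL := (latent_gen (th 0%N) w nu).
Local Notation rho := (shrink lam eta).
Local Notation bet := (capB lam eta).

Let thh x : 'cV[R]_d := F_mx U lam eta *m thbar x + eps x.
Let e i x : R := ocoord U (fun k => eps x k ord0) i.
Let thb k x : R := thbar x k ord0.

Let mgfG p : hasE P (fun x => expR (lin G p x)) (expR (2^-1 * Q p)).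
Proof. exact: obs_mgf model p. Qed.

Let QZ k p : Q (fun i => k * p i) = k ^+ 2 * Q p.
Proof. exact: obsQZ. Qed.

Let mGL : GL `<=` measurable.
Proof. exact: latent_gen_measurable model. Qed.

Let mGH : GH `<=` measurable.
Proof. by rewrite -hist_gen_fam; exact: (hist_gen_measurable (t := t) model). Qed.

Let thbarE' : is_cond_exp P (th t) GH thbar.
Proof. by rewrite -hist_gen_fam. Qed.

Let K_ex : exists K : 'I_d -> 'I_t * 'I_m -> R, forall k j,
  covQ Q (inl k) (inr j) = \sum_i K k i * covQ Q (inr i) (inr j).
Proof. by have /choice [K KE] := normal_equations mgfG QZ; exists K. Qed.

Let sthb k : smeas GH (thb k).
Proof. by have [] := thbarE' k. Qed.

Let mthb k : measurable_fun setT (thb k) := smeas_measurable mGH (sthb k).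

Let seps k : smeas (vec_gen eps) (fun x => eps x k ord0).
Proof. exact: smeas_coord. Qed.

Let se i : smeas (vec_gen eps) (e i).
Proof. by apply: smeas_sum => k; apply: smeasM => //; exact: smeas_cst. Qed.

Let mGE : vec_gen eps `<=` measurable.
Proof. exact: vec_gen_measurable. Qed.

Let mgfe b : hasE P (fun x => expR (lin e b x))
  (\prod_i expR (2^-1 * (psi lam rho i * b i ^+ 2))).
Proof.
have := gaussian_mgf (U *m (\col_i b i)) meps geps.
rewrite qform_diag// mulr_sumr expR_sum => h.
rewrite (eq_bigr (fun i => expR (2^-1 * ((\row_i ((1 - expR (- (2 * capB lam eta i)))
  * expR (- (2 * capB lam eta i)) * lam i)) ord0 i * b i ^+ 2)))); last first.
  by move=> i _; rewrite mxE.
apply: eq_hasE h => x; congr expR.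
rewrite dotE /lin; under [RHS]eq_bigr do rewrite /e /ocoord mulr_sumr.
rewrite exchange_big; apply: eq_bigr => k _; rewrite !mxE mulr_suml.
by apply: eq_bigr => i _; rewrite !mxE; ring.
Qed.

Let thhE x i : ocoord U (fun k => thh x k ord0) i = chanY e (predB U thb) rho i x.
Proof. exact: ocoord_F_mx. Qed.

Let thh_chan k x : thh x k ord0 = \sum_i U k i * chanY e (predB U thb) rho i x.
Proof.
rewrite -[LHS](ocoord_inv UU (fun k => thh x k ord0)).
by apply: eq_bigr => i _; rewrite thhE.
Qed.

Let mthh : rv_vec thh.
Proof.
move=> k; rewrite (_ : (fun x => _) = (fun x => \sum_l F_mx U lam eta k l * thb l x + eps x k ord0)).
  apply: measurable_funD => //; apply: measurable_sum => l.
  exact: measurable_funM.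
by apply/funext => x; rewrite !mxE.
Qed.

Let sGH : <<s GH >> `<=` <<s GL >>.
Proof.
apply: smallest_sub; first exact: smallest_sigma_algebra.
by rewrite -hist_gen_fam; exact: (hist_gen_latent (t := t) model).
Qed.

Lemma stage_feasible : [/\ rv_vec thh,
  cond_indep P (vec_gen thh) GL (hist_gen Y t) &
  (mutual_info P (vec_gen thh) (hist_gen Y t) <= Bc%:E)%E].
Proof.
have [K KE] := K_ex.
have lamE := pred_cov_eigen mgfG QZ KE mGH (fun _ _ => erefl) thbarE' UU eigU.
have lam0 := lam_ge0 mgfG QZ lamE.
rewrite (hist_gen_fam th); split=> //.
  apply: (noise_cond_indep mGE mGL mGH ieps).
    by move=> E HE; apply: sGH; exact: sub_sigma_algebra.
  apply: (fam_gen_sub (X := fun k x => thh x k ord0)) => k.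
  rewrite (_ : (fun x => _) = (fun x => \sum_l F_mx U lam eta k l * thb l x + eps x k ord0)).
    have sub1 : <<s GH >> `<=` <<s vec_gen eps `|` GH >>.
      apply: smallest_sub; first exact: smallest_sigma_algebra.
      by move=> E HE; apply: sub_sigma_algebra; right.
    have sub2 : <<s vec_gen eps >> `<=` <<s vec_gen eps `|` GH >>.
      apply: smallest_sub; first exact: smallest_sigma_algebra.
      by move=> E HE; apply: sub_sigma_algebra; left.
    apply: smeasD; last exact: smeasS sub2 (seps k).
    apply: smeas_sum => l; apply: smeasM; first exact: smeas_cst.
    exact: smeasS sub1 (sthb l).
  by apply/funext => x; rewrite !mxE.
rewrite -(sum_capB etaE).
apply: (@channel_mutual_info _ _ _ P d _ G Q mgfG QZ K U lam lamE rho bet eta eta0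
  (shrink_gt0 lam eta) (shrink_le1 lam eta) (shrinkE lam0 eta0) _ GL mGL mGH
  (smeas_obs (t := t) model) (vec_gen eps) mGE ieps thb e sthb _ se mgfe) => //.
- by move=> k; exact: (cond_exp_ae mgfG QZ KE mGH (fun _ _ => erefl) thbarE').
- exact: vec_gen_measurable.
apply: (fam_gen_sub (X := fun k x => thh x k ord0)) => k.
rewrite (_ : (fun x => _) = (fun x => \sum_i U k i * chanY e (predB U thb) rho i x)).
  apply: smeas_sum => i; apply: smeasM; first exact: smeas_cst.
  exact: (@smeas_fam _ _ _ (chanY e (predB U thb) rho) i).
by apply/funext => x; exact: thh_chan.
Qed.

(** The value attained under [P] and the lower bound under [P'] are one and the same expression in
    [Q], [K], [U], [lam]: the bound is applied on [P'] with the data found on [P]. *)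
Lemma stage_optimal (dO' : measure_display) (Om' : measurableType dO')
    (P' : probability Om' R) (th' w' : nat -> Om' -> 'cV[R]_d)
    (nu' Y' : nat -> Om' -> 'cV[R]_m) (thh' : Om' -> 'cV[R]_d) :
  lin_gauss_model P' A C S0 Sw Sv th' w' nu' Y' -> rv_vec thh' ->
  cond_indep P' (vec_gen thh') (latent_gen (th' 0%N) w' nu') (hist_gen Y' t) ->
  (mutual_info P' (vec_gen thh') (hist_gen Y' t) <= Bc%:E)%E ->
  (\int[P]_x (\sum_(i < d) (th t x i ord0 - thh x i ord0) ^+ 2)%:E <=
   \int[P']_x (\sum_(i < d) (th' t x i ord0 - thh' x i ord0) ^+ 2)%:E)%E.
Proof.
move=> model' mthh'; rewrite (hist_gen_fam th') => ci MI.
have [K KE] := K_ex.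
have lamE := pred_cov_eigen mgfG QZ KE mGH (fun _ _ => erefl) thbarE' UU eigU.
have lam0 := lam_ge0 mgfG QZ lamE.
have thb_ae k := cond_exp_ae mgfG QZ KE mGH (fun _ _ => erefl) thbarE' k.
have := @channel_distortion _ _ _ P d _ G Q mgfG QZ K KE U lam lamE UU rho GL mGL mGH
  (smeas_obs (t := t) model) (vec_gen eps) mGE ieps thb e sthb thb_ae se mgfe
  (fun k x => thh x k ord0) thhE.
move=> ->; rewrite -(sum_capB etaE) in MI.
have mGH' : fam_gen (fun i => @obs_fam R _ Om' d m th' Y' t (inr i)) `<=` measurable.
  by rewrite -hist_gen_fam; exact: (hist_gen_measurable (t := t) model').
apply: (@distortion_lower_bound _ _ _ P' d _ (@obs_fam R _ Om' d m th' Y' t) Q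
  (obs_mgf model') QZ K KE U lam lamE UU rho bet eta eta0
  (shrink_gt0 lam eta) (shrink_le1 lam eta) (shrinkE lam0 eta0) _ (shrink_lam lam0 eta0)
  _ (latent_gen_measurable model') mGH' (smeas_obs (t := t) model') (vec_gen thh')) => //.
- exact: vec_gen_measurable.
- by move=> k; exact: smeas_coord.
Qed.

End stage.

Theorem theorem2 (R : realType) (d m T : nat) (Bc : R)
  (A : 'M[R]_d) (C : 'M[R]_(m, d)) (S0 Sw : 'M[R]_d) (Sv : 'M[R]_m)
  (hT : (1 <= T)%N) (hB : 0 < Bc)
  (dO : measure_display) (Om : measurableType dO) (P : probability Om R)
  (th w : nat -> Om -> 'cV[R]_d) (nu Y : nat -> Om -> 'cV[R]_m)
  (hmod : lin_gauss_model P A C S0 Sw Sv th w nu Y)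
  (thbar : nat -> Om -> 'cV[R]_d)
  (hbar : forall t, (1 <= t <= T)%N -> is_cond_exp P (th t) (hist_gen Y t) (thbar t))
  (lam : nat -> 'I_d -> R) (U : nat -> 'M[R]_d)
  (hU : forall t, (1 <= t <= T)%N ->
     (U t)^T *m U t = 1%:M /\
     cov_mx P (thbar t) *m U t = U t *m diag_mx (\row_i lam t i))
  (eta : nat -> R)
  (heta : forall t, (1 <= t <= T)%N ->
     0 < eta t /\ \sum_(i < d) Num.max (ln (2 * lam t i / eta t)) 0 = 2 * Bc)
  (eps : nat -> Om -> 'cV[R]_d)
  (heps : forall t, (1 <= t <= T)%N ->
     [/\ rv_vec (eps t),
         is_gaussian P (eps t) 0 (Psi_mx (U t) (lam t) (eta t)) &
         indep2 P (vec_gen (eps t)) (latent_gen (th 0%N) w nu)]) :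
  let thh := fun t x => F_mx (U t) (lam t) (eta t) *m thbar t x + eps t x in
  feasible P T Bc th w nu Y thh /\
  forall (dO' : measure_display) (Om' : measurableType dO') (P' : probability Om' R)
         (th' w' : nat -> Om' -> 'cV[R]_d) (nu' Y' : nat -> Om' -> 'cV[R]_m)
         (thh' : nat -> Om' -> 'cV[R]_d),
    lin_gauss_model P' A C S0 Sw Sv th' w' nu' Y' ->
    feasible P' T Bc th' w' nu' Y' thh' ->
    (sq_obj P T th thh <= sq_obj P' T th' thh')%E.
Proof.
move=> thh; split.
  move=> t ht; have [UU eigU] := hU t ht; have [eta0 etaE] := heta t ht.
  have [meps geps ieps] := heps t ht.
  exact: (stage_feasible hmod (hbar t ht) UU eigU eta0 etaE meps geps ieps).
move=> dO' Om' P' th' w' nu' Y' thh' model' feas'.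
(* Constraints and costs separate over time, so it suffices to compare the objectives term by
   term. *)
rewrite /sq_obj big_nat_cond [leRHS]big_nat_cond; apply: lee_sum => t /andP[ht _].
have [UU eigU] := hU t ht; have [eta0 etaE] := heta t ht.
have [meps geps ieps] := heps t ht; have [mthh' ci MI] := feas' t ht.
exact: (stage_optimal hmod (hbar t ht) UU eigU eta0 etaE meps geps ieps model' mthh' ci MI).
Qed.
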